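(* Let $D_\circ$ be any hollow dissection. The collection of cones \[ \mathcal{G}(D_\circ) := \bigl\{\, \mathbb{R}_{\ge 0}\{\mathbf{g}(D_\circ \mid \delta_\bullet) : \delta_\bullet \in D_\bullet\} \;:\; D_\bullet \text{ a } D_\circ\text{-accordion dissection} \,\bigr\} \] forms a complete simplicial fan in $\mathbb{R}^{D_\circ}$ (called the $\mathbf{g}$-vector fan of $D_\circ$).
   Context: Fix $n\ge 2$ and $2n$ points on the unit circle of the (standardly oriented) Euclidean plane, labeled $1,\dots,2n$ in clockwise order (labels modulo $2n$). Odd-labeled points are hollow, even-labeled points are solid. The hollow polygon $P_\circ$ (resp. solid polygon $P_\bullet$) is the convex hull of the hollow (resp. solid) points. A hollow (resp. solid) diagonal is a segment joining two hollow (resp. two solid) points; edges of the polygon (boundary edges) count as diagonals, the others are internal. Two segments cross if they meet at a point interior to both. A hollow (resp. solid) dissection is a set of pairwise non-crossing internal hollow (resp. solid) diagonals; its cells are the closures of the connected components of the polygon minus its diagonals; $\overline{D}$ denotes $D$ together with all boundary edges of its polygon. For a hollow dissection $D_\circ$, a solid diagonal $\delta_\bullet$ is a $D_\circ$-accordion diagonal if the union of the segments of $\overline{D_\circ}$ crossed by $\delta_\bullet$ is connected. A $D_\circ$-accordion dissection is a solid dissection consisting of (internal) $D_\circ$-accordion diagonals (the empty set included). Sign function: let $R$ be a dissection of one of the two polygons, $r\in R$, and $e$ a diagonal of the other polygon. Set $\zeta_R(r,e)=0$ if $e$ does not cross $r$. Otherwise, in each of the two cells of $R$ containing $r$, $e$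 crosses exactly one other segment of $\overline{R}$; call them $\mu$ and $\nu$. If $\mu$ and $\nu$ are incident to distinct endpoints of $r$, write $r=uv$, $\mu=au$, $\nu=vb$, and set $\zeta_R(r,e)=1$ if $a$ lies strictly to the right of the directed line from $u$ to $v$ (the path $a\,u\,v\,b$ forms a ''Z''), and $\zeta_R(r,e)=-1$ if $a$ lies strictly to the left (an ''S''); this does not depend on which endpoint is called $u$. In all other cases $\zeta_R(r,e)=0$. For a hollow dissection $D_\circ$, $\mathbb{R}^{D_\circ}$ has canonical basis $(\mathbf{e}_{\delta_\circ})_{\delta_\circ\in D_\circ}$, and the $\mathbf{g}$-vector of a solid diagonal $\delta_\bullet$ is $\mathbf{g}(D_\circ\mid\delta_\bullet)=\sum_{\delta_\circ\in D_\circ}\zeta_{D_\circ}(\delta_\circ,\delta_\bullet)\,\mathbf{e}_{\delta_\circ}$. A simplicial fan means each cone is generated by a linearly independent set; complete means the union of the cones is the whole space. *)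

(* Defs.v *)
From HB Require Import structures.
From mathcomp Require Import all_boot all_order all_algebra.
From mathcomp Require Import all_classical all_reals all_analysis.
Set Implicit Arguments.
Unset Strict Implicit.
Unset Printing Implicit Defensive.
Import Order.TTheory GRing.Theory Num.Theory.
Import numFieldNormedType.Exports.
Local Open Scope classical_set_scope.
Local Open Scope ring_scope.

Section Fans.
Variables (R : realType) (V : vectType R).
Implicit Types (s : seq V) (C F : set V) (G : set (set V)).

Definition cone s : set V :=
  [set x | exists2 c : 'I_(size s) -> R,
     (forall i, 0 <= c i) & x = \sum_(i < size s) c i *: s`_i].

Definition polyhedral_cone C := exists s, C = cone s.

(* With f = 0, a cone is a face of itself. *)
Definition face F C :=
  exists f : {scalar V},
    (forall x, C x -> 0 <= f x) /\ F = C `&` [set x | f x = 0].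

Definition is_fan G :=
  [/\ finite_set G,
      (forall C, G C -> polyhedral_cone C),
      (forall C F, G C -> face F C -> G F) &
      (forall C C', G C -> G C' ->
         face (C `&` C') C /\ face (C `&` C') C')].

Definition simplicial_cone C := exists2 s, free s & C = cone s.

Definition complete_simplicial_fan G :=
  [/\ is_fan G, (forall C, G C -> simplicial_cone C) &
      \bigcup_(C in G) C = [set: V]].

End Fans.

(* The index i : 'I_(2 * n) stands for the label i if i > 0, and the index 0  *)
(* for the label 2n; hence odd labels are odd indices.                        *)
Notation label n := 'I_(2 * n).
(* A segment joining two of the points is the pair of labels of its ends.     *)
Notation diag n := {set label n}.

Section Accordions.
Variables (R : realType) (n : nat).

Local Notation plane := (R * R)%type.

(* Positive iff c lies strictly to the left of the directed line from a to b. *)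
Definition orient (a b c : plane) : R :=
  (b.1 - a.1) * (c.2 - a.2) - (b.2 - a.2) * (c.1 - a.1).

(* Points of the circle are in clockwise order iff so are all the triangles   *)
(* they form, when their vertices are listed in this order.                   *)
Definition clockwise_on_circle (p : label n -> plane) :=
  (forall i, (p i).1 ^+ 2 + (p i).2 ^+ 2 = 1) /\
  (forall i j k : label n, (i < j < k)%N -> orient (p i) (p j) (p k) < 0).

Variable p : label n -> plane.
Implicit Types (A d e r : diag n) (D : {set diag n}) (b : bool).

Definition hull A : set plane :=
  [set x | exists w : label n -> R,
     [/\ forall i, 0 <= w i, \sum_(i in A) w i = 1
       & x = \sum_(i in A) w i *: p i]].

(* For a pair of labels, the segment without its ends. *)
Definition open_hull A : set plane :=
  [set x | exists w : label n -> R,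
     [/\ forall i, 0 < w i, \sum_(i in A) w i = 1
       & x = \sum_(i in A) w i *: p i]].

Definition cross d e := open_hull d `&` open_hull e !=set0.

(* The colour b is true for hollow and false for solid. *)
Definition polygon b : set plane := hull [set i : label n | odd i == b]%SET.

Definition diagonal b d := (#|d| == 2%N) && [forall i in d, odd i == b].

Definition boundary b d :=
  diagonal b d &&
  [exists i in d, exists j in d, (j == i + 2 %[mod 2 * n])%N].

Definition internal b d := diagonal b d && ~~ boundary b d.

Definition dissection b D :=
  (forall d, d \in D -> internal b d) /\
  (forall d e, d \in D -> e \in D -> d != e -> ~ cross d e).

Definition overline b D : {set diag n} :=
  (D :|: [set d | boundary b d])%SET.

Definition cut_polygon b D : set plane :=
  polygon b `\` \bigcup_(d in [set` D]) hull d.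

Definition cell b D (C : set plane) :=
  exists2 x, cut_polygon b D x &
    C = closure (connected_component (cut_polygon b D) x).

Definition accordion_diagonal D e :=
  diagonal false e /\
  connected
    (\bigcup_(d in [set d | d \in overline true D /\ cross d e]) hull d).

Definition accordion_dissection D D' :=
  dissection false D' /\ (forall e, e \in D' -> accordion_diagonal D e).

(* In a cell C containing r, there is exactly one such s when e crosses r.    *)
Definition crossed_side b D r e (C : set plane) (s : diag n) :=
  [/\ cell b D C /\ hull r `<=` C, s \in overline b D, s != r, cross e s &
      hull s `<=` C].

(* The orientation of the triangle u v a is required to satisfy P: negative   *)
(* for a "Z", positive for an "S".                                            *)
Definition bent_path (P : pred R) b D r e :=
  cross e r /\
  exists (C C' : set plane) (u v a c : label n),
    [/\ C <> C', u != v /\ r = [set u; v]%SET,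
        crossed_side b D r e C [set a; u]%SET,
        crossed_side b D r e C' [set v; c]%SET &
        P (orient (p u) (p v) (p a))].

Definition zeta b D r e : R :=
  if `[< bent_path (fun t => t < 0) b D r e >] then 1
  else if `[< bent_path (fun t => 0 < t) b D r e >] then -1
  else 0.

Definition gvector D e : {ffun {d : diag n | d \in D} -> R^o} :=
  [ffun d => zeta true D (val d) e].

Definition gfan D : set (set {ffun {d : diag n | d \in D} -> R^o}) :=
  [set C | exists2 D', accordion_dissection D D' &
     C = cone [seq gvector D e | e <- enum D']].

End Accordions.

Arguments gfan {R n} p D.

(* Main.v *)
(* A family of vectors generates a complete simplicial fan as soon as every vector
   is, in a unique way, a nonnegative combination of a compatible subfamily. So one
   has to show that each x in R^D is uniquely a nonnegative combination, with
   noncrossing support, of the g-vectors of the internal accordion diagonals.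

   Complete D to a triangulation m of the hollow points. A weight w on the solid
   diagonals has a shear coordinate at each diagonal ac of m, with adjacent triangles
   abc and acd: the weight of the diagonals separating {a,d} from {b,c} minus the
   weight of those separating {a,b} from {c,d}. For an accordion diagonal it is zeta
   at the diagonals of D and 0 at the other ones, and a solid diagonal whose shear
   coordinates vanish outside D is an accordion diagonal.

   Uniqueness. Let I(h,k) be the weight of the diagonals crossing hk. It determines
   w (by second differences) and, for a noncrossing w, satisfies
     I(a,c) + I(b,d) = max (I(a,b) + I(c,d), I(a,d) + I(b,c)),
   hence is determined by its values on m. Two weights with the same shear
   coordinates have crossing functions which differ on m, hence everywhere, by
   l(h) + l(k) for some function l, and this does not affect second differences.

   Existence. The chords obtained from a diagonal of m by rotating both of its ends
   to the next, or to the previous, solid points have opposite shear coordinates,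
   supported by this diagonal; so some nonnegative weight has prescribed shear
   coordinates. Two crossing solid diagonals can be uncrossed in two ways, one of
   which keeps the shear coordinates, so a weight that is minimal for a cost which
   decreases at each uncrossing is noncrossing. The coordinates at the diagonals of
   m outside D being 0, they vanish for each of the diagonals of its support, as two
   diagonals with opposite signs at ac would cross. *)
From HB Require Import structures.
From mathcomp Require Import all_boot all_order all_algebra.
From mathcomp Require Import all_classical all_reals all_analysis.
From mathcomp Require Import ring lra zify.
Require Import Defs.
Set Implicit Arguments.
Unset Strict Implicit.
Unset Printing Implicit Defensive.
Import Order.TTheory GRing.Theory Num.Theory.
Import numFieldNormedType.Exports.
Local Open Scope classical_set_scope.
Local Open Scope ring_scope.

(** * Order tautologies *)

Section OrderTautologies.
Local Open Scope nat_scope.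

(** The obstacle is that [zeta] and the shear coordinates look at different things: [zeta] at the
    sides of the cells of D that a diagonal crosses, a shear coordinate at the sides of the two
    triangles of m along ac. The bridge is [linked], a combinatorial form of connectedness:
    noncrossing chords meet only at common ends, so the crossed chords of D must be joined through
    such ends. If the diagonal crosses uv and leaves the triangle uvb through ub, this forces the
    next side of the cell that it crosses to start at u as well. Geometry enters only through signs
    of [orient]. The rest is about the linear order of the labels: a statement on at most six of
    them is checked on all their weak orders, and larger configurations are assembled from such
    statements. Hollow labels being odd and solid ones even, the ends of a solid diagonal never
    coincide with hollow points. The function l appears because, on the chords of m, the sums l(h) +
    l(k) are exactly the functions whose alternating sum over the sides of every quadrilateral is 0.
    Uncrossing may create edges of the solid polygon. They have no shear coordinates and are
    discarded at the end. *)

Fixpoint ltr (a b : nat) : bool :=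
  match a, b with _, 0 => false | 0, _.+1 => true | a'.+1, b'.+1 => ltr a' b' end.
Fixpoint all_below (P : nat -> bool) m : bool :=
  if m is m'.+1 then if P m' then all_below P m' else false else true.
Definition lt_in (lt : rel nat) s : rel nat := fun i j =>
  if onth s i is Some a then if onth s j is Some b then lt a b else false
  else false.

(* [order_check F k 0 [::]] evaluates [F] on all the weak orders of [k] variables,
   each represented by the ranks [t] of its variables, which are inserted one at
   a time. *)
Fixpoint order_check (F : rel nat -> bool) k m (t : seq nat) : bool :=
  if k is k'.+1 then
    if all_below (fun q => order_check F k' m (q :: t)) m then
      all_below (fun q => order_check F k' m.+1
        (q :: map (fun x => if ltr x q then x else x.+1) t)) m.+1
    else false
  else F (lt_in ltr t).

Arguments all_below : simpl never.

Lemma ltrE a b : ltr a b = (a < b).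
Proof. by elim: a b => [|a IH] [|b] //=; rewrite IH. Qed.

Lemma all_belowP P m q : all_below P m -> q < m -> P q.
Proof.
rewrite /all_below; elim: m => //= m IH; case E: (P m) => // /IH h.
by rewrite ltnS leq_eqVlt => /predU1P[->|].
Qed.

Lemma isotone_cons x q s t : size s = size t ->
  (forall i j, i < size s -> j < size s ->
     ((nth 0 s i < nth 0 s j) = (nth 0 t i < nth 0 t j))) ->
  (forall i, i < size s -> ((x < nth 0 s i) = (q < nth 0 t i)) /\
     ((nth 0 s i < x) = (nth 0 t i < q))) ->
  forall i j, i < size (x :: s) -> j < size (x :: s) ->
    (nth 0 (x :: s) i < nth 0 (x :: s) j) = (nth 0 (q :: t) i < nth 0 (q :: t) j).
Proof.
move=> st h1 h2 [|i] [|j] /=; rewrite ?ltnS ?ltnn //.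
- by move=> _ /h2[].
- by move=> /h2[].
- exact: h1.
Qed.

Lemma order_check_sound F s0 s t m : size s = size t ->
  (forall i, i < size s -> nth 0 t i < m) ->
  (forall i j, i < size s -> j < size s ->
     ((nth 0 s i < nth 0 s j) = (nth 0 t i < nth 0 t j))) ->
  order_check F (size s0) m t -> F (lt_in ltn (catrev s0 s)).
Proof.
elim: s0 s t m => [|x s0 IH] s t m st tm h /=.
  congr (is_true (F _)); apply/funext => i; apply/funext => j.
  rewrite /lt_in; case: (ltnP i (size s)) => [i_s|si]; last first.
    by rewrite !onth_default -?st.
  case: (ltnP j (size s)) => [js|sj]; last first.
    have -> : onth s j = None by rewrite onth_default.
    have -> : onth t j = None by rewrite onth_default -?st.
    by case: (onth s i) => [?|]; case: (onth t i).
  by rewrite !onthE !(nth_map 0) -?st // ltrE -h.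
set A := all_below _ m; case EA: A => // hB.
have [/hasP[y ys /eqP xy]|nx] := boolP (has (pred1 x) s).
  have iy : index y s < size s by rewrite index_mem.
  have xn : x = nth 0 s (index y s) by rewrite nth_index.
  apply: (IH _ (nth 0 t (index y s) :: t) m) => /=; first by rewrite st.
  - by case=> [_|i]; rewrite ?ltnS /=; [exact: tm|exact: tm].
  - by apply: isotone_cons => // i si; rewrite xn !h.
  - exact: (all_belowP (q := nth 0 t (index y s)) EA (tm _ iy)).
(* The rank of a new value: just above the ranks of all smaller values, 0 if there are none. The
   ranks from [q] on are shifted by one. *)
set q := \max_(i < size s | nth 0 s i < x) (nth 0 t i).+1.
have qm : q < m.+1 by rewrite ltnS; apply/bigmax_leqP => i _; exact: tm.
have lo i : i < size s -> nth 0 s i < x -> nth 0 t i < q.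
  by move=> si ix; exact: (@leq_bigmax_cond _ (fun j : 'I_(size s) => nth 0 s j < x)
    (fun j => (nth 0 t j).+1) (Ordinal si)).
have hi i : i < size s -> x < nth 0 s i -> q <= nth 0 t i.
  move=> si ix; apply/bigmax_leqP => j jx; rewrite -h //.
  exact: ltn_trans jx ix.
have ne i : i < size s -> nth 0 s i != x.
  move=> si; apply: contra nx => /eqP <-; apply/hasP; exists (nth 0 s i) => //=.
  exact: mem_nth.
apply: (IH _ (q :: map (fun x => if ltr x q then x else x.+1) t) m.+1) => /=.
- by rewrite size_map st.
- move=> [|i]; rewrite ?ltnS //= => si; rewrite (nth_map 0) -?st // ltrE.
  by have := tm i si; case: ifP => _ //; apply: ltnW.
- apply: isotone_cons; rewrite ?size_map // => i.
  + move=> j si sj; rewrite !(nth_map 0) -?st // !ltrE h //.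
    by case: ifP; case: ifP; lia.
  + move=> si; rewrite !(nth_map 0) -?st // ltrE.
    have := ne i si; have := lo i si; have := hi i si.
    by case: ifP; lia.
- exact: (all_belowP (q := q) hB qm).
Qed.

Lemma order_taut F s : order_check F (size s) 0 [::] ->
  F (lt_in ltn (rev s)).
Proof. exact: order_check_sound. Qed.

End OrderTautologies.

Ltac abstract_lt_row a i l j r :=
  lazymatch l with
  | ?b :: ?l' => change (leq a.+1 b) with (lt_in ltn r i j);
                 abstract_lt_row a i l' (j.+1) r
  | _ => idtac
  end.
Ltac abstract_lt k i r :=
  lazymatch k with
  | ?a :: ?k' => abstract_lt_row a i r 0%N r; abstract_lt k' (i.+1) r
  | _ => idtac
  end.
(** Only the hypotheses still in the goal are used: they become boolean implications, disequalities
    become comparisons, and each comparison between members of [s] becomes [lt_in] at their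
    positions. The result is an instance of [order_taut], decided by evaluation. *)
Ltac order_by_cases s :=
  repeat match goal with H : is_true _ |- _ => clear H end;
  intros;
  repeat match goal with H : is_true _ |- _ => revert H; apply/implyP end;
  rewrite ?neq_ltn;
  let r := eval cbv [rev catrev] in (rev s) in
  abstract_lt r 0%N r; pattern (lt_in ltn r);
  lazymatch goal with |- (fun x => is_true (@?F x)) _ =>
    let b := eval vm_compute in (order_check F (size s) 0 [::]) in
    lazymatch b with
    | true => exact (@order_taut F s (erefl true <: order_check F (size s) 0 [::]))
    | _ => fail "not a tautology"
    end
  end.


(** * Chords of a circle *)

(* For distinct labels: the points [a], [b], [c] are met in this order when
   turning clockwise. *)
Definition cw (a b c : nat) : bool := ((a < b) (+) (a < c) (+) (b < c))%N.

(* The chords [ab] and [cd] meet inside the disc. *)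
Definition xing (a b c d : nat) : bool :=
  [&& a != c, a != d, b != c, b != d &
    ((a < c) (+) (b < c) (+) (a < d) (+) (b < d))%N].

(* For [h] and [k] different from [v] and [w]: the chord [vw] separates [h] from
   [k]. In general a label [h] stands for the gap just before it. *)
Definition sp (v w h k : nat) : bool :=
  ((v < h) (+) (w < h) (+) (v < k) (+) (w < k))%N.

Ltac chords s := rewrite /cw /xing /sp; order_by_cases s.


Section Chords.
Implicit Types a b c d h k u v w x y : nat.

Lemma xingC a b c d : xing a b c d = xing b a c d.
Proof. by apply/idP/idP; chords [:: a; b; c; d]. Qed.

Lemma xingCr a b c d : xing a b c d = xing a b d c.
Proof. by apply/idP/idP; chords [:: a; b; c; d]. Qed.

Lemma xing_sym a b c d : xing a b c d = xing c d a b.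
Proof. by apply/idP/idP; chords [:: a; b; c; d]. Qed.

Lemma spC a b c d : a != c -> a != d -> b != c -> b != d -> sp a b c d = sp c d a b.
Proof. by move=> ac ad bc bd; apply/idP/idP; move: ac ad bc bd; chords [:: a; b; c; d]. Qed.

Lemma sp_add v w h k l : sp v w h l = sp v w h k (+) sp v w k l.
Proof.
rewrite /sp; move: (v < h)%N (w < h)%N (v < k)%N (w < k)%N (v < l)%N (w < l)%N.
by do 6!case.
Qed.

(** With [a], [b], [c], [d] in cyclic order, [xing a b v c] says that [v] lies in the arc [ab] that
    avoids [c], whatever the orientation. So one end of the chord is in the arc [ab] and the other
    in the arc [cd]. *)
Lemma arc_split a b c d v w : xing a c b d ->
  v != a -> v != b -> v != c -> v != d -> w != a -> w != b -> w != c -> w != d ->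
  sp v w a b -> ~~ sp v w b c -> sp v w c d ->
  (xing a b v c && xing c d w a) || (xing a b w c && xing c d v a).
Proof. by chords [:: a; b; c; d; v; w]. Qed.

Lemma sp_no_four a b c d v w : xing a c b d ->
  v != a -> v != b -> v != c -> v != d -> w != a -> w != b -> w != c -> w != d ->
  ~~ [&& sp v w a b, sp v w b c & sp v w c d].
Proof. by chords [:: a; b; c; d; v; w]. Qed.

Lemma arcs_neq a b c d v w v' : xing a c b d ->
  xing a b v c -> xing c d w a -> xing b c v' d -> (v != v') && (w != v').
Proof.
move=> abcd v_ab w_cd v'_bc; apply/andP; split.
  by move: abcd v_ab v'_bc; chords [:: a; b; c; d; v; v'].
by move: abcd w_cd v'_bc; chords [:: a; b; c; d; w; v'].
Qed.

Lemma arc_under b c x d v w : xing b c x d -> ~~ xing b c v d -> ~~ xing b c w d ->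
  v != x -> w != x -> v != b -> v != c -> v != d -> w != d -> w != b -> w != c ->
  ~~ sp v w b x.
Proof. by chords [:: b; c; x; d; v; w]. Qed.

Lemma arcs_sp a b c d v w v' : xing a c b d ->
  xing a b v c -> xing c d w a -> xing b c v' d ->
  v != d -> w != b -> ~~ sp v w b v'.
Proof.
move=> abcd v_ab w_cd v'_bc vd wb.
have /andP[vv' wv'] := arcs_neq abcd v_ab w_cd v'_bc.
have v_bc : ~~ xing b c v d by move: abcd v_ab; chords [:: a; b; c; d; v].
have w_bc : ~~ xing b c w d by move: abcd w_cd; chords [:: a; b; c; d; w].
apply: arc_under v'_bc v_bc w_bc vv' wv' _ _ vd _ wb _.
- by move: v_ab; chords [:: a; b; c; v].
- by move: v_ab; chords [:: a; b; c; v].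
- by move: w_cd; chords [:: a; d; c; w].
- by move: w_cd; chords [:: a; d; c; w].
Qed.

(** The chord [vw] separates [b] from [d], and [v'] is on the side of [b], [w'] on the side of [d].
    This detour avoids an enumeration of the weak orders of eight labels. *)
Lemma arcs_xing a b c d v w v' w' : xing a c b d ->
  v != d -> w != b -> v' != a -> w' != c ->
  xing a b v c -> xing c d w a -> xing b c v' d -> xing d a w' b -> xing v w v' w'.
Proof.
move=> abcd vd wb v'a w'c v_ab w_cd v'_bc w'_da.
have cdab : xing c a d b by rewrite xingC xingCr.
have /andP[vv' wv'] := arcs_neq abcd v_ab w_cd v'_bc.
have /andP[ww' vw'] := arcs_neq cdab w_cd v_ab w'_da.
have := arcs_sp abcd v_ab w_cd v'_bc vd wb.
have := arcs_sp cdab w_cd v_ab w'_da wb vd.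
have : sp v w b d by move: abcd v_ab w_cd; chords [:: a; b; c; d; v; w].
rewrite /xing vv' vw' wv' ww' /= /sp.
move: (v < b)%N (v < d)%N (v < v')%N (v < w')%N (w < b)%N (w < d)%N (w < v')%N (w < w')%N.
by do 8!case.
Qed.

Lemma split_xing a b c d v w v' w' : xing a c b d ->
  v \notin [:: a; b; c; d] -> w \notin [:: a; b; c; d] ->
  v' \notin [:: a; b; c; d] -> w' \notin [:: a; b; c; d] ->
  sp v w a b -> ~~ sp v w b c -> sp v w c d ->
  sp v' w' b c -> ~~ sp v' w' c d -> sp v' w' d a ->
  xing v w v' w'.
Proof.
rewrite !inE !negb_or => abcd /and4P[va vb vc vd] /and4P[wa wb wc wd].
move=> /and4P[v'a v'b v'c v'd] /and4P[w'a w'b w'c w'd] ab bc cd bc' cd' da'.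
have bcda : xing b d c a by rewrite xing_sym xingCr in abcd *.
have /orP[/andP[h1 h2]|/andP[h1 h2]] :=
  arc_split abcd va vb vc vd wa wb wc wd ab bc cd;
have /orP[/andP[h3 h4]|/andP[h3 h4]] :=
  arc_split bcda v'b v'c v'd v'a w'b w'c w'd w'a bc' cd' da'.
- exact: arcs_xing abcd vd wb v'a w'c h1 h2 h3 h4.
- by rewrite xingCr; exact: arcs_xing abcd vd wb w'a v'c h1 h2 h3 h4.
- by rewrite xingC; exact: arcs_xing abcd wd vb v'a w'c h1 h2 h3 h4.
- by rewrite xingC xingCr; exact: arcs_xing abcd wd vb w'a v'c h1 h2 h3 h4.
Qed.

Lemma cwC u v a : u != v -> cw u v a = ~~ cw v u a.
Proof. by move=> uv; apply/idP/idP; move: uv; chords [:: u; v; a]. Qed.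

Lemma cw_side i j h k : h != i -> h != j -> k != i -> k != j ->
  (cw i j h == cw i j k) = ~~ xing i j h k.
Proof.
by rewrite /cw /xing => *; case: (_ < _)%N; case: (_ < _)%N; case: (_ < _)%N;
  case: (_ < _)%N;
  case: (_ < _)%N; lia.
Qed.

Lemma xing_arc_first u v b c d s : u != v -> u != b -> v != b ->
  xing u b c d -> ~~ xing u v c d ->
  cw u v b == s -> [|| [&& c != u, c != v, c != b, cw u v c == s & cw u b c == s] |
   [&& d != u, d != v, d != b, cw u v d == s & cw u b d == s]].
Proof. by case: s; chords [:: u; v; b; c; d]. Qed.

(** Equalities are written [~~ (c != u)] because the enumeration understands only comparisons and
    disequalities. Here and in [xing_arc_first], a chord that blocks a side of the triangle [uvb]
    provides a better choice than [b]. *)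
Lemma xing_arc_second u v b c d s : u != v -> u != b -> v != b ->
  xing b v c d -> ~~ xing u v c d -> ~~ xing u b c d ->
  cw u v b == s -> [|| [&& ~~ (c != u), d != v, d != b, cw u v d == s & cw u d b == s] |
   [&& ~~ (d != u), c != v, c != b, cw u v c == s & cw u c b == s]].
Proof. by case: s; chords [:: u; v; b; c; d]. Qed.

Lemma cw_between u v b x y s : u != v -> x != u -> x != v -> cw u v x == s ->
  b != u -> b != v -> cw u v b == s -> y != u -> y != v -> cw u v y == s ->
  x != b -> cw u x b == s -> y != x -> cw u y x == s ->
  (y != b) && (cw u y b == s).
Proof. by case: s; chords [:: u; v; b; x; y]. Qed.

Lemma cw_xing a b c d : a != c -> a != b -> b != c -> c != d -> d != a ->
  cw a c b -> ~~ cw a c d -> xing a c b d.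
Proof. by chords [:: a; b; c; d]. Qed.

Lemma cw_inner a b c : (a < b < c)%N -> cw a c b == false.
Proof. by move=> /andP[]; chords [:: a; b; c]. Qed.

Lemma cw_inner_between a b c : (a < c)%N -> b != a -> b != c ->
  cw a c b == false -> (a < b < c)%N.
Proof. by chords [:: a; b; c]. Qed.

Lemma cw_quad1 a b' b c : (a < b')%N && (b' < b)%N -> (b < c)%N ->
  cw a b c && ~~ cw a b b'.
Proof. by chords [:: a; b; b'; c]. Qed.

Lemma cw_quad2 a b' b c : (a < b)%N -> (b < b')%N && (b' < c)%N ->
  cw b c a && ~~ cw b c b'.
Proof. by chords [:: a; b; b'; c]. Qed.

Lemma xing_neq h k a c : xing h k a c -> h != a.
Proof. by chords [:: h; k; a; c]. Qed.

Lemma xing_fan h a c : ~~ xing h a a c.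
Proof. by chords [:: h; a; c]. Qed.

Lemma xing_sub h k a c c' d' : xing h k a c -> ~~ xing a c c' d' ->
  xing h a c' d' -> xing h k c' d'.
Proof. by chords [:: h; k; a; c; c'; d']. Qed.

Lemma xing_out_right a h b k : (a < h)%N -> (h < b)%N -> (b < k)%N -> xing h k a b.
Proof. by chords [:: a; h; b; k]. Qed.

Lemma xing_out_left h b k c : (h < b)%N -> (b < k)%N -> (k < c)%N -> xing h k b c.
Proof. by chords [:: h; b; k; c]. Qed.

(** * Uncrossing two chords *)

Lemma resolve_le v w x y h k : xing v w x y ->
  (sp v x h k + sp w y h k <= sp v w h k + sp x y h k)%N.
Proof. by chords [:: v; w; x; y; h; k]. Qed.

Lemma resolve_eq v w x y h k : xing v w x y ->
  ~~ [&& sp v w h k, sp x y h k, ~~ sp v x h k & ~~ sp w y h k] ->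
  (sp v x h k + sp w y h k == sp v w h k + sp x y h k)%N.
Proof. by chords [:: v; w; x; y; h; k]. Qed.

(** A label stands for the gap before it, so [sp] makes sense at the ends themselves, and pairs of
    ends suffice as witnesses. *)
Lemma resolve_lt v w x y : xing v w x y ->
  has (fun z => (sp v x z.1 z.2 + sp w y z.1 z.2 < sp v w z.1 z.2 + sp x y z.1 z.2)%N)
    [:: (v, w); (v, x); (v, y); (w, x); (w, y); (x, y)].
Proof. by rewrite /=; chords [:: v; w; x; y]. Qed.

(** Chords and points exchange their roles by [spC]: the two bad chords [hk] and [h'k'] split the
    quadrilateral [v x w y] of the ends in the two opposite ways, so [split_xing] applies to
    them. *)
Lemma resolve_both v w x y h k h' k' : xing v w x y ->
  h \notin [:: v; w; x; y] -> k \notin [:: v; w; x; y] ->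
  h' \notin [:: v; w; x; y] -> k' \notin [:: v; w; x; y] ->
  [&& sp v w h k, sp x y h k, ~~ sp v x h k & ~~ sp w y h k] ->
  [&& sp v w h' k', sp y x h' k', ~~ sp v y h' k' & ~~ sp w x h' k'] ->
  xing h' k' h k.
Proof.
move=> vwxy hn kn hn' kn' /and4P[s1 s2 s3 s4] /and4P[s1' s2' s3' s4'].
have e (z : nat) : (z \notin [:: v; x; w; y]) = (z \notin [:: v; w; x; y]).
  by rewrite !inE; congr negb; case: (z == v); case: (z == w); case: (z == x);
    case: (z == y).
move: (hn) (kn) (hn') (kn'); rewrite -!e => hm km hm' km'.
have S z z' : z \notin [:: v; w; x; y] -> z' \notin [:: v; w; x; y] ->
    forall a b, a \in [:: v; w; x; y] -> b \in [:: v; w; x; y] -> sp z z' a b = sp a b z z'.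
  by move=> zi zi' a b ai bi; apply: spC; by [apply: contraNneq zi =>
    ->|apply: contraNneq zi' => ->].
have S1 := S _ _ hn kn; have S2 := S _ _ hn' kn'.
apply: split_xing vwxy hm' km' hm km _ _ _ _ _ _; rewrite (S1, S2) ?inE ?eqxx ?orbT //.
- move: s1' s2' s3' s4'; rewrite /sp.
  move: (v < h')%N (v < k')%N (w < h')%N (w < k')%N (x < h')%N (x < k')%N (y < h')%N (y
    < k')%N.
  by do 8!case.
- move: s1' s2' s3' s4'; rewrite /sp.
  move: (v < h')%N (v < k')%N (w < h')%N (w < k')%N (x < h')%N (x < k')%N (y < h')%N (y
    < k')%N.
  by do 8!case.
- move: s1' s2' s3' s4'; rewrite /sp.
  move: (v < h')%N (v < k')%N (w < h')%N (w < k')%N (x < h')%N (x < k')%N (y < h')%N (y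
    < k')%N.
  by do 8!case.
- move: s1 s2 s3 s4; rewrite /sp.
  move: (v < h)%N (v < k)%N (w < h)%N (w < k)%N (x < h)%N (x < k)%N (y < h)%N (y < k)%N.
  by do 8!case.
- move: s1 s2 s3 s4; rewrite /sp.
  move: (v < h)%N (v < k)%N (w < h)%N (w < k)%N (x < h)%N (x < k)%N (y < h)%N (y < k)%N.
  by do 8!case.
Qed.

(* [sp u v] and [pps u v] describe which pairs of points are separated by the
   chord [uv] after a small clockwise, respectively anticlockwise, rotation. *)
Definition pps u v h k : bool := ((h < u) (+) (h < v) (+) (k < u) (+) (k < v))%N.

Lemma sp_other a b c d u v : u != v -> xing a c b d ->
  (a != u) || (c != v) -> (a != v) || (c != u) ->
  ~~ xing u v a c -> ~~ xing u v a b -> ~~ xing u v b c -> ~~ xing u v c d ->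
    ~~ xing u v d a ->
  ~~ [&& sp u v a b, ~~ sp u v b c & sp u v c d] &&
  ~~ [&& sp u v b c, ~~ sp u v c d & sp u v d a].
Proof. by chords [:: a; b; c; d; u; v]. Qed.

Lemma pps_other a b c d u v : u != v -> xing a c b d ->
  (a != u) || (c != v) -> (a != v) || (c != u) ->
  ~~ xing u v a c -> ~~ xing u v a b -> ~~ xing u v b c -> ~~ xing u v c d ->
    ~~ xing u v d a ->
  ~~ [&& pps u v a b, ~~ pps u v b c & pps u v c d] &&
  ~~ [&& pps u v b c, ~~ pps u v c d & pps u v d a].
Proof. by rewrite /pps; chords [:: a; b; c; d; u; v]. Qed.

Lemma pps_quad a b c d : a != c -> a != b -> b != c -> c != d -> d != a ->
  cw a c b -> ~~ cw a c d -> [&& pps a c a b, ~~ pps a c b c & pps a c c d].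
Proof. by rewrite /pps; chords [:: a; b; c; d]. Qed.

Lemma sp_quad a b c d : a != c -> a != b -> b != c -> c != d -> d != a ->
  cw a c b -> ~~ cw a c d -> [&& sp a c b c, ~~ sp a c c d & sp a c d a].
Proof. by chords [:: a; b; c; d]. Qed.

Lemma sp_swap v w h k : sp v w h k = sp w v h k.
Proof.
by rewrite /sp; case: (v < h)%N; case: (w < h)%N; case: (v < k)%N; case: (w < k)%N.
Qed.

(** On the side [s], the chord [xy] ends in the arc between [u] and [b], whereas [k] lies in the arc
    from [v] to [b], because [vk] does not cross [ub]. *)
Lemma sp_wrong_end u v b k x y s : u != v -> u != b -> u != k -> v != b -> v != k ->
  x != u -> x != v -> x != b -> x != k -> y != u -> y != v -> y != b -> y != k ->
  cw u v b == s -> cw u v k == s -> ~~ xing v k u b ->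
  sp x y u v -> sp x y u b -> ~~ sp x y v k.
Proof. by case: s; chords [:: u; v; b; k; x; y]. Qed.

Lemma sp_right_end u v b a x y s : u != v -> u != b -> u != a -> v != b -> v != a ->
  x != u -> x != v -> x != b -> x != a -> y != u -> y != v -> y != b -> y != a ->
  cw u v b == s -> cw u v a == s -> ~~ xing u a b v ->
  sp x y u v -> sp x y u a -> sp x y u b.
Proof. by case: s; chords [:: u; v; b; a; x; y]. Qed.

Lemma sp_nearer u v a j x y s : u != v -> u != a -> u != j -> v != a -> v != j -> j != a ->
  x != u -> x != v -> x != a -> x != j -> y != u -> y != v -> y != a -> y != j ->
  cw u v a == s -> cw u v j == s -> cw u j a == s ->
  sp x y u v -> sp x y u a -> sp x y u j.
Proof. by case: s; chords [:: u; v; a; j; x; y]. Qed.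

Lemma sp_side u v x y s : u != v -> x != u -> x != v -> y != u -> y != v ->
  sp x y u v -> (cw u v x == s) || (cw u v y == s).
Proof. by case: s; chords [:: u; v; x; y]. Qed.

(** Meant for the hollow neighbours [l] and [r] of a solid [z]: any hollow label is [l], [r], or
    across the chord [lr] from [z], so no hollow chord passes between [z] and [l]. *)
Lemma xing_adjacent l r z u v : z != l -> z != r -> z != u -> z != v -> u != v -> l != r ->
  [|| ~~ (u != l), ~~ (u != r) | xing l r u z] ->
  [|| ~~ (v != l), ~~ (v != r) | xing l r v z] ->
  [&& l != u, l != v & xing u v l z] = false.
Proof.
move=> h1 h2 h3 h4 h5 h6 h7 h8; apply/negbTE; move: h1 h2 h3 h4 h5 h6 h7 h8.
by chords [:: l; r; z; u; v].
Qed.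

Lemma fan_side a b c z z' : a != b -> a != c -> b != c ->
  z != a -> z != b -> z != c -> z' != a -> z' != b -> z' != c ->
  ~~ xing a c b z -> sp z z' a b -> ~~ sp z z' b c -> xing a b c z.
Proof. by chords [:: a; b; c; z; z']. Qed.

Lemma fan_shrink a b c x z : a != b -> a != c -> b != c ->
  z != a -> z != b -> z != c -> x != a -> x != b -> x != z ->
  ~~ xing a c b z -> xing a b c z -> ~~ xing a b x z -> (x != c) && ~~ xing a c x z.
Proof. by chords [:: a; b; c; x; z]. Qed.

Lemma xing_pred_succ N z h : (z < N)%N -> (h < N)%N -> h != z ->
  h != (if z == 0 then N else z).-1%N -> h != z.+1 ->
  xing (if z == 0 then N else z).-1%N z.+1 h z.
Proof. by rewrite /xing; case: z => [|z] /=; lia. Qed.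

Lemma cw_cyclic a b c : a != b -> b != c -> a != c -> cw a b c ->
  [|| (a < b)%N && (b < c)%N, (b < c)%N && (c < a)%N | (c < a)%N && (a < b)%N].
Proof. by chords [:: a; b; c]. Qed.

Lemma sp_step N i j h k : (i < N)%N -> (h < N)%N -> (k < N)%N -> odd h -> odd k ->
  odd i = false -> odd j = false -> (j = i + 2 \/ j + N = i + 2)%N ->
  sp i j h k = (h == i.+1) (+) (k == i.+1).
Proof.
move=> iN hN kN oh ok oi oj st.
suff key x : (x < N)%N -> odd x ->
    ((i < x) (+) (j < x))%N = (x == i.+1) (+) (j + N == i + 2)%N.
  have := key h hN oh; have := key k kN ok; rewrite /sp.
  by case: (i < h)%N; case: (j < h)%N; case: (i < k)%N; case: (j < k)%N;
    case: (h == i.+1); case: (k == i.+1); case: (_ == _).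
move=> xN ox; case: st => st.
  by have -> : (j + N == i + 2)%N = false; [lia|rewrite addbF; lia].
by rewrite st eqxx; have -> : j = 0%N; lia.
Qed.

Lemma xing_ex N u v : ~~ odd N -> (u < v)%N -> (v < N)%N -> odd u -> odd v ->
  (v == u + 2)%N = false -> (u + N == v + 2)%N = false ->
  exists h k, [/\ (h < N)%N, (k < N)%N, odd h, odd k & xing u v h k].
Proof.
move=> oN uv vN ou ov uv2 vu2; exists u.+2, (if u == 1 then N.-1 else 1)%N.
split; [lia|by case: ifP; lia|by rewrite /= negbK|by case: ifP; lia|].
by rewrite /xing; case: ifP; lia.
Qed.

Lemma mod_step i j N : (i < N)%N -> (j < N)%N -> (2 < N)%N ->
  (j == i + 2 %[mod N])%N -> (j = i + 2 \/ j + N = i + 2)%N.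
Proof.
move=> iN jN N2 /eqP; rewrite (modn_small jN) => ->.
have [lt|le] := ltnP (i + 2) N; first by left; rewrite modn_small.
right; rewrite -{1}(subnK le) modnDr modn_small; lia.
Qed.

End Chords.

(** * Triangulations and their quadrilaterals *)

Section Triangulation.
Variable n : nat.
Implicit Types a b c d h k u v x y : label n.

(** The edges of the hollow polygon belong to [m], since no hollow chord crosses them; they need no
    special treatment. *)
Structure maximal_noncrossing (m : rel (label n)) : Prop := MaximalNoncrossing {
  mn_sym : symmetric m;
  mn_hollow : forall a b, m a b -> [/\ odd a, odd b & a != b];
  mn_noncrossing : forall a b c d, m a b -> m c d -> ~~ xing a b c d;
  mn_max : forall a b, odd a -> odd b -> a != b ->
    (forall c d, m c d -> ~~ xing a b c d) -> m a b }.

Section Side.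
Variables (u v : label n) (s : bool).

Definition on_side : {set label n} :=
  [set h : label n | [&& odd h, h != u, h != v & cw u v h == s]]%SET.

(* On the side [s] of [uv], [x] is nearer to [v] than [b] iff [cw u x b == s]. *)
Definition before_on_side b : nat :=
  #|[set x in on_side | (x != b) && (cw u x b == s)]%SET|.

Lemma before_on_side_lt x b : u != v -> x \in on_side -> b \in on_side ->
  x != b -> cw u x b == s -> (before_on_side x < before_on_side b)%N.
Proof.
move=> uv xS bS xb xbs; apply: proper_card; apply/properP; split; last first.
  exists x; first by rewrite finset.in_set xS xb xbs.
  by rewrite finset.in_set eqxx andbF.
apply/fintype.subsetP => y; rewrite finset.in_set => /and3P[yS yx yxs].
rewrite finset.in_set yS /=; move: xS bS yS; rewrite !inE =>
  /and4P[_ xu xv xs] /and4P[_ bu bv bs] /and4P[_ yu yv ys].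
exact: cw_between uv xu xv xs bu bv bs yu yv ys xb xbs yx yxs.
Qed.
End Side.

Variable m : rel (label n).
Hypothesis mM : maximal_noncrossing m.

Lemma mn_neq a b : m a b -> a != b.
Proof. by case/(mn_hollow mM). Qed.

(** The vertex [b0] of the side nearest to [u] is joined to [u]. Among the vertices of the side
    joined to [u], the apex is the nearest to [v]: a chord that crosses [bv] but neither [uv] nor
    [ub] starts at [u] and ends nearer to [v]. *)
Lemma triangle_ex u v s h0 : m u v -> h0 \in on_side u v s ->
  exists b, [/\ m u b, m b v & b \in on_side u v s].
Proof.
move=> muv h0S; have [ou ov uv] := mn_hollow mM muv.
pose S := on_side u v s; pose f := before_on_side u v s.
have lt := before_on_side_lt uv.
have [b0 b0S b0max] := @arg_maxnP _ h0 (fun b => b \in S) f h0S.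
have mub0 : m u b0.
  have := b0S; rewrite finset.in_set => /and4P[ob bu bv bs].
  apply: (mn_max mM) => //; first by rewrite eq_sym.
  move=> c d mcd; apply/negP => xg.
  have [oc od _] := mn_hollow mM mcd.
  rewrite eq_sym in bu; rewrite eq_sym in bv.
  have /orP[] := xing_arc_first uv bu bv xg (mn_noncrossing mM muv mcd) bs.
  - move=> /and5P[cu cv cb cs cbs]; have cS : c \in S by rewrite inE oc cu cv cs.
    have := lt _ _ _ b0S cS _ cbs; rewrite eq_sym => /(_ cb).
    by rewrite ltnNge; apply/negP/negPn; exact: b0max.
  - move=> /and5P[cu cv cb cs cbs]; have cS : d \in S by rewrite inE od cu cv cs.
    have := lt _ _ _ b0S cS _ cbs; rewrite eq_sym => /(_ cb).
    by rewrite ltnNge; apply/negP/negPn; exact: b0max.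
have b0P : (b0 \in S) && m u b0 by rewrite b0S.
have [b /andP[bS mub] bmin] := @arg_minnP _ b0 (fun b => (b \in S) && m u b) f b0P.
exists b; split=> //.
have := bS; rewrite finset.in_set => /and4P[ob bu bv bs].
apply: (mn_max mM) => // c d mcd; apply/negP => xg.
have [oc od _] := mn_hollow mM mcd.
rewrite eq_sym in bu; rewrite eq_sym in bv.
have /orP[] := xing_arc_second uv bu bv xg (mn_noncrossing mM muv mcd)
  (mn_noncrossing mM mub mcd) bs.
- move=> /and5P[/negPn/eqP/val_inj cu dv db ds dbs].
  have mud : m u d by rewrite -cu.
  have dS : d \in S by rewrite inE od [d == u]eq_sym (mn_neq mud) dv ds.
  have := lt _ _ _ dS bS db dbs; rewrite ltnNge => /negP; apply.
  by apply: bmin; rewrite dS mud.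
- move=> /and5P[/negPn/eqP/val_inj cu dv db ds dbs].
  have mud : m u c by rewrite -cu (mn_sym mM).
  have dS : c \in S by rewrite inE oc [c == u]eq_sym (mn_neq mud) dv ds.
  have := lt _ _ _ dS bS db dbs; rewrite ltnNge => /negP; apply.
  by apply: bmin; rewrite dS mud.
Qed.

(* The two triangles [abc] and [acd] adjacent to the diagonal [ac], with [b] to the
   right of the directed line from [a] to [c]. *)
Definition quad a b c d : bool :=
  [&& m a c, m a b, m b c, m c d, m d a, cw a c b & ~~ cw a c d].

Lemma quad_xing a b c d : quad a b c d -> xing a c b d.
Proof.
move=> /and5P[/mn_neq ac /mn_neq ab /mn_neq bc /mn_neq cd /and3P[/mn_neq da]].
exact: cw_xing.
Qed.

Lemma quad_flip a b c d : quad a b c d -> quad c d a b.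
Proof.
move=> /and5P[h1 h2 h3 h4 /and3P[h5 h6 h7]].
rewrite /quad (mn_sym mM c a) h1 h2 h3 h4 h5 /=.
move/mn_neq: h1 => ac.
by rewrite cwC 1?eq_sym // h7 cwC 1?eq_sym // negbK h6.
Qed.

End Triangulation.

(** * Tropical Ptolemy relations *)

Section Gauge.
Variables (R : realFieldType) (n : nat) (m : rel (label n)).
Hypothesis mM : maximal_noncrossing m.
Implicit Types a b c d h k : label n.

(** A triangle [abc] determines [l] at its vertices, by [2 l(a) = J(a,b) + J(a,c) - J(b,c)], and the
    relation on quadrilaterals says that the two triangles along a chord give the same values at its
    ends. So [l] propagates from [ac] to all the triangles below it, by induction on [c - a]. *)
Lemma gauge_interval (J : label n -> label n -> R) a c (la lc : R) :
  (forall h k, J h k = J k h) ->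
  (forall a b c d, quad m a b c d -> J a b + J c d = J a d + J b c) ->
  (a < c)%N -> m a c -> la + lc = J a c ->
  (forall b, m a b -> m b c -> (a < b < c)%N -> la *+ 2 = J a b + J a c - J b c) ->
  exists l : label n -> R, [/\ l a = la, l c = lc &
    forall h k, (a <= h)%N -> (h < k)%N -> (k <= c)%N -> m h k -> J h k = l h + l k].
Proof.
move=> Jsym Jquad; move: {-1}(c - a)%N (leqnn (c - a)%N) => N.
elim: N a c la lc => [|N IH] a c la lc leN ac mac lac tri; first by lia.
have [oa oc nac] := mn_hollow mM mac.
have [/existsP[h0 /andP[oh0 h0ac]]|] := boolP [exists h, odd (h : label n) && (a < h <
  c)%N]; last first.
  rewrite negb_exists => /forallP nh.
  exists (fun x => if x == a then la else lc); split; rewrite ?eqxx //.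
    by rewrite eq_sym (negbTE nac).
  move=> h k ah hk kc mhk; have [oh ok _] := mn_hollow mM mhk.
  have ha : h = a.
    apply/val_inj/eqP; move: (nh h); rewrite oh /=; lia.
  have kec : k = c.
    apply/val_inj/eqP; move: (nh k); rewrite ok /=; lia.
  by rewrite ha kec eqxx eq_sym (negbTE nac).
have h0S : h0 \in on_side a c false.
  rewrite finset.in_set oh0 /=; apply/and3P; split; rewrite -?val_eqE /= ?cw_inner //; lia.
have [b [mab mbc]] := triangle_ex mM mac h0S.
rewrite finset.in_set => /and4P[ob nba nbc bside].
have abc : (a < b < c)%N.
  by move: ac nba nbc bside; rewrite -!val_eqE /=; exact: cw_inner_between.
have /andP[ab bc] := abc.
have la2 := tri b mab mbc abc.
pose lb := J a b - la.
have [|||l1 [l1a l1b l1J]] := IH a b la lb _ ab mab.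
- lia.
- by rewrite /lb; ring.
- move=> b' mab' mb'b ab'b.
  have q : quad m a c b b'.
    rewrite /quad mab mac (mn_sym mM c b) mbc (mn_sym mM b b') mb'b (mn_sym mM b' a)
      mab' /=.
    exact: cw_quad1.
  by have := Jquad _ _ _ _ q; rewrite (Jsym b' b) (Jsym c b); lra.
have [|||l2 [l2b l2c l2J]] := IH b c lb lc _ bc mbc.
- lia.
- by rewrite /lb; lra.
- move=> b' mbb' mb'c bb'c.
  have q : quad m b a c b'.
    rewrite /quad mbc (mn_sym mM b a) mab mac (mn_sym mM c b') mb'c (mn_sym mM b' b)
      mbb' /=.
    exact: cw_quad2.
  by have := Jquad _ _ _ _ q; rewrite (Jsym b a) (Jsym c b') /lb; lra.
exists (fun x : label n => if (x <= b)%N then l1 x else l2 x); split.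
- by rewrite ltnW.
- by rewrite leqNgt bc.
move=> h k ah hk kc mhk.
have := mn_noncrossing mM mhk mab; have := mn_noncrossing mM mhk mbc.
have [kb|bk] := leqP k b.
  by move=> _ _; rewrite (leq_trans (ltnW hk) kb); exact: l1J.
have [hb|bh] := leqP h b; last by move=> _ _; apply: l2J => //; lia.
move: hb; rewrite leq_eqVlt => /predU1P[hb|hb].
  have {}hb : h = b by exact: val_inj.
  by move=> _ _; rewrite hb l1b -l2b -l2J // -hb.
move=> x1 x2.
have ha : h = a.
  apply/val_inj/eqP; rewrite /= eqn_leq ah andbT leqNgt; apply: contra x2 => ah'.
  exact: xing_out_right.
have kec : k = c.
  apply/val_inj/eqP; rewrite /= eqn_leq kc leqNgt; apply: contra x1 => ck.
  exact: xing_out_left.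
by rewrite ha kec l1a l2c.
Qed.

Lemma gauge (J : label n -> label n -> R) : (2 <= n)%N ->
  (forall h k, J h k = J k h) ->
  (forall a b c d, quad m a b c d -> J a b + J c d = J a d + J b c) ->
  exists l : label n -> R, forall h k, m h k -> J h k = l h + l k.
Proof.
move=> n2 Jsym Jquad.
(* The chord from 1 to [2n - 1] is an edge of the hollow polygon, and all hollow labels lie between
   its ends. *)
have lt1 : (1 < 2 * n)%N by lia.
have lt2 : ((2 * n).-1 < 2 * n)%N by lia.
pose a : label n := Ordinal lt1; pose c : label n := Ordinal lt2.
have ac : (a < c)%N by rewrite /=; lia.
have oc : odd c by rewrite /=; case: (n) n2 => // k _; rewrite mulnS /= oddM.
have mac : m a c.
  apply: (mn_max mM) => //.
    by rewrite -val_eqE /=; lia.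
  move=> h k mhk; have [oh ok _] := mn_hollow mM mhk.
  have hx (x : label n) : odd x -> (0 < x < 2 * n)%N.
    by rewrite ltn_ord; case: (val x).
  by move: (hx _ oh) (hx _ ok); rewrite /xing /=; lia.
have uniq_tri b b' : m a b -> m b c -> (a < b < c)%N -> m a b' -> m b' c ->
    (a < b' < c)%N -> b = b'.
  move=> ab bc /andP[ab_lt bc_lt] ab' b'c /andP[ab'_lt b'c_lt].
  have := mn_noncrossing mM ab b'c; have := mn_noncrossing mM ab' bc.
  rewrite [xing a b' _ _]xing_sym [xing a b _ _]xing_sym.
  case: (ltngtP b b') => [lt|lt|eq_b]; last by rewrite (val_inj eq_b).
    by rewrite (xing_out_right ab_lt lt b'c_lt).
  by rewrite (xing_out_right ab'_lt lt bc_lt) => _.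
(* For [n = 2] there is no triangle below this chord, and any value at [a] will do. *)
pose la := if [pick b | [&& m a b, m b c & (a < b < c)%N]] is Some b then
  (J a b + J a c - J b c) / 2 else 0.
have [||l [_ _ lJ]] := @gauge_interval J a c la (J a c - la) Jsym Jquad ac mac.
- by ring.
- move=> b mab mbc abc; rewrite /la; case: pickP => [b' /and3P[mab' mb'c ab'c]|].
    by rewrite (uniq_tri b b') //; lra.
  by move/(_ b); rewrite mab mbc abc.
have lJ' h k : (h < k)%N -> m h k -> J h k = l h + l k.
  move=> hk mhk; have [oh ok _] := mn_hollow mM mhk; apply: lJ => //.
    by case: (val h) oh.
  by have := ltn_ord k; rewrite /=; lia.
exists l => h k mhk; have [hk|kh|hk] := ltngtP h k.
- exact: lJ'.
- by rewrite Jsym addrC; apply: lJ' => //; rewrite (mn_sym mM).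
- by have := mn_neq mM mhk; rewrite (val_inj hk) eqxx.
Qed.

Definition ptolemy (I : label n -> label n -> R) :=
  forall a b c d, odd a -> odd b -> odd c -> odd d -> xing a c b d ->
  I a c + I b d = Num.max (I a b + I c d) (I a d + I b c).

(* The Ptolemy relation determines the value on a chord from the values on chords
   that cross fewer diagonals of the triangulation. *)
Lemma gauge_ptolemy (I I' : label n -> label n -> R) (l : label n -> R) :
  (forall h k, I h k = I k h) -> (forall h k, I' h k = I' k h) ->
  ptolemy I -> ptolemy I' ->
  (forall h k, m h k -> I' h k - I h k = l h + l k) ->
  forall h k, odd h -> odd k -> h != k -> I' h k - I h k = l h + l k.
Proof.
move=> Isym I'sym pI pI' lm h k.
pose f (h k : label n) := #|[set x : label n * label n | m x.1 x.2 && xing h k x.1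
  x.2]%SET|.
move: {-1}(f h k) (leqnn (f h k)) => N; elim: N h k => [|N IH] h k fN oh ok hk.
  apply: lm; apply: (mn_max mM) => // c d mcd; apply/negP => x.
  by move: fN; rewrite leqn0 cards_eq0 => /eqP/finset.setP/(_ (c, d)); rewrite !inE mcd x.
have [mhk|] := boolP (m h k); first exact: lm.
move=> nm; have [/existsP[[a c] /andP[/= mac x]]|] :=
  boolP [exists x : label n * label n, m x.1 x.2 && xing h k x.1 x.2]; last first.
  rewrite negb_exists => /forallP nx; apply: lm; apply: (mn_max mM) => // c d mcd.
  by move: (nx (c, d)); rewrite /= mcd.
have [oa oc ac] := mn_hollow mM mac.
have IH' h' k' : odd h' -> odd k' -> h' != k' -> ~~ xing h' k' a c ->
  (forall c d, m c d -> xing h' k' c d -> xing h k c d) ->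
  I' h' k' - I h' k' = l h' + l k'.
  move=> oh' ok' nhk nx sub; apply: IH => //; rewrite -ltnS; apply: leq_trans fN.
  apply: proper_card; apply/properP; split; last first.
    by exists (a, c); rewrite !inE /= mac //= (negbTE nx).
  by apply/fintype.subsetP => -[c' d']; rewrite !inE /= => /andP[mcd x1]; rewrite mcd;
    exact: sub.
have x' : xing h k c a by rewrite xingCr.
have xk : xing k h a c by rewrite xingC.
have xk' : xing k h c a by rewrite xingC xingCr.
have nc c' d' : m c' d' -> ~~ xing a c c' d' by exact: mn_noncrossing.
have nc' c' d' : m c' d' -> ~~ xing c a c' d' by rewrite xingC; exact: nc.
have ha : I' h a - I h a = l h + l a.
  apply: IH' => //; [exact: xing_neq x|exact: xing_fan|].
  by move=> c' d' mcd; exact: (xing_sub x (nc _ _ mcd)).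
have hc : I' h c - I h c = l h + l c.
  apply: IH' => //; [exact: xing_neq x'|by rewrite xingCr; exact: xing_fan|].
  by move=> c' d' mcd; exact: (xing_sub x' (nc' _ _ mcd)).
have ka : I' k a - I k a = l k + l a.
  apply: IH' => //; [exact: xing_neq xk|exact: xing_fan|].
  by move=> c' d' mcd; rewrite [xing h k _ _]xingC; exact: (xing_sub xk (nc _ _ mcd)).
have kc : I' k c - I k c = l k + l c.
  apply: IH' => //; [exact: xing_neq xk'|by rewrite xingCr; exact: xing_fan|].
  by move=> c' d' mcd; rewrite [xing h k _ _]xingC; exact: (xing_sub xk' (nc' _ _ mcd)).
have e1 := pI h a k c oh oa ok oc x; have e2 := pI' h a k c oh oa ok oc x.
have am := lm _ _ mac.
have eI : I' h a + I' k c = (I h a + I k c) + (l h + l a + l k + l c) by lra.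
have eI' : I' h c + I' a k = (I h c + I a k) + (l h + l a + l k + l c).
  by rewrite (I'sym a k) (Isym a k); lra.
(* Both terms of the maximum are shifted by the same sum of four values of [l], hence so is the
   maximum. *)
by rewrite eI eI' -addr_maxl -e1 in e2; lra.
Qed.

End Gauge.

(** * Laminations: uniqueness *)

Section Separation.
Variable n : nat.
Implicit Types (e : diag n) (a b c d h k v w x y : label n).

(** A parity, so that [sep] is defined without choosing an order on the ends of [e]; on a pair it
    gives [sp]. *)
Definition below e h : bool := odd #|[set i in e | (i < h)%N]%SET|.
Definition sep e h k : bool := below e h (+) below e k.

Lemma diagonalP col e : reflect
  (exists v w, [/\ v != w, odd v = col, odd w = col & e = [set v; w]%SET]) (diagonal col e).
Proof.
apply: (iffP andP) => [[/cards2P c2 /forall_inP h]|[v [w [vw ov ow ->]]]].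
  case: c2 => v [w] [vw eE]; exists v, w.
  by split=> //; apply/eqP/h; rewrite eE !inE eqxx ?orbT.
rewrite cards2 vw; split=> //; apply/forall_inP => i; rewrite !inE.
by case/orP => /eqP->; apply/eqP.
Qed.

Lemma sepE v w h k : v != w -> sep [set v; w]%SET h k = sp v w h k.
Proof.
move=> vw; rewrite /sep /sp.
have below2 x : below [set v; w]%SET x = ((v < x) (+) (w < x))%N.
  rewrite /below -sum1_card big_mkcond /= (bigD1 v) //= (bigD1 w) 1?eq_sym //=.
  rewrite big1 => [|i /andP[iv iw]]; last by rewrite !inE (negbTE iv) (negbTE iw).
  by rewrite !inE !eqxx orbT /=; do 2 case: ifP.
by rewrite !below2 !addbA.
Qed.

Lemma sepC e h k : sep e h k = sep e k h.
Proof. exact: addbC. Qed.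

Lemma odd_neq (h v : nat) : odd h -> odd v = false -> v != h.
Proof. by move=> oh; apply: contraFneq => ->. Qed.

(* For a diagonal [e]: it separates [a, d] from [b, c]. *)
Definition split e a b c d := [&& sep e a b, ~~ sep e b c & sep e c d].

Lemma split_sepE (R : numDomainType) e a b c d :
  ((sep e a b)%:R + (sep e c d)%:R - (sep e a d)%:R - (sep e b c)%:R : R) =
  2 * (split e a b c d)%:R - 2 * (split e b c d a)%:R.
Proof.
rewrite /split /sep.
by case: (below e a); case: (below e b); case: (below e c); case: (below e d) => /=; ring.
Qed.

Lemma split_diagE (R : numDomainType) e a b c d : diagonal false e ->
  odd a -> odd b -> odd c -> odd d -> xing a c b d ->
  ((sep e a c)%:R + (sep e b d)%:R - (sep e a b)%:R - (sep e c d)%:R : R) =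
  2 * (split e b c d a)%:R.
Proof.
move=> /diagonalP[v [w [vw ov ow eE]]] oa ob oc od x.
have : ~~ [&& sep e a b, sep e b c & sep e c d].
  by rewrite eE !sepE //; apply: (sp_no_four x); exact: odd_neq.
rewrite /split /sep.
case: (below e a); case: (below e b); case: (below e c); case: (below e d) => //= _; ring.
Qed.

Lemma diag_split_xing a b c d v w x y : xing a c b d ->
  odd a -> odd b -> odd c -> odd d ->
  v != w -> odd v = false -> odd w = false ->
  x != y -> odd x = false -> odd y = false ->
  split [set v; w]%SET a b c d -> split [set x; y]%SET b c d a -> xing v w x y.
Proof.
move=> abcd oa ob oc od vw ov ow xy ox oy; rewrite /split !sepE //.
move=> /and3P[h1 h2 h3] /and3P[h4 h5 h6].
have nm (z : label n) : odd z = false -> (z : nat) \notin [:: a : nat; b : nat; c : nat;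
  d : nat].
  by move=> oz; rewrite !inE !negb_or; do !(apply/andP; split=> //); exact: odd_neq.
by apply: split_xing abcd (nm _ ov) (nm _ ow) (nm _ ox) (nm _ oy) h1 h2 h3 h4 h5 h6.
Qed.

End Separation.

Lemma cyclic_pred_inj N v w : (v < N)%N -> (w < N)%N ->
  ((if v == 0 then N else v).-1 = (if w == 0 then N else w).-1 -> v = w)%N.
Proof. by case: v => [|v]; case: w => [|w] /=; lia. Qed.

Lemma cyclic_predE N v w : (v < N)%N -> (w < N)%N ->
  ((if v == 0 then N else v).-1 = w.+1 -> v = w + 2 %[mod N])%N.
Proof.
case: v => [|v] vN wN /= E; last by rewrite E addn2.
by rewrite (_ : w + 2 = N)%N ?modnn ?mod0n //; lia.
Qed.

Section Lamination.
Variables (R : realFieldType) (n : nat).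
Implicit Types (e : diag n) (a b c d h k v x y : label n) (w : diag n -> R).

(** The edges of the solid polygon may carry weight, as uncrossing produces them; no shear
    coordinate sees them, which is why uniqueness is claimed for internal diagonals only. *)
Structure lamination w : Prop := Lamination {
  lam_ge0 : forall e, 0 <= w e;
  lam_solid : forall e, w e != 0 -> diagonal false e;
  lam_noncrossing : forall v v' x y, w [set v; v']%SET != 0 -> w [set x; y]%SET != 0 ->
    ~~ xing v v' x y }.

Definition crossings w h k : R := \sum_e w e * (sep e h k)%:R.

Lemma crossingsC w h k : crossings w h k = crossings w k h.
Proof. by apply: eq_bigr => e _; rewrite sepC. Qed.

Lemma crossings_diag w a b c d : (forall e, w e != 0 -> diagonal false e) ->
  odd a -> odd b -> odd c -> odd d -> xing a c b d ->
  crossings w a c + crossings w b d - crossings w a b - crossings w c d =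
  2 * \sum_e w e * (split e b c d a)%:R.
Proof.
move=> sw oa ob oc od x.
rewrite /crossings -big_split -!sumrB mulr_sumr; apply: eq_bigr => e _ /=.
have [->|we] := eqVneq (w e) 0; first by rewrite !mul0r; ring.
by rewrite mulrCA -split_diagE ?sw //; ring.
Qed.

Lemma lam_split w a b c d : lamination w -> xing a c b d ->
  odd a -> odd b -> odd c -> odd d ->
  (forall e, w e * (split e a b c d)%:R = 0) \/ (forall e, w e * (split e b c d a)%:R = 0).
Proof.
move=> lw x oa ob oc od.
have [/existsP[e /andP[we se]]|] := boolP [exists e, (w e != 0) && split e a b c d].
  right=> e'; have [->|we'] := eqVneq (w e') 0; first by rewrite mul0r.
  case se' : (split e' b c d a); rewrite ?mulr0 //; exfalso.
  have /diagonalP[v1 [v2 [v12 ov1 ov2 eE]]] := lam_solid lw we.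
  have /diagonalP[v3 [v4 [v34 ov3 ov4 e'E]]] := lam_solid lw we'.
  rewrite eE in we se; rewrite e'E in we' se'.
  by have /negP := lam_noncrossing lw we we'; apply; exact: diag_split_xing se se'.
rewrite negb_exists => /forallP nx; left=> e; move: (nx e); rewrite negb_and negbK.
by case/orP => [/eqP->|/negbTE->]; rewrite ?mul0r ?mulr0.
Qed.

(** By [crossings_diag], the left-hand side exceeds each term of the maximum by twice the weight of
    one of the two kinds of diagonals that split the quadrilateral. Diagonals of different kinds
    cross, so one of the two excesses is 0. *)
Lemma lam_ptolemy w : lamination w -> ptolemy (crossings w).
Proof.
move=> lw a b c d oa ob oc od x.
have x' : xing b d c a by rewrite xing_sym xingC.
have h1 := crossings_diag (lam_solid lw) oa ob oc od x.
have h2 := crossings_diag (lam_solid lw) ob oc od oa x'.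
have p1 : 0 <= \sum_e w e * (split e b c d a)%:R.
  by apply: sumr_ge0 => e _; rewrite mulr_ge0 ?(lam_ge0 lw) ?ler0n.
have p2 : 0 <= \sum_e w e * (split e c d a b)%:R.
  by apply: sumr_ge0 => e _; rewrite mulr_ge0 ?(lam_ge0 lw) ?ler0n.
have split4 e : split e c d a b = split e a b c d.
  rewrite /split /sep.
  by case: (below e a); case: (below e b); case: (below e c); case: (below e d).
rewrite (crossingsC w c a) (crossingsC w d a) in h2.
have [z|z] := lam_split lw x oa ob oc od.
  rewrite [X in 2 * X]big1 in h2; last by move=> e _; rewrite split4.
  by rewrite max_r; lra.
rewrite [X in 2 * X]big1 in h1; last by move=> e _.
by rewrite max_l; lra.
Qed.

Lemma hollow_neighbours v : odd v = false -> exists l r : label n,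
  [/\ odd l, odd r, (r = v.+1 :> nat) /\ (l = (if v == 0 :> nat then 2 * n else v).-1 :>
    nat)%N &
   forall x y, x != y -> odd x = false -> odd y = false ->
     sep [set x; y]%SET l r = (x == v) (+) (y == v)].
Proof.
move=> ov; have vn := ltn_ord v.
have oo : odd (2 * n) = false by rewrite oddM.
have rP : (v.+1 < 2 * n)%N.
  by rewrite ltn_neqAle vn andbT; apply: contraFneq oo => <-; rewrite /= ov.
pose l' := (if v == 0 :> nat then 2 * n else v).-1%N.
have lP : (l' < 2 * n)%N by rewrite /l'; case: ifP => _; lia.
exists (Ordinal lP), (Ordinal rP); split=> //=.
- by rewrite /l'; case: ifP => [v0|v0]; lia.
- by rewrite ov.
move=> x y xy ox oy; rewrite sepE // /sp /=.
suff key (z : label n) : odd z = false ->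
    (z < l')%N (+) (z < v.+1)%N = ((v == 0 :> nat) (+) (z == v)).
  have := key x ox; have := key y oy.
  by case: (x < l')%N; case: (x < v.+1)%N; case: (y < l')%N; case: (y < v.+1)%N;
    case: (x == v); case: (y == v); case: (v == 0 :> nat).
move=> oz; have zn := ltn_ord z; rewrite -val_eqE /= /l'; case: ifP => v0; lia.
Qed.

Lemma internalE e : internal false e -> exists v v', [/\ v != v', odd v = false, odd v'
  = false,
  e = [set v; v']%SET & (v' <> v + 2 %[mod 2 * n])%N /\ (v <> v' + 2 %[mod 2 * n])%N].
Proof.
move=> /andP[de]; have /diagonalP[v [v' [vv' ov ov' ->]]] := de.
rewrite /boundary -[X in diagonal _ X]/[set v; v']%SET => nb.
have dv : diagonal false [set v; v']%SET by apply/diagonalP; exists v, v'.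
exists v, v'; split=> //.
move: nb; rewrite dv /= negb_exists => /forallP nb.
split=> eq2; [move: (nb v)|move: (nb v')]; rewrite !inE eqxx ?orbT /= negb_exists =>
  /forallP.
  by move/(_ v'); rewrite !inE eqxx orbT /= eq2 eqxx.
by move/(_ v); rewrite !inE eqxx /= eq2 eqxx.
Qed.

(* The gauge [l] cancels in the second difference at the hollow neighbours of the
   ends of [e], and [e] is the only diagonal that contributes to it. *)
Lemma crossings_eq_weight w w' (l : label n -> R) e :
  (forall e, w e != 0 -> diagonal false e) -> (forall e, w' e != 0 -> diagonal false e) ->
  (forall h k, odd h -> odd k -> h != k -> crossings w' h k - crossings w h k = l h + l
    k) ->
  internal false e -> w e = w' e.
Proof.
move=> sw sw' J /internalE[v [v' [vv' ov ov' -> [nb nb']]]] {e}.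
have [a [c [oa oc [cE aE] sac]]] := hollow_neighbours ov.
have [b [d [ob od [dE bE] sbd]]] := hollow_neighbours ov'.
have vn := ltn_ord v; have v'n := ltn_ord v'.
have ab : a != b.
  apply: contraNneq vv' => eab; apply/eqP/val_inj/(cyclic_pred_inj vn v'n).
  by rewrite -aE -bE eab.
have cd : c != d.
  by apply: contraNneq vv' => ecd; apply/eqP/val_inj/succn_inj; rewrite -cE -dE ecd.
have ad : a != d.
  by apply/eqP => ead; apply/nb'/(cyclic_predE vn v'n); rewrite -aE -dE ead.
have bc : b != c.
  by apply/eqP => ebc; apply/nb/(cyclic_predE v'n vn); rewrite -bE -cE ebc.
have X w0 : (forall e, w0 e != 0 -> diagonal false e) ->
    crossings w0 a b + crossings w0 c d - crossings w0 a d - crossings w0 b c =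
    w0 [set v; v']%SET * (2 * (split [set v; v']%SET a b c d)%:R - 2 * (split [set v;
      v']%SET b c d a)%:R).
  move=> s0; rewrite /crossings -big_split -!sumrB (bigD1 [set v; v']%SET) //= big1 ?addr0.
    by rewrite -split_sepE; ring.
  move=> e ne; have [->|we] := eqVneq (w0 e) 0; first by rewrite !mul0r; ring.
  transitivity (w0 e * (2 * (split e a b c d)%:R - 2 * (split e b c d a)%:R)).
    by rewrite -split_sepE; ring.
  have /diagonalP[x [y [xy ox oy eE]]] := s0 _ we.
  suff [-> ->] : split e a b c d = false /\ split e b c d a = false by ring.
  have hs : sep e a c && sep e b d = false.
    apply: contraNF ne; rewrite eE sac // sbd //.
    have [->|xv] := eqVneq x v; have [->|yv] := eqVneq y v => //=.
      by rewrite (negbTE vv') /= => /eqP->.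
    by rewrite (negbTE vv') /= addbF => /eqP->; rewrite finset.setUC.
  by move: hs; rewrite /split /sep; case: (below e a); case: (below e b);
    case: (below e c); case: (below e d).
have := X w sw; have := X w' sw'.
have := J _ _ oa ob ab; have := J _ _ oc od cd; have := J _ _ oa od ad; have :=
  J _ _ ob oc bc.
have : sep [set v; v']%SET a c && sep [set v; v']%SET b d.
  by rewrite sac // sbd // !eqxx (negbTE vv') eq_sym (negbTE vv').
rewrite /split /sep; set W := w _; set W' := w' _.
by case: (below _ a); case: (below _ b); case: (below _ c); case: (below _ d) => //= _; lra.
Qed.

Theorem lamination_unique (m : rel (label n)) w w' : (2 <= n)%N -> maximal_noncrossing m ->
  lamination w -> lamination w' ->
  (forall a b c d, quad m a b c d ->
     \sum_e w e * ((split e a b c d)%:R - (split e b c d a)%:R) =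
     \sum_e w' e * ((split e a b c d)%:R - (split e b c d a)%:R)) ->
  forall e, internal false e -> w e = w' e.
Proof.
move=> n2 mM lw lw' ww' e ie.
pose J h k := crossings w' h k - crossings w h k.
have X w0 a b c d : crossings w0 a b + crossings w0 c d - crossings w0 a d - crossings
  w0 b c =
    2 * \sum_e w0 e * ((split e a b c d)%:R - (split e b c d a)%:R).
  rewrite /crossings -big_split -!sumrB mulr_sumr; apply: eq_bigr => e' _ /=.
  by rewrite mulrCA mulrBr -split_sepE; ring.
have [||l lJ] := gauge mM (J := J) n2.
- by move=> h k; rewrite /J !(crossingsC _ h).
- move=> a b c d q; have := ww' _ _ _ _ q; have := X w a b c d; have := X w' a b c d.
  by rewrite /J; lra.
apply: (@crossings_eq_weight _ _ l) => //; try exact: lam_solid.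
by apply: gauge_ptolemy; try exact: crossingsC; try exact: lam_ptolemy; try exact: lJ;
  exact: mM.
Qed.

End Lamination.

(** * Laminations: existence *)

Section LinearProgram.
Variables (R : realType) (I K : finType) (P : pred I).
Variables (A : K -> I -> R) (b : K -> R) (c : I -> R).

Definition feasible (w : I -> R) :=
  [/\ forall i, 0 <= w i, forall i, ~~ P i -> w i = 0 &
      forall k, \sum_i w i * A k i = b k].

(** The feasible points that cost no more than [w0] form a compact set: the coordinate [i] is at
    most [cost w0 / c i], and it is 0 off [P]. A minimum there is global, since the other feasible
    points cost more. *)
Lemma linear_program_min : (forall i, P i -> 0 < c i) -> (exists w, feasible w) ->
  exists2 w, feasible w &
    forall w', feasible w' -> \sum_i c i * w i <= \sum_i c i * w' i.
Proof.
move=> c_gt0 [w0 w0F].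
pose f (v : 'rV[R]_#|I|) (i : I) : R := v ord0 (enum_rank i).
pose g (w : I -> R) : 'rV[R]_#|I| := \row_j w (enum_val j).
have fg w : f (g w) = w by apply/funext => i; rewrite /f mxE enum_rankK.
pose cost w := \sum_i c i * w i.
pose box (j : 'I_#|I|) : set R :=
  if P (enum_val j) then `[0, cost w0 / c (enum_val j)]%classic else `[0, 0]%classic.
pose B := [set v : 'rV[R]_#|I| | forall j, box j (v ord0 j)].
have cB : compact B.
  by apply: rV_compact => j; rewrite /box; case: ifP => _; exact: segment_compact.
have f_cont i : continuous (fun v => f v i) by exact: coord_continuous.
have sum_cont (d : I -> R) : continuous (fun v => \sum_i f v i * d i).
  apply: continuous_big => [|i _]; first exact: add_continuous.
  move=> v; apply: (@continuous_comp _ _ _ (f^~ i) (fun x : R => x * d i)).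
    exact: f_cont.
  exact: mulrr_continuous.
pose C := \bigcap_(k in [set: K]) [set v | \sum_i f v i * A k i = b k].
have clC : closed C.
  apply: closed_bigI => k _.
  exact: (preimage_closed (fun v _ => sum_cont (A k) v) (@closed_eq _ (b k))).
have box_feasible w : feasible w -> cost w <= cost w0 -> (B `&` C) (g w).
  move=> [w_ge0 wP wA] ww0; split=> [j|k _]; last by rewrite /= fg.
  rewrite /box mxE; set i := enum_val j; case: ifP => [Pi|/negbT nPi]; last first.
    by rewrite /= in_itv /= wP ?lexx.
  rewrite /= in_itv /= w_ge0 /= ler_pdivlMr ?c_gt0 // mulrC (le_trans _ ww0) //.
  rewrite /cost (bigD1 i) //= lerDl sumr_ge0 // => i' _.
  have [Pi'|nPi'] := boolP (P i'); last by rewrite wP ?mulr0.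
  by rewrite mulr_ge0 // ltW // c_gt0.
have feasible_box v : (B `&` C) v -> feasible (f v).
  move=> [Bv Cv]; split=> [i|i nPi|k]; last exact: Cv.
    have := Bv (enum_rank i); rewrite /box enum_rankK.
    by case: ifP => _; rewrite /= in_itv /= => /andP[].
  have := Bv (enum_rank i); rewrite /box enum_rankK (negbTE nPi) /= in_itv /=.
  by move=> /le_anti/esym.
have cBC : compact (B `&` C) by exact: compact_closedI.
have BC0 : B `&` C !=set0 by exists (g w0); exact: box_feasible.
have cost_cont : {within B `&` C, continuous (fun v => \sum_i f v i * c i)}.
  by apply: continuous_subspaceT; exact: sum_cont.
have [v vBC vmin] := compact_EVT_min BC0 cBC cost_cont.
exists (f v); first by apply: feasible_box; rewrite inE in vBC.
move=> w' w'F; have costE u : \sum_i f u i * c i = cost (f u).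
  by apply: eq_bigr => i _; rewrite mulrC.
have [w'w0|w0w'] := leP (cost w') (cost w0).
  have := vmin (g w'); rewrite inE !costE fg; apply; exact: box_feasible.
apply: le_trans (ltW w0w').
by have := vmin (g w0); rewrite inE !costE fg; apply; exact: box_feasible.
Qed.

End LinearProgram.

Lemma cyclic_succ_inj N u v :
  ((if u.+1 == N then 0 else u.+1) = (if v.+1 == N then 0 else v.+1) -> u = v)%N.
Proof. by do 2 case: eqP; lia. Qed.

Section Existence.
Variables (R : realType) (n : nat) (m : rel (label n)).
Hypothesis mM : maximal_noncrossing m.
Implicit Types (e f : diag n) (a b c d h k u v x y : label n) (w : diag n -> R).

(* The shear coordinate of [e] at the diagonal [ac] of the quadrilateral [abcd]. *)
Definition shear e a b c d : R := (split e a b c d)%:R - (split e b c d a)%:R.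

Lemma shear_flip e a b c d : shear e c d a b = shear e a b c d.
Proof.
rewrite /shear /split /sep.
by case: (below e a); case: (below e b); case: (below e c); case: (below e d).
Qed.

Lemma shearE e a b c d : shear e a b c d *+ 2 =
  (sep e a b)%:R + (sep e c d)%:R - (sep e a d)%:R - (sep e b c)%:R.
Proof. by rewrite split_sepE /shear -mulr_natl; ring. Qed.

Lemma label_gt0 v : (0 < 2 * n)%N.
Proof. exact: leq_ltn_trans (ltn_ord v). Qed.

Lemma label_pred_lt v : (v.-1 < 2 * n)%N.
Proof. exact: leq_ltn_trans (leq_pred v) (ltn_ord v). Qed.

(** Used at hollow labels, which are positive, so it never wraps around; [label_succ] does, from
    [2n - 1] to 0. *)
Definition label_pred v : label n := Ordinal (label_pred_lt v).
Definition label_succ v : label n := Ordinal (ltn_pmod v.+1 (label_gt0 v)).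

Lemma label_predP u v : odd u -> odd v -> u != v ->
  [/\ label_pred u != label_pred v, odd (label_pred u) = false,
     odd (label_pred v) = false &
     forall h k, odd h -> odd k -> sep [set label_pred u;
       label_pred v]%SET h k = pps u v h k].
Proof.
move=> ou ov uv.
have uv' : label_pred u != label_pred v.
  apply: contraNneq uv => /(congr1 val) /= E; apply/eqP/val_inj => /=.
  by case: (nat_of_ord u) (nat_of_ord v) E ou ov => [|u'] [|v'] //= ->.
have o (z : label n) : odd z -> odd (label_pred z) = false by rewrite /=;
  case: (nat_of_ord z) => //= k /negbTE.
have lt (z h : label n) : odd z -> (label_pred z < h)%N = ~~ (h < z)%N.
  by rewrite -leqNgt /=; case: (nat_of_ord z).
split; rewrite ?o // => h k oh ok.
rewrite sepE // /sp /pps !lt //.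
by case: (_ < _)%N; case: (_ < _)%N; case: (_ < _)%N; case: (_ < _)%N.
Qed.

Lemma label_succP u v : odd u -> odd v -> u != v ->
  [/\ label_succ u != label_succ v, odd (label_succ u) = false,
     odd (label_succ v) = false &
     forall h k, odd h -> odd k -> sep [set label_succ u;
       label_succ v]%SET h k = sp u v h k].
Proof.
move=> ou ov uv.
have oN : odd (2 * n) = false by rewrite oddM.
have sE (z : label n) : label_succ z = (if z.+1 == 2 * n then 0 else z.+1)%N :> nat.
  rewrite /=; case: eqP => [->|/eqP ne]; first by rewrite modnn.
  by rewrite modn_small // ltn_neqAle ne ltn_ord.
have uv' : label_succ u != label_succ v.
  apply: contraNneq uv => /(congr1 (@nat_of_ord _)); rewrite !sE => E.
  apply/eqP/val_inj => /=.
  exact: cyclic_succ_inj E.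
have o (z : label n) : odd z -> odd (label_succ z) = false.
  by move=> oz; rewrite sE; case: ifP => //= _; rewrite oz.
(* If the successor of [z] wraps around to 0, the comparison is complemented for every [h]; this
   cancels in [sep], which adds the comparisons with [h] and with [k]. *)
have lt (z h : label n) : odd z -> odd h ->
    (label_succ z < h)%N = (z < h)%N (+) (z.+1 == 2 * n)%N.
  move=> oz oh; rewrite sE; case: eqP => [E|_].
    have hz : (h <= z)%N by rewrite -ltnS E ltn_ord.
    by rewrite [(z < h)%N]ltnNge hz /=; case: (nat_of_ord h) oh.
  by rewrite addbF ltn_neqAle; apply: andb_idl => _; apply: contraTneq oh => <-;
    rewrite /= oz.
split; rewrite ?o // => h k oh ok.
rewrite sepE // /sp !lt //.
by case: (u < h)%N; case: (v < h)%N; case: (u < k)%N; case: (v < k)%N;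
  case: (_ == _); case: (_ == _).
Qed.

Lemma quad_neq a b c d : quad m a b c d ->
  [/\ a != c, a != b, b != c, c != d & d != a].
Proof.
have nm := mn_neq mM.
by move=> /and5P[/nm ac /nm ab /nm bc /nm cd /and3P[/nm da _ _]].
Qed.

Lemma quad_odd a b c d : quad m a b c d -> [/\ odd a, odd b, odd c & odd d].
Proof.
move=> /and5P[/(mn_hollow mM)[? ? _] _ /(mn_hollow mM)[? ? _] /(mn_hollow mM)[? ? _] _].
by [].
Qed.

Lemma shear_pred u v a b c d : m u v -> quad m a b c d ->
  shear [set label_pred u; label_pred v]%SET a b c d =
  ((a == u) && (c == v) || (a == v) && (c == u))%:R.
Proof.
move=> muv q; have [ou ov uv] := mn_hollow mM muv.
have [oa ob oc od] := quad_odd q; have [ac ab bc cd da] := quad_neq q.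
have [_ _ _ s] := label_predP ou ov uv.
have /and5P[mac mab mbc mcd /and3P[mda cwb cwd]] := q.
rewrite /shear /split !s //.
have nx h k : m h k -> ~~ xing u v h k by move=> mhk; exact: (mn_noncrossing mM muv mhk).
case: (boolP (_ || _)) => [E|/norP[]]; last first.
  rewrite !negb_and => n1 n2.
  have /andP[/negbTE-> /negbTE->] : _ && _ :=
    pps_other uv (quad_xing mM q) n1 n2 (nx _ _ mac) (nx _ _ mab) (nx _ _ mbc) (nx _ _
      mcd) (nx _ _ mda).
  by rewrite subrr.
have ppsC h k : pps v u h k = pps u v h k.
  by rewrite /pps; case: (_ < _)%N; case: (_ < _)%N; case: (_ < _)%N; case: (_ < _)%N.
have {E} ppsE h k : pps u v h k = pps a c h k.
  by case/orP: E => /andP[/eqP-> /eqP->].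
have := pps_quad ac ab bc cd da cwb cwd; rewrite !ppsE => /and3P[-> /negbTE-> ->] /=.
by rewrite subr0.
Qed.

Lemma shear_succ u v a b c d : m u v -> quad m a b c d ->
  shear [set label_succ u; label_succ v]%SET a b c d =
  - ((a == u) && (c == v) || (a == v) && (c == u))%:R.
Proof.
move=> muv q; have [ou ov uv] := mn_hollow mM muv.
have [oa ob oc od] := quad_odd q; have [ac ab bc cd da] := quad_neq q.
have [_ _ _ s] := label_succP ou ov uv.
have /and5P[mac mab mbc mcd /and3P[mda cwb cwd]] := q.
rewrite /shear /split !s //.
have nx h k : m h k -> ~~ xing u v h k by move=> mhk; exact: (mn_noncrossing mM muv mhk).
case: (boolP (_ || _)) => [E|/norP[]]; last first.
  rewrite !negb_and => n1 n2.
  have /andP[/negbTE-> /negbTE->] : _ && _ :=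
    sp_other uv (quad_xing mM q) n1 n2 (nx _ _ mac) (nx _ _ mab) (nx _ _ mbc) (nx _ _
      mcd) (nx _ _ mda).
  by rewrite subrr oppr0.
have spC' h k : sp v u h k = sp u v h k.
  by rewrite /sp; case: (_ < _)%N; case: (_ < _)%N; case: (_ < _)%N; case: (_ < _)%N.
have {E} spE h k : sp u v h k = sp a c h k.
  by case/orP: E => /andP[/eqP-> /eqP->].
have := sp_quad ac ab bc cd da cwb cwd; rewrite !spE => /and3P[-> /negbTE-> ->] /=.
by rewrite andbF sub0r.
Qed.

(* The two rotations of a chord [uv] of the triangulation have opposite shear
   coordinates, concentrated on [uv]. *)
Lemma lamination_spanning (x : diag n -> R) : exists w : diag n -> R,
  [/\ forall e, 0 <= w e, forall e, ~~ diagonal false e -> w e = 0 &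
   forall a b c d, quad m a b c d -> \sum_e w e * shear e a b c d = x [set a; c]%SET].
Proof.
pose V := [pred z : label n * label n | m z.1 z.2 && (z.1 < z.2)%N].
pose X (z : label n * label n) := x [set z.1; z.2]%SET.
pose f (z : label n * label n) := [set label_pred z.1; label_pred z.2]%SET.
pose g (z : label n * label n) := [set label_succ z.1; label_succ z.2]%SET.
(* The positive part of the prescribed coordinate is put on one rotation of the chord, the negative
   part on the other. [V] lists each chord of [m] once. *)
exists (fun e => \sum_(z | V z)
  (Num.max (X z) 0 * (e == f z)%:R + Num.max (- X z) 0 * (e == g z)%:R)).
have Vf (z : label n * label n) : V z -> diagonal false (f z) /\ diagonal false (g z).
  move=> /andP[mz _]; have [odd1 odd2 neq12] := mn_hollow mM mz.
  have [? ? ? ?] := label_predP odd1 odd2 neq12; have [? ? ? ?] :=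
    label_succP odd1 odd2 neq12.
  split; apply/diagonalP.
    by exists (label_pred z.1), (label_pred z.2).
  by exists (label_succ z.1), (label_succ z.2).
split=> [e|e ne|a b c d].
- by apply: sumr_ge0 => z _; rewrite addr_ge0 // mulr_ge0 ?ler0n // le_max lexx orbT.
- apply: big1 => z /Vf[df dg].
  have [ef|_] := eqVneq e (f z); first by rewrite ef df in ne.
  have [eg|_] := eqVneq e (g z); first by rewrite eg dg in ne.
  by rewrite !mulr0 addr0.
wlog ac : a b c d / (a < c)%N.
  move=> H q; have [ac _ _ _ _] := quad_neq q.
  have [lt|gt|eq_ac] := ltngtP a c; first exact: H.
    rewrite finset.setUC -(H c d a b gt (quad_flip mM q)).
    by apply: eq_bigr => e _; rewrite shear_flip.
  by move: ac; rewrite (val_inj eq_ac) eqxx.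
move=> q; under eq_bigr do rewrite mulr_suml.
rewrite exchange_big /=.
have mac : m a c by case/and5P: q.
rewrite (bigD1 (a, c)) /=; last by rewrite mac ac.
have sumV z : V z -> \sum_e (Num.max (X z) 0 * (e == f z)%:R + Num.max (- X z) 0 * (e ==
  g z)%:R) *
    shear e a b c d = X z * ((a == z.1) && (c == z.2) || (a == z.2) && (c == z.1))%:R.
  move=> /andP[mz _].
  under eq_bigr do rewrite mulrDl.
  rewrite big_split /= (bigD1 (f z)) //= big1 ?addr0; last first.
    by move=> e /negbTE->; rewrite mulr0 mul0r.
  rewrite (bigD1 (g z)) //= big1 ?addr0; last first.
    by move=> e /negbTE->; rewrite mulr0 mul0r.
  rewrite !eqxx !mulr1 shear_pred // shear_succ // mulrN -mulrBl; congr (_ * _).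
  have [X_ge0|X_lt0] := lerP 0 (X z).
    by rewrite max_r ?oppr_le0 // subr0.
  by rewrite max_l ?oppr_ge0 ?ltW // sub0r opprK.
rewrite sumV /= ?mac ?ac // ?eqxx ?mulr1 big1 ?addr0 // =>
  -[u v] /andP[/andP[/= muv uv] ne].
rewrite sumV /=; last by rewrite muv uv.
case: (boolP (_ || _)); rewrite ?mulr0 // => /orP[/andP[/eqP au /eqP cv]|/andP[/eqP av
  /eqP cu]].
  by move: ne; rewrite au cv eqxx.
by move: uv ac; rewrite av cu; lia.
Qed.

End Existence.

(** * Uncrossing a weight of minimal cost *)

Section ExistenceMin.
Variables (R : realType) (n : nat) (m : rel (label n)).
Hypothesis mM : maximal_noncrossing m.
Implicit Types (e f : diag n) (a b c d h k u v x y : label n) (w : diag n -> R).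

(* Uncrossing changes the number of diagonals that separate [h] from [k] only if
   [hk] crosses both of the old ones and none of the new ones. If this happened on
   [m] for the two ways of uncrossing, two chords of [m] would cross. *)
Lemma resolution v v' y y' : xing v v' y y' ->
  odd v = false -> odd v' = false -> odd y = false -> odd y' = false ->
  exists f f' : diag n, [/\ diagonal false f, diagonal false f',
    forall h k, m h k -> (sep f h k + sep f' h k =
      sep [set v; v']%SET h k + sep [set y; y']%SET h k)%N,
    forall h k, (sep f h k + sep f' h k <=
      sep [set v; v']%SET h k + sep [set y; y']%SET h k)%N &
    exists h k, (sep f h k + sep f' h k <
      sep [set v; v']%SET h k + sep [set y; y']%SET h k)%N].
Proof.
move=> vy ov ov' oy oy'.
have [vv' yy'] : v != v' /\ y != y'.
  by split; apply: contraTneq vy => ->; rewrite /xing; do 2 case: (_ < _)%N;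
    rewrite /= ?andbF.
have nine (z z' : label n) : m z z' -> forall h1 h2 h3 h4 : label n,
    odd h1 = false -> odd h2 = false -> odd h3 = false -> odd h4 = false ->
    ((z : nat) \notin [:: h1 : nat; h2 : nat; h3 : nat; h4 : nat]) &&
    ((z' : nat) \notin [:: h1 : nat; h2 : nat; h3 : nat; h4 : nat]).
  move=> /(mn_hollow mM)[oz oz' _] h1 h2 h3 h4 e1 e2 e3 e4; rewrite !inE !negb_or.
  by rewrite !(eq_sym (_ : nat) (nat_of_ord h1), eq_sym (_ : nat) (nat_of_ord h2),
    eq_sym (_ : nat) (nat_of_ord h3), eq_sym (_ : nat) (nat_of_ord h4)) !odd_neq.
pose bad z := m z.1 z.2 && [&& sp v v' z.1 z.2, sp y y' z.1 z.2, ~~ sp v y z.1 z.2 & ~~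
  sp v' y' z.1 z.2].
have solid2 (z z' : label n) : z != z' -> odd z = false -> odd z' = false ->
  diagonal false [set z; z']%SET.
  by move=> *; apply/diagonalP; exists z, z'.
have [vy1 vy2 vy3 vy4] : [/\ v != y, v != y', v' != y & v' != y'] by case/and5P: vy.
have vy' : xing v v' y' y by rewrite xingCr.
have [/existsP[[h k] /andP[/= mhk b1]]|] := boolP [exists z : label n * label n, bad z];
  last first.
  rewrite negb_exists => /forallP nb.
  exists [set v; y]%SET, [set v'; y']%SET; split; rewrite ?solid2 //.
  - move=> h k mhk; rewrite !sepE //; apply/eqP/(resolve_eq vy).
    by have := nb (h, k); rewrite /bad /= mhk.
  - by move=> h k; rewrite !sepE //; exact: resolve_le.
  - have /hasP[[h k] hk lt] := resolve_lt vy.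
    suff [h' [k' [hE kE]]] : exists h' k' : label n, h = h' /\ k = k'.
      by exists h', k'; rewrite !sepE // -hE -kE.
    move: hk; rewrite !inE; do !(case/orP); move/eqP => [-> ->];
    by do 2 eexists.
exists [set v; y']%SET, [set v'; y]%SET; split; rewrite ?solid2 //.
- move=> h' k' mhk'; rewrite !sepE // (sp_swap y y'); apply/eqP/(resolve_eq vy').
  apply/negP => b2.
  have /andP[hn kn] := nine _ _ mhk _ _ _ _ ov ov' oy oy'.
  have /andP[hn' kn'] := nine _ _ mhk' _ _ _ _ ov ov' oy oy'.
  have := resolve_both vy hn kn hn' kn' b1 b2.
  exact/negP/(mn_noncrossing mM).
- by move=> h' k'; rewrite !sepE // (sp_swap y y'); exact: resolve_le.
- have /hasP[[h' k'] hk lt] := resolve_lt vy'.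
  suff [h2 [k2 [hE kE]]] : exists h2 k2 : label n, h' = h2 /\ k' = k2.
    exists h2, k2; rewrite !sepE // (sp_swap y y').
    by rewrite -hE -kE.
  move: hk; rewrite !inE; do !(case/orP); move/eqP => [-> ->];
  by do 2 eexists.
Qed.

(** All labels are counted, solid ones included: the strict decrease in [resolution] is found at the
    ends of the uncrossed diagonals. *)
Definition separated_pairs e : R := \sum_h \sum_k (sep e h k)%:R.

Lemma separated_pairs_gt0 e : diagonal false e -> 0 < separated_pairs e.
Proof.
move=> /diagonalP[v [v' [vv' _ _ eE]]].
have ge0 h k : 0 <= (sep e h k)%:R :> R by exact: ler0n.
rewrite /separated_pairs (bigD1 v) //= ltr_pwDl ?sumr_ge0 // => [|h _];
  last exact: sumr_ge0.
rewrite (bigD1 v') //= ltr_pwDl ?sumr_ge0 //.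
suff -> : sep e v v' by rewrite ltr01.
rewrite eE sepE // /sp !ltnn; move: vv'; rewrite -val_eqE /=.
by case: ltngtP.
Qed.

(* Uncrossing keeps the shear coordinates and decreases the number of separated
   pairs, so a weight that minimises the total number of these is noncrossing. *)
Theorem lamination_exists (x : diag n -> R) : exists2 w : diag n -> R, lamination w &
  forall a b c d, quad m a b c d -> \sum_e w e * shear R e a b c d = x [set a; c]%SET.
Proof.
pose K := (label n * label n * label n * label n)%type.
pose A (k : K) e := let: (a, b, c, d) := k in
  if quad m a b c d then shear R e a b c d else 0.
pose B (k : K) := let: (a, b, c, d) := k in
  if quad m a b c d then x [set a; c]%SET else 0.
have [w0 [w0_ge0 w0_solid w0E]] := lamination_spanning mM x.
have feas0 : exists w, feasible (diagonal false) A B w.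
  exists w0; split=> // -[[[a b] c] d] /=; case: ifP => q; first exact: w0E.
  by apply: big1 => e _; rewrite mulr0.
have [w [w_ge0 w_solid wE] wmin] := linear_program_min separated_pairs_gt0 feas0.
exists w; last by move=> a b c d q; have := wE (a, b, c, d); rewrite /= q.
split=> // [e|v v' y y' we we'].
  by apply: contraNT => /w_solid->.
apply/negP => vy.
set e := [set v; v']%SET in we; set e' := [set y; y']%SET in we'.
have [de de'] : diagonal false e /\ diagonal false e'.
  by split; [apply: contraNT we|apply: contraNT we'] => /w_solid->.
have solid z f : diagonal false f -> z \in f -> odd (z : label n) = false.
  by move=> /andP[_ /forall_inP h] /h/eqP.
have [ev ev' ey ey'] : [/\ v \in e, v' \in e, y \in e' & y' \in e'].
  by rewrite !inE !eqxx !orbT.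
have [f [f' [df df' fE fle [h0 [k0 flt]]]]] :=
  resolution vy (solid _ _ de ev) (solid _ _ de ev') (solid _ _ de' ey) (solid _ _ de' ey').
have ee' : e != e'.
  apply/eqP => E; move: ev; rewrite E !inE => /orP[]/eqP vE; move: vy;
    rewrite vE /xing eqxx //=.
  by rewrite andbF.
pose t := Num.min (w e) (w e').
have t_gt0 : 0 < t by rewrite lt_min !lt_def we we' !w_ge0.
(* The weight [t] is moved from [e] and [e'] to [f] and [f']. As [e] and [e'] are distinct, each
   loses [t] only once and stays nonnegative. *)
pose w1 g := w g - t * (g == e)%:R - t * (g == e')%:R + t * (g == f)%:R + t * (g == f')%:R.
have w1sum (G : diag n -> R) : \sum_g w1 g * G g =
    \sum_g w g * G g - t * (G e + G e' - G f - G f').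
  have D (g0 : diag n) : \sum_g t * (g == g0)%:R * G g = t * G g0.
    rewrite (bigD1 g0) //= eqxx mulr1 big1 ?addr0 // => g /negbTE->.
    by rewrite mulr0 mul0r.
  under eq_bigr do rewrite /w1 !mulrDl !mulNr.
  by rewrite !big_split /= !sumrN !D; ring.
have F1 : feasible (diagonal false) A B w1.
  split=> [g|g ng|k].
  - rewrite /w1; have tf : 0 <= t * (g == f)%:R by rewrite mulr_ge0 ?ler0n // ltW.
    have tf' : 0 <= t * (g == f')%:R by rewrite mulr_ge0 ?ler0n // ltW.
    have tw : t <= w e by rewrite ge_min lexx.
    have tw' : t <= w e' by rewrite ge_min lexx orbT.
    have [ge|ge] := eqVneq g e.
      by rewrite ge (negbTE ee') mulr1 mulr0; move: tf tf'; rewrite ge; lra.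
    have [ge'|ge'] := eqVneq g e'.
      by rewrite ge' mulr1 mulr0; move: tf tf'; rewrite ge'; lra.
    by have := w_ge0 g; rewrite !mulr0; lra.
  - rewrite /w1 w_solid //.
    have ne g' : diagonal false g' -> (g == g') = false.
      by move=> dg'; apply: contraNF ng => /eqP->.
    by rewrite !ne // !mulr0 !subr0 !addr0.
  - rewrite w1sum wE; move: k => [[[a b] c] d] /=; case: ifP => q; last by ring.
    suff -> : shear R e a b c d + shear R e' a b c d - shear R f a b c d - shear R f' a
      b c d = 0.
      by rewrite mulr0 subr0.
    have fER h k : m h k -> (sep f h k)%:R + (sep f' h k)%:R = (sep e h k)%:R + (sep e'
      h k)%:R :> R.
      by move=> mhk; rewrite -!natrD fE.
    have /and5P[_ /fER ab /fER bc /fER cd /and3P[]] := q.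
    rewrite (mn_sym mM) => /fER ad _ _.
    have := shearE R e a b c d; have := shearE R e' a b c d.
    by have := shearE R f a b c d; have := shearE R f' a b c d; lra.
have := wmin _ F1.
under eq_bigr do rewrite mulrC; under [X in _ <= X]eq_bigr do rewrite mulrC.
rewrite w1sum; apply/negP; rewrite -ltNge ltrBlDr ltrDl mulr_gt0 //.
rewrite /separated_pairs -!big_split -!sumrB /=.
have leR h k : (sep f h k)%:R + (sep f' h k)%:R <= (sep e h k)%:R + (sep e' h k)%:R :> R.
  by rewrite -!natrD ler_nat.
rewrite (bigD1 h0) //= ltr_pwDl //.
  rewrite -!big_split -!sumrB (bigD1 k0) //= ltr_pwDl //.
    have : (sep f h0 k0)%:R + (sep f' h0 k0)%:R < (sep e h0 k0)%:R + (sep e' h0 k0)%:R :> R.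
      by rewrite -!natrD ltr_nat.
    by lra.
  by apply: sumr_ge0 => k _; have := leR h0 k; lra.
apply: sumr_ge0 => h _; rewrite -!big_split -!sumrB; apply: sumr_ge0 => k _ /=.
by have := leR h k; lra.
Qed.

End ExistenceMin.

(** * Combinatorial accordions *)

Section Accordion.
Variable n : nat.
Implicit Types (e f s : diag n) (a b c d h k l r u v x y z : label n).

Definition adjacent z l r := [/\ odd l, odd r, (r = z.+1 :> nat)%N &
  (l = (if z == 0 :> nat then 2 * n else z).-1 :> nat)%N].

Variables (m db : rel (label n)) (z1 z2 : label n).
Hypothesis mM : maximal_noncrossing m.
Hypothesis db_sym : symmetric db.
Hypothesis db_m : forall h k, db h k -> m h k.
Hypothesis db_adjacent : forall z l r, odd z = false -> adjacent z l r -> db l r.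
Hypothesis z12 : z1 != z2.
Hypothesis odd1 : odd z1 = false.
Hypothesis odd2 : odd z2 = false.

Local Notation cut h k := (sp z1 z2 h k).

Lemma adjacent_xing z l r h : odd z = false -> adjacent z l r -> odd h ->
  [|| ~~ (h != l :> nat), ~~ (h != r :> nat) | xing l r h z].
Proof.
move=> oz [ol or rE lE] oh; have zh : h != z :> nat by apply: contraTneq oh => ->;
  rewrite oz.
case hl : (h != l :> nat) => //=; case hr : (h != r :> nat) => //=.
by rewrite lE rE in hl hr *; apply: xing_pred_succ (ltn_ord z) (ltn_ord h) zh hl hr.
Qed.

Lemma adjacent_ex z : (z == z1) || (z == z2) ->
  exists l r, [/\ odd z = false, adjacent z l r, l != r & cut l r].
Proof.
move=> zz; have oz : odd z = false by case/orP: zz => /eqP->.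
have [l [r [ol or [rE lE] s]]] := hollow_neighbours oz.
have clr : cut l r.
  rewrite -sepE // s //; case/orP: zz => /eqP->; rewrite eqxx ?(negbTE z12) //.
  by rewrite eq_sym (negbTE z12).
exists l, r; split=> //; apply: contraTneq clr => ->.
by rewrite /sp; case: (_ < _)%N; case: (_ < _)%N.
Qed.

Definition cut_chord h k := db h k && cut h k.

(* The union of the chords cut by [z1 z2] is connected. *)
Definition linked := forall P : rel (label n), symmetric P ->
  (exists h k, cut_chord h k /\ P h k) -> (exists h k, cut_chord h k /\ ~~ P h k) ->
  exists h k k', [/\ cut_chord h k, cut_chord h k', P h k & ~~ P h k'].

Lemma cutC h k : cut h k = cut k h.
Proof.
by rewrite /sp; case: (_ < _)%N; case: (_ < _)%N; case: (_ < _)%N; case: (_ < _)%N.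
Qed.

Lemma z1_neq h : odd h -> z1 != h :> nat. Proof. by move=> oh; exact: odd_neq. Qed.
Lemma z2_neq h : odd h -> z2 != h :> nat. Proof. by move=> oh; exact: odd_neq. Qed.

Section Side.
Variables (u v b : label n) (s : bool).
Hypothesis muv : m u v.
Hypothesis mub : m u b.
Hypothesis mbv : m b v.
Hypothesis cut_uv : cut u v.
Hypothesis b_side : cw u v b == s.

Definition strictly_on h := [&& h != u, h != v & cw u v h == s].
Definition reaches_side h k := strictly_on h || strictly_on k.

Lemma not_on_side h k : m h k -> strictly_on k -> ~~ strictly_on h -> (h == u) || (h == v).
Proof.
move=> mhk /and3P[ku kv ks]; apply: contraNT; rewrite negb_or /strictly_on => /andP[hu hv].
rewrite hu hv /= -(eqP ks) cw_side //.
by rewrite (mn_noncrossing mM muv).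
Qed.

(** The chord is the edge between the hollow neighbours of the end [z] of the cut that lies on this
    side. If it did not reach the side, it would be [uv] itself, and then [b] could not be on the
    same side of [uv] as [z]. *)
Lemma end_on_side : exists h k, cut_chord h k /\ reaches_side h k.
Proof.
have [ou ov uv] := mn_hollow mM muv; have [_ ob ub] := mn_hollow mM mub.
have [_ _ bv] := mn_hollow mM mbv.
have /orP side : (cw u v z1 == s) || (cw u v z2 == s).
  by apply: sp_side cut_uv; rewrite ?z1_neq ?z2_neq.
have [z [zz zs]] : exists z : label n, (z == z1) || (z == z2) /\ cw u v z == s.
  by case: side => ?; [exists z1|exists z2]; rewrite eqxx ?orbT.
have [l [r [oz adj lr clr]]] := adjacent_ex zz; exists l, r.
have [ol or _ _] := adj; rewrite /cut_chord (db_adjacent oz adj) clr; split=> //.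
have ne h : odd h -> z != h :> nat by move=> oh; exact: odd_neq.
have A := adjacent_xing oz adj.
have stuck (w : label n) : odd w -> [&& w != u, w != v & xing u v w z] = false ->
  ~~ strictly_on w ->
    (w == u) || (w == v).
  move=> ow X; apply: contraNT; rewrite negb_or /strictly_on => /andP[wu wv].
  rewrite wu wv /= -(eqP zs) cw_side ?wu ?wv ?ne //.
  by move: X; rewrite wu wv /= => ->.
have Xl := xing_adjacent (ne _ ol) (ne _ or) (ne _ ou) (ne _ ov) uv lr (A _ ou) (A _ ov).
have A' h : odd h -> [|| ~~ (h != r :> nat), ~~ (h != l :> nat) | xing r l h z].
  by move=> /A; rewrite orbCA xingC.
have Xr : [&& r != u, r != v & xing u v r z] = false.
  apply: (@xing_adjacent r l) => //; rewrite ?ne //; first by rewrite eq_sym.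
    exact: A'.
  exact: A'.
apply: contraT; rewrite negb_or => /andP[/(stuck _ ol Xl) lE /(stuck _ or Xr) rE].
have x : xing u v b z.
  have := A _ ob; case/orP: lE => /eqP lE; case/orP: rE => /eqP rE; move: lr;
    rewrite lE rE ?eqxx // => _.
    by case/or3P => //; rewrite ?negbK => /eqP/val_inj bE; move: ub bv; rewrite bE eqxx.
  by rewrite xingC; case/or3P => //; rewrite ?negbK => /eqP/val_inj bE; move: ub bv;
    rewrite bE eqxx.
have bu : b != u by rewrite eq_sym.
by have := cw_side bu bv (ne _ ou) (ne _ ov); rewrite x (eqP b_side) (eqP zs) eqxx.
Qed.

Lemma wrong_end k : cut u b -> m v k -> strictly_on k -> ~~ cut v k.
Proof.
have [ou ov uv] := mn_hollow mM muv; have [_ ob ub] := mn_hollow mM mub.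
have [_ _ bv] := mn_hollow mM mbv.
move=> cub mvk /and3P[ku kv ks]; have [_ ok _] := mn_hollow mM mvk.
apply: (@sp_wrong_end u v b k z1 z2 s) => //; rewrite ?z1_neq ?z2_neq //;
  try by rewrite eq_sym.
exact: (mn_noncrossing mM mvk mub).
Qed.

Lemma right_end a : m u a -> strictly_on a -> cut u a -> cut u b.
Proof.
have [ou ov uv] := mn_hollow mM muv; have [_ ob ub] := mn_hollow mM mub.
have [_ _ bv] := mn_hollow mM mbv.
move=> mua /and3P[au av as_] cua; have [_ oa _] := mn_hollow mM mua.
apply: (@sp_right_end u v b a z1 z2 s) => //; rewrite ?z1_neq ?z2_neq //;
  try by rewrite eq_sym.
exact: (mn_noncrossing mM mua mbv).
Qed.

(** The cut chords on this side are linked to [uv], and only through [u], since [wrong_end] excludes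
    [v]. Choose [ua] nearest to [v]: a chord of [db] that crosses [va] would start at [u] and end
    nearer to [v], and it would be cut too. So the triangle [uva] lies in one cell. *)
Lemma linked_side : cut u b -> linked -> db u v ->
  exists a, [/\ cut_chord u a, strictly_on a & forall i j, db i j -> ~~ xing i j v a].
Proof.
have [ou ov uv] := mn_hollow mM muv.
move=> cub L duv.
have Psym : symmetric reaches_side by move=> h k; exact: orbC.
have [|h [k [k' [/andP[dhk chk] /andP[dhk' chk'] P1]]]] := L _ Psym end_on_side.
  exists u, v; rewrite /cut_chord duv cut_uv /reaches_side /strictly_on !eqxx /=.
  by rewrite andbF.
rewrite /reaches_side negb_or => /andP[nh _].
have {P1} Pk : strictly_on k by move: P1; rewrite /reaches_side (negbTE nh).
have hE := not_on_side (db_m dhk) Pk nh.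
have {hE} hu : h = u.
  case/orP: hE => /eqP hE //; move: chk (db_m dhk); rewrite hE => cvk mvk.
  by have := wrong_end cub mvk Pk; rewrite cvk.
rewrite {}hu in dhk chk.
have kS : cut_chord u k && strictly_on k by rewrite /cut_chord dhk chk.
have [a /andP[ca sa] amin] :=
  @arg_minnP _ k (fun a => cut_chord u a && strictly_on a) (before_on_side u v s) kS.
exists a; split=> // i j dij; apply/negP => x.
have /andP[dua cua] := ca; have /and3P[au av as_] := sa.
have [_ oa _] := mn_hollow mM (db_m dua).
have [oi oj ij] := mn_hollow mM (db_m dij).
have x' : xing a v i j by rewrite xingC xing_sym.
have aS : a \in on_side u v s by rewrite finset.in_set oa au av as_.
have close (j' : label n) : odd j' -> db u j' -> j' != v -> j' != a -> cw u v j' == s ->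
    cw u j' a == s -> False.
  move=> oj' duj jv ja js jas; have uj := mn_neq mM (db_m duj).
  have jS : j' \in on_side u v s by rewrite finset.in_set oj' jv js eq_sym uj.
  have lt := before_on_side_lt uv jS aS ja jas.
  have cuj : cut u j'.
    apply: (@sp_nearer u v a j' z1 z2 s) => //; rewrite ?z1_neq ?z2_neq //;
      by rewrite eq_sym.
  suff : (before_on_side u v s a <= before_on_side u v s j')%N by rewrite leqNgt lt.
  by apply: amin; rewrite /cut_chord duj cuj /strictly_on jv js eq_sym uj.
rewrite eq_sym in au; rewrite eq_sym in av.
have := xing_arc_second uv au av x' (mn_noncrossing mM muv (db_m dij))
  (mn_noncrossing mM (db_m dua) (db_m dij)) as_.
case/orP => /and5P[/negPn/eqP/val_inj E n1 n2 s1 s2]; rewrite E in dij.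
  exact: close n1 n2 s1 s2.
by rewrite db_sym in dij; exact: close n1 n2 s1 s2.
Qed.

End Side.

(* Off [db], the chord [uv] would separate the chords cut on its two sides. *)
Lemma linked_no_turn u v b d (s : bool) : linked -> m u v -> ~~ db u v ->
  m u b -> m b v -> m v d -> m d u -> cut u v -> cut u b -> cut v d ->
  cw u v b == s -> cw u v d != s -> False.
Proof.
move=> L muv nduv mub mbv mvd mdu cuv cub cvd bs ds.
have [ou ov uv] := mn_hollow mM muv.
have vu : v != u by rewrite eq_sym.
have mvu : m v u by rewrite (mn_sym mM).
have cvu : cut v u by rewrite cutC.
have ds' : cw v u d == s.
  by move: ds; rewrite cwC //; case: (cw v u d); case: (s).
have Psym : symmetric (reaches_side u v s) by move=> h k; exact: orbC.
have opp h : strictly_on v u s h -> ~~ strictly_on u v s h.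
  move=> /and3P[_ _ /eqP hs]; rewrite /strictly_on (cwC h uv) hs !negb_and.
  by case: (s); rewrite !orbT.
have [||h [k [k' [/andP[dhk chk] /andP[dhk' chk'] P1]]]] := L _ Psym.
- exact: (end_on_side muv mub mbv cuv bs).
- have [h [k [/andP[dhk chk] P1]]] := end_on_side mvu mvd mdu cvu ds'.
  exists h, k; rewrite /cut_chord dhk chk; split=> //.
  wlog oh : h k dhk chk P1 / strictly_on v u s h.
    move=> H; case/orP: (P1) => hk; first exact: H.
    by rewrite Psym; apply: H => //; rewrite 1?db_sym 1?cutC // /reaches_side hk.
  rewrite /reaches_side negb_or (opp _ oh) /=.
  apply/negP => ok; have := not_on_side muv (db_m dhk) ok (opp _ oh).
  by move: oh => /and3P[/negbTE-> /negbTE->].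
rewrite /reaches_side negb_or => /andP[nh nk'].
have {P1} Pk : strictly_on u v s k by move: P1; rewrite /reaches_side (negbTE nh).
have hE := not_on_side muv (db_m dhk) Pk nh.
have {hE} hu : h = u.
  case/orP: hE => /eqP hE //; move: chk (db_m dhk); rewrite hE => cvk mvk.
  by have := wrong_end muv mub mbv cuv bs cub mvk Pk; rewrite cvk.
rewrite {}hu in dhk chk dhk' chk'.
have k'u : k' != u by rewrite eq_sym (mn_neq mM (db_m dhk')).
have k'v : k' != v by apply: contraNneq nduv => <-.
have Pk' : strictly_on v u s k'.
  rewrite /strictly_on k'u k'v /=; move: nk'; rewrite /strictly_on k'u k'v /=.
  by rewrite (cwC k' uv); case: (cw v u k'); case: (s).
by have := wrong_end mvu mvd mdu cvu ds' cvd (db_m dhk') Pk'; rewrite chk'.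
Qed.

(** * Absence of turns implies linkedness *)

Section Fan.
Hypothesis no_turn : forall a b c d, quad m a b c d -> ~~ db a c ->
  ~~ [&& cut a b, ~~ cut b c & cut c d] && ~~ [&& cut b c, ~~ cut c d & cut d a].

(* The hollow labels strictly on the side of [z1] of the chord [ac]. *)
Definition near_z1 a c := [set x : label n | [&& odd x, x != a, x != c & ~~ xing a c x
  z1]]%SET.

Lemma near_z1C a c : near_z1 a c = near_z1 c a.
Proof.
by apply/finset.setP => x; rewrite !inE xingC; case: (x != a); case: (x != c).
Qed.

Lemma near_z1_eq0 a c l r : m a c -> adjacent z1 l r -> l != r -> #|near_z1 a c| = 0%N ->
  (a = l /\ c = r) \/ (a = r /\ c = l).
Proof.
move=> mac adj lr /eqP; rewrite cards_eq0 => /eqP e0.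
have [ol or _ _] := adj; have [oa oc ac] := mn_hollow mM mac.
have A := adjacent_xing odd1 adj.
have ne h : odd h -> z1 != h :> nat by exact: z1_neq.
have stuck (w : label n) : odd w -> [&& w != a, w != c & xing a c w z1] = false ->
    (w == a) || (w == c).
  move=> ow X; apply: contraT; rewrite negb_or => /andP[wa wc].
  have : w \in near_z1 a c by rewrite finset.in_set ow wa wc /=; move: X;
    rewrite wa wc /= => ->.
  by rewrite e0 finset.in_set0.
have Xl := xing_adjacent (ne _ ol) (ne _ or) (ne _ oa) (ne _ oc) ac lr (A _ oa) (A _ oc).
have A' h : odd h -> [|| ~~ (h != r :> nat), ~~ (h != l :> nat) | xing r l h z1].
  by move=> /A; rewrite orbCA xingC.
have Xr : [&& r != a, r != c & xing a c r z1] = false.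
  apply: (@xing_adjacent r l) => //; rewrite ?ne //; first by rewrite eq_sym.
    exact: A'.
  exact: A'.
case/orP: (stuck _ ol Xl) => /eqP lE; case/orP: (stuck _ or Xr) => /eqP rE;
  move: lr; rewrite lE rE ?eqxx //; by [left|right].
Qed.

Lemma near_z1_lt a b c : m a b -> m a c -> m b c -> ~~ xing a c b z1 -> xing a b c z1 ->
  (#|near_z1 a b| < #|near_z1 a c|)%N.
Proof.
move=> mab mac mbc x1 x2.
have [oa ob ab] := mn_hollow mM mab; have [_ oc ac] := mn_hollow mM mac.
have [_ _ bc] := mn_hollow mM mbc.
apply: proper_card; apply/properP; split; last first.
  exists b; first by rewrite finset.in_set ob bc eq_sym ab.
  by rewrite finset.in_set eqxx !andbF.
apply/fintype.subsetP => x; rewrite !finset.in_set => /and4P[ox xa xb nx].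
have xz : x != z1 :> nat by rewrite eq_sym z1_neq.
have /andP[xc nx'] := fan_shrink ab ac bc (z1_neq oa) (z1_neq ob) (z1_neq oc) xa xb xz
  x1 x2 nx.
by rewrite ox xa nx' andbT.
Qed.

(** The cut runs through the fan of triangles at [a]. If [ab] is not in [db], the cut does not turn
    there, so it leaves the next triangle [abd] through [ad]. Fewer and fewer vertices remain on the
    side of [z1], and the last possible chord is an edge, which is in [db]. *)
Lemma fan_chord a b c : m a b -> m a c -> m b c -> cut a b -> ~~ cut b c ->
  ~~ xing a c b z1 ->
  exists k, cut_chord a k /\ (#|near_z1 a k| <= #|near_z1 a b|)%N.
Proof.
have [N leN] := ex_intro (fun N => #|near_z1 a b| <= N)%N _ (leqnn _).
elim: N b c leN => [|N IH] b c leN mab mac mbc cab ncbc x1.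
  have [|l [r [_ adj lr clr]]] := @adjacent_ex z1; first by rewrite eqxx.
  have d1 := db_adjacent odd1 adj; exists b; rewrite /cut_chord cab andbT; split=> //.
  move: leN; rewrite leqn0 => /eqP/(near_z1_eq0 mab adj lr)[[-> ->]|[-> ->]] //.
  by rewrite db_sym.
have [dab|ndab] := boolP (db a b); first by exists b; rewrite /cut_chord dab cab.
have [oa ob ab] := mn_hollow mM mab; have [_ oc ac] := mn_hollow mM mac.
have [_ _ bc] := mn_hollow mM mbc.
have cC : cut b c = cut c b := cutC b c.
have x2 : xing a b c z1.
  apply: (@fan_side a b c z1 z2) => //; rewrite ?z1_neq ?z2_neq // .
have [/eqP e0|ne0] := boolP (#|near_z1 a b| == 0%N).
  have [|l [r [_ adj lr clr]]] := @adjacent_ex z1; first by rewrite eqxx.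
  have d1 := db_adjacent odd1 adj; case/negP: ndab.
  by case: (near_z1_eq0 mab adj lr e0) => -[-> ->] //; rewrite db_sym.
have /card_gt0P[h0] : (0 < #|near_z1 a b|)%N by rewrite lt0n.
rewrite finset.in_set => /and4P[oh0 h0a h0b nx0].
have hS : h0 \in on_side a b (cw a b z1).
  by rewrite finset.in_set oh0 h0a h0b cw_side ?z1_neq.
have [d [mad mdb]] := triangle_ex mM mab hS.
rewrite finset.in_set => /and4P[od da db' ds].
have ds' : ~~ xing a b d z1 by rewrite -cw_side ?z1_neq.
have cs : cw a b c != cw a b z1.
  by rewrite cw_side ?z1_neq ?negbK // eq_sym.
have ncdb : ~~ cut d b.
  have mca : m c a by rewrite (mn_sym mM).
  have mba : m b a by rewrite (mn_sym mM).
  have mcb : m c b by rewrite (mn_sym mM).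
  have mbd : m b d by rewrite (mn_sym mM).
  have mda : m d a by rewrite (mn_sym mM).
  have cac : cut a c by rewrite (sp_add z1 z2 a b c) cab (negbTE ncbc).
  case cbc : (cw a b c).
    have q : quad m a c b d.
      by rewrite /quad mab mac mcb mbd mda cbc /=; move: cs ds; rewrite cbc;
        case: (cw a b z1); case: (cw a b d).
    have /andP[+ _] := no_turn q ndab; rewrite cac -cC ncbc /=.
    by rewrite cutC.
  have q : quad m a d b c.
    by rewrite /quad mab mad mdb mbc mca cbc /=; move: cs ds; rewrite cbc;
      case: (cw a b z1); case: (cw a b d).
  by have /andP[_] := no_turn q ndab; rewrite ncbc [cut c a]cutC cac !andbT.
have cad : cut a d by rewrite (sp_add z1 z2 a b d) cab (cutC b d) (negbTE ncdb).
have ad : a != d by rewrite eq_sym.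
have x3 : xing a d b z1.
  by apply: (@fan_side a d b z1 z2) => //; rewrite ?z1_neq ?z2_neq.
have lt := near_z1_lt mad mab mdb ds' x3.
have [|k [ck le]] := IH d b _ mad mab mdb cad ncdb ds'.
  by rewrite -ltnS; exact: leq_trans lt leN.
by exists k; split=> //; exact: leq_trans le (ltnW lt).
Qed.

(** Towards [z1], the cut leaves the triangle on [ac] through one of its two other sides, and then
    stays in the fan of the common end of that side and [ac] until it meets [db]. *)
Lemma inward_chord a c : cut_chord a c -> (0 < #|near_z1 a c|)%N ->
  (exists k, cut_chord a k /\ (#|near_z1 a k| < #|near_z1 a c|)%N) \/
  (exists k, cut_chord c k /\ (#|near_z1 c k| < #|near_z1 a c|)%N).
Proof.
move=> /andP[dac cac] /card_gt0P[h0]; have mac := db_m dac.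
have [oa oc ac] := mn_hollow mM mac.
rewrite finset.in_set => /and4P[oh0 h0a h0c nx0].
have hS : h0 \in on_side a c (cw a c z1).
  by rewrite finset.in_set oh0 h0a h0c cw_side ?z1_neq.
have [b [mab mbc]] := triangle_ex mM mac hS.
rewrite finset.in_set => /and4P[ob ba bc bs].
have bs' : ~~ xing a c b z1 by rewrite -cw_side ?z1_neq.
have ab := mn_neq mM mab; have nbc := mn_neq mM mbc.
have [cab|ncab] := boolP (cut a b).
  have ncbc : ~~ cut b c by move: cac; rewrite (sp_add z1 z2 a b c) cab.
  left; have [k [ck le]] := fan_chord mab mac mbc cab ncbc bs'.
  exists k; split=> //; apply: leq_ltn_trans le _; apply: near_z1_lt => //.
  by apply: (@fan_side a b c z1 z2) => //; rewrite ?z1_neq ?z2_neq.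
have ccb : cut c b by move: cac; rewrite (sp_add z1 z2 a b c) (negbTE ncab) cutC.
have mcb : m c b by rewrite (mn_sym mM).
have mca : m c a by rewrite (mn_sym mM).
have mba : m b a by rewrite (mn_sym mM).
have bs2 : ~~ xing c a b z1 by rewrite xingC.
have ncba : ~~ cut b a by rewrite cutC.
right; have [k [ck le]] := fan_chord mcb mca mba ccb ncba bs2.
exists k; split=> //; apply: leq_ltn_trans le _; rewrite (near_z1C a c);
  apply: near_z1_lt => //.
by apply: (@fan_side c b a z1 z2) => //; rewrite ?z1_neq ?z2_neq // eq_sym.
Qed.

(** From any cut chord, [inward_chord] leads to the edge [lr] at [z1] through cut chords that share
    an end with their predecessor. If [P] differs at the two extremities of this path, it changes at
    some step. *)
Lemma linked_of_no_turn : linked.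
Proof.
move=> P Psym [h1 [k1 [c1 P1]]] [h2 [k2 [c2 P2]]].
have [|l [r [_ adj lr clr]]] := @adjacent_ex z1; first by rewrite eqxx.
have cutC' h k : cut_chord h k = cut_chord k h by rewrite /cut_chord db_sym cutC.
suff key a c : cut_chord a c -> P a c != P l r ->
    exists h k k', [/\ cut_chord h k, cut_chord h k', P h k & ~~ P h k'].
  have [Plr|nPlr] := boolP (P l r); first by apply: (key _ _ c2); rewrite Plr (negbTE P2).
  by apply: (key _ _ c1); rewrite P1 (negbTE nPlr).
move: {-1}#|near_z1 a c| (leqnn #|near_z1 a c|) => N.
elim: N a c => [|N IH] a c leN cac Pac.
  move: leN; rewrite leqn0 => /eqP.
  have /andP[/db_m mac _] := cac.
  by move: Pac => /[swap] /(near_z1_eq0 mac adj lr)[[-> ->]|[-> ->]]; rewrite 1?Psym eqxx.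
have [/eqP e0|ne0] := boolP (#|near_z1 a c| == 0%N).
  have /andP[/db_m mac _] := cac.
  by move: Pac; have [[-> ->]|[-> ->]] := near_z1_eq0 mac adj lr e0; rewrite 1?Psym eqxx.
have pick_side x y k : cut_chord x y -> P x y != P l r -> cut_chord x k ->
    (#|near_z1 x k| <= N)%N ->
    exists h k k', [/\ cut_chord h k, cut_chord h k', P h k & ~~ P h k'].
  move=> cxy Pxy cxk lek; have [Pxk|] := eqVneq (P x k) (P l r); last exact: IH.
  case Plr: (P l r) Pxy Pxk => Pxy Pxk.
    by exists x, k, y; rewrite Pxk; split=> //; move: Pxy; case: (P x y).
  by exists x, y, k; rewrite Pxk; split=> //; move: Pxy; case: (P x y).
rewrite -lt0n in ne0.
have [[k [ck lt]]|[k [ck lt]]] := inward_chord cac ne0.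
  by apply: pick_side cac Pac ck _; rewrite -ltnS (leq_trans lt).
apply: (@pick_side c a k) => //; first by rewrite cutC'.
  by rewrite Psym.
by rewrite -ltnS; exact: leq_trans lt leN.
Qed.

End Fan.
End Accordion.

(** * Geometry of the circle *)

Section Plane.
Variable R : realType.
Local Notation plane := (R * R)%type.
Implicit Types (a b c d x y : plane) (s t : R).

Lemma orient_rot a b c : orient a b c = orient b c a.
Proof. by rewrite /orient; ring. Qed.

Lemma orient_swap a b c : orient a b c = - orient b a c.
Proof. by rewrite /orient; ring. Qed.

Lemma orient_convex a b x y s t : s + t = 1 ->
  orient a b (s *: x + t *: y) = s * orient a b x + t * orient a b y.
Proof. move=> st; have -> : t = 1 - s by [lra]. by rewrite /orient /= /GRing.scale /=;
  ring. Qed.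

Lemma orientaa a b : orient a b a = 0.
Proof. by rewrite /orient; ring. Qed.

Lemma orientbb a b : orient a b b = 0.
Proof. by rewrite /orient; ring. Qed.

Lemma orient_continuous a b : continuous (fun x => orient a b x : R^o).
Proof.
move=> x; rewrite /orient; apply: cvgB.
  by apply: cvgMr; apply: cvgB; [exact: cvg_snd|exact: cvg_cst].
by apply: cvgMr; apply: cvgB; [exact: cvg_fst|exact: cvg_cst].
Qed.

(** The parameter [t] is that of the orthogonal projection on the line. It lies between 0 and 1
    because [|x|^2 = 1 - t (1 - t) N] when [a] and [b] are unit vectors, where [N] is the squared
    length of the chord. *)
Lemma chord_param (a1 a2 b1 b2 x1 x2 : R) :
  a1 ^+ 2 + a2 ^+ 2 = 1 -> b1 ^+ 2 + b2 ^+ 2 = 1 -> x1 ^+ 2 + x2 ^+ 2 <= 1 ->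
  (b1 - a1) * (x2 - a2) - (b2 - a2) * (x1 - a1) = 0 ->
  (b1 - a1) ^+ 2 + (b2 - a2) ^+ 2 != 0 ->
  exists s t, [/\ 0 <= s, 0 <= t, s + t = 1, x1 = s * a1 + t * b1 & x2 = s * a2 + t * b2].
Proof.
move=> a b x o; set N := _ + _ => N0.
have N_gt0 : 0 < N by rewrite lt_def N0 addr_ge0 ?sqr_ge0.
pose t := ((x1 - a1) * (b1 - a1) + (x2 - a2) * (b2 - a2)) / N.
have tN : t * N = (x1 - a1) * (b1 - a1) + (x2 - a2) * (b2 - a2) by rewrite /t divfK.
have E1 : x1 = (1 - t) * a1 + t * b1.
  apply: (mulfI N0); transitivity (N * a1 + (t * N) * (b1 - a1)); last by ring.
  rewrite tN /N; apply/eqP; rewrite -subr_eq0; apply/eqP.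
  transitivity (- (b2 - a2) * ((b1 - a1) * (x2 - a2) - (b2 - a2) * (x1 - a1)));
    first by ring.
  by rewrite o mulr0.
have E2 : x2 = (1 - t) * a2 + t * b2.
  apply: (mulfI N0); transitivity (N * a2 + (t * N) * (b2 - a2)); last by ring.
  rewrite tN /N; apply/eqP; rewrite -subr_eq0; apply/eqP.
  transitivity ((b1 - a1) * ((b1 - a1) * (x2 - a2) - (b2 - a2) * (x1 - a1))); first by ring.
  by rewrite o mulr0.
clearbody t.
have tt : 0 <= t * (1 - t).
  rewrite -(pmulr_lge0 _ N_gt0).
  have : x1 ^+ 2 + x2 ^+ 2 = (1 - t) * (a1 ^+ 2 + a2 ^+ 2) + t * (b1 ^+ 2 + b2 ^+ 2) - t
    * (1 - t) * N.
    rewrite E1 E2 /N; ring.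
  by rewrite a b; lra.
by exists (1 - t), t; split=> //; [nra|nra|ring].
Qed.

End Plane.

Section Circle.
Variables (R : realType) (n : nat) (p : label n -> (R * R)%type).
Hypothesis n2 : (2 <= n)%N.
Hypothesis p_cw : clockwise_on_circle p.
Implicit Types (a b c d i j h k : label n) (x y : (R * R)%type) (e f : diag n).

Lemma orient_lt0 a b c : a != b -> b != c -> a != c -> cw a b c ->
  orient (p a) (p b) (p c) < 0.
Proof.
case: p_cw => _ cwp ab bc ac cwabc; have /or3P[] := cw_cyclic ab bc ac cwabc.
- exact: cwp.
- by rewrite orient_rot; exact: cwp.
- by rewrite -orient_rot; exact: cwp.
Qed.

Lemma orient_gt0 a b c : a != b -> b != c -> a != c -> ~~ cw a b c ->
  0 < orient (p a) (p b) (p c).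
Proof.
move=> ab bc ac ncw; rewrite orient_swap oppr_gt0; apply: orient_lt0 => //.
  by rewrite eq_sym.
by rewrite cwC // eq_sym.
Qed.

Lemma orient_neq0 a b c : a != b -> b != c -> a != c -> orient (p a) (p b) (p c) != 0.
Proof.
move=> ab bc ac; case: (boolP (cw a b c)) => h.
  by rewrite lt_eqF // orient_lt0.
by rewrite gt_eqF // orient_gt0.
Qed.

Lemma hull_pairP a b x : a != b -> hull p [set a; b]%SET x <->
  exists s t, [/\ 0 <= s, 0 <= t, s + t = 1 & x = s *: p a + t *: p b].
Proof.
move=> ab; split=> [[w [w_ge0 ]]|[s [t [s0 t0 st ->]]]].
  rewrite !big_setU1 ?inE //= !big_set1 => w1 ->.
  by exists (w a), (w b).
exists (fun i => if i == a then s else t); rewrite !big_setU1 ?inE //= !big_set1 eqxx.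
by rewrite eq_sym (negbTE ab); split=> // i; case: ifP.
Qed.

Lemma open_hull_pairP a b x : a != b -> open_hull p [set a; b]%SET x <->
  exists s t, [/\ 0 < s, 0 < t, s + t = 1 & x = s *: p a + t *: p b].
Proof.
move=> ab; split=> [[w [w_ge0 ]]|[s [t [s0 t0 st ->]]]].
  rewrite !big_setU1 ?inE //= !big_set1 => w1 ->.
  by exists (w a), (w b).
exists (fun i => if i == a then s else t); rewrite !big_setU1 ?inE //= !big_set1 eqxx.
by rewrite eq_sym (negbTE ab); split=> // i; case: ifP.
Qed.

Lemma orient_same_side a b c d : a != b -> c != a -> c != b -> d != a -> d != b ->
  ~~ xing a b c d -> 0 < orient (p a) (p b) (p c) * orient (p a) (p b) (p d).
Proof.
move=> ab ca cb da db; rewrite -cw_side // => /eqP E.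
case: (boolP (cw a b c)) => h.
  by rewrite nmulr_rgt0 orient_lt0 // -?E // eq_sym.
by rewrite pmulr_rgt0 orient_gt0 // -?E // eq_sym.
Qed.

Lemma orient_opposite a b c d : a != b -> xing a b c d ->
  orient (p a) (p b) (p c) * orient (p a) (p b) (p d) < 0.
Proof.
move=> ab x; have [ac ad bc bd] : [/\ a != c, a != d, b != c & b != d] by case/and5P: x.
have : cw a b c != cw a b d by rewrite cw_side 1?eq_sym // negbK.
case: (boolP (cw a b c)) => h; case: (boolP (cw a b d)) => // h' _.
  by rewrite nmulr_rlt0 ?orient_lt0 // orient_gt0.
by rewrite pmulr_rlt0 ?orient_gt0 // orient_lt0.
Qed.

Lemma opposite_ratio (A B : R) : A * B < 0 ->
  [/\ 0 < A / (A - B), 0 < - B / (A - B), A / (A - B) + - B / (A - B) = 1 & A - B != 0].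
Proof.
have [A0|A0|->] := ltrgt0P A; last by rewrite mul0r ltxx.
  rewrite pmulr_rlt0 // => B0; have S0 : 0 < A - B by lra.
  have nz : A - B != 0 by rewrite gt_eqF.
  by split; rewrite ?divr_gt0 ?oppr_gt0 // -mulrDl divff.
rewrite nmulr_rlt0 // => B0; have S0 : 0 < - (A - B) by lra.
have nz : A - B != 0 by rewrite -oppr_eq0 gt_eqF.
split=> //; last by rewrite -mulrDl divff.
  by rewrite -mulrNN -invrN; apply: divr_gt0 => //; rewrite oppr_gt0.
by rewrite mulNr -mulrN -invrN divr_gt0.
Qed.

(* The crossing point is read off the affine dependency between the four points. *)
Lemma cross_xing a b c d : a != b -> c != d -> [set a; b]%SET != [set c; d]%SET ->
  cross p [set a; b]%SET [set c; d]%SET <-> xing a b c d.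
Proof.
move=> ab cd ne; split=> [[x []]|x].
  move=> /(open_hull_pairP _ ab)[s [t [s0 t0 st xE]]].
  move=> /(open_hull_pairP _ cd)[s' [t' [s'0 t'0 st' xE']]].
  apply: contraT => nx.
  have e0 : s' * orient (p a) (p b) (p c) + t' * orient (p a) (p b) (p d) = 0.
    by rewrite -orient_convex // -xE' xE orient_convex // orientaa orientbb !mulr0 addr0.
  have one i j (l r : R) : i != j -> 0 < l -> 0 < r -> (i == a) || (i == b) ->
     [set i; j]%SET = [set c; d]%SET -> l * orient (p a) (p b) (p i) + r * orient (p a)
       (p b) (p j) = 0 -> False.
    move=> ij l0 r0 iab E; have -> : orient (p a) (p b) (p i) = 0.
      by case/orP: iab => /eqP->; rewrite ?orientaa ?orientbb.
    rewrite mulr0 add0r => /eqP; rewrite mulf_eq0 gt_eqF //=; apply/negP.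
    case/orP: iab => /eqP iE; apply: orient_neq0 => //; rewrite ?iE in ij E *;
      rewrite // 1?eq_sym //.
    - by apply: contraNneq ne => jE; rewrite -E jE.
    - by apply: contraNneq ne => jE; rewrite -E jE finset.setUC.
  have [/(one c d s' t' cd s'0 t'0)/(_ erefl e0)//|] := boolP ((c == a) || (c == b)).
  have [|/norP[da db] /norP[ca cb]] := boolP ((d == a) || (d == b)).
    move=> dab _; exfalso; apply: (one d c t' s') => //; first by rewrite eq_sym.
      exact: finset.setUC.
    by rewrite addrC.
  have := orient_same_side ab ca cb da db nx.
  have /eqP := e0; rewrite addr_eq0 => /eqP e1.
  have : 0 < (s' * orient (p a) (p b) (p c)) * (t' * orient (p a) (p b) (p d)) -> False.
    by rewrite e1 mulNr oppr_gt0 -expr2 ltNge sqr_ge0.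
  by move=> h pos; exfalso; apply: h; rewrite mulrACA mulr_gt0 // mulr_gt0.
have [ac ad bc bd] : [/\ a != c, a != d, b != c & b != d] by case/and5P: x.
pose A := orient (p c) (p d) (p b); pose B := orient (p c) (p d) (p a).
pose C := orient (p a) (p b) (p d); pose D := orient (p a) (p b) (p c).
have AB : A * B < 0 by rewrite mulrC orient_opposite // xing_sym.
have CD : C * D < 0 by rewrite mulrC orient_opposite.
have sumE : C - D = - (A - B) by rewrite /A /B /C /D /orient; ring.
have [s0 t0 st S0] := opposite_ratio AB; have [s'0 t'0 st' S'0] := opposite_ratio CD.
exists ((A / (A - B)) *: p a + (- B / (A - B)) *: p b); split.
  by apply/open_hull_pairP => //; exists (A / (A - B)), (- B / (A - B)).
apply/open_hull_pairP => //; exists (C / (C - D)), (- D / (C - D)); split=> //.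
have ring_id : A * (p a).1 - B * (p b).1 = - (C * (p c).1 - D * (p d).1) /\
    A * (p a).2 - B * (p b).2 = - (C * (p c).2 - D * (p d).2).
  by rewrite /A /B /C /D /orient; split; ring.
have ratio (u v w z : R) : A * u - B * v = - (C * w - D * z) ->
    A / (A - B) * u + - B / (A - B) * v = C / (C - D) * w + - D / (C - D) * z.
  move=> E; have -> : A / (A - B) * u + - B / (A - B) * v = (A * u - B * v) / (A - B).
    by field.
  by rewrite E sumE invrN; field.
case: ring_id => id1 id2; apply/pair_equal_spec.
by split; [exact: (ratio _ _ _ _ id1)|exact: (ratio _ _ _ _ id2)].
Qed.

(** Here [|x|^2] is the weighted mean of the scalar products of [x] with the [p i], each of which is
    at most [(|x|^2 + 1) / 2]. *)
Lemma in_disc col x : polygon p col x -> x.1 ^+ 2 + x.2 ^+ 2 <= 1.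
Proof.
case: p_cw => p1 _ [w [w_ge0 w1 xE]].
have x1 : x.1 = \sum_(i in [set i : label n | odd i == col]%SET) w i * (p i).1.
  by rewrite xE (big_morph fst (id1 := 0) (op1 := +%R)).
have x2 : x.2 = \sum_(i in [set i : label n | odd i == col]%SET) w i * (p i).2.
  by rewrite xE (big_morph snd (id1 := 0) (op1 := +%R)).
have : x.1 ^+ 2 + x.2 ^+ 2 <= \sum_(i in [set i : label n | odd i == col]%SET) w i *
  ((x.1 ^+ 2 + x.2 ^+ 2 + 1) / 2).
  have E : x.1 ^+ 2 + x.2 ^+ 2 = \sum_(i in [set i : label n | odd i == col]%SET) w i *
    (x.1 * (p i).1 + x.2 * (p i).2).
    under eq_bigr do rewrite mulrDr mulrCA [X in _ + X]mulrCA.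
    by rewrite big_split -!mulr_sumr -x1 -x2 !expr2.
  rewrite [X in X <= _]E; apply: ler_sum => i _; apply: ler_wpM2l => //.
  move: (p1 i) => /= p1i; rewrite ler_pdivlMr // -subr_ge0.
  have -> : x.1 ^+ 2 + x.2 ^+ 2 + 1 - (x.1 * (p i).1 + x.2 * (p i).2) * 2
     = (x.1 - (p i).1) ^+ 2 + (x.2 - (p i).2) ^+ 2 by rewrite -[X in _ + X - _]p1i; ring.
  by rewrite addr_ge0 ?sqr_ge0.
by rewrite -mulr_suml w1 mul1r; lra.
Qed.

Lemma third_label i j : exists k : label n, j != k /\ i != k.
Proof.
suff /existsP[k /andP[jk ik]] : [exists k : label n, (j != k) && (i != k)] by exists k.
apply: contraT; rewrite negb_exists => /forallP h.
have : (#|{: label n}| <= #|[set i; j]%SET|)%N.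
  apply: subset_leq_card; apply/fintype.subsetP => k _.
  by move: (h k); rewrite !inE negb_and !negbK orbC !(eq_sym k).
by rewrite card_ord cards2; case: (_ != _); lia.
Qed.

(* A chord of a disc is the part of its line inside the disc. *)
Lemma polygon_line col i j x : i != j -> polygon p col x -> orient (p i) (p j) x = 0 ->
  hull p [set i; j]%SET x.
Proof.
move=> ij /in_disc x_disc o0; apply/hull_pairP => //.
case: p_cw => /[dup]/(_ i) pi1 /(_ j) pj1 _.
have Ne : ((p j).1 - (p i).1) ^+ 2 + ((p j).2 - (p i).2) ^+ 2 != 0.
  apply/negP; rewrite paddr_eq0 ?sqr_ge0 // !sqrf_eq0.
  move=> /andP[/eqP E1 /eqP E2]; have [k [ki kj]] := third_label i j.
  by have := orient_neq0 ij ki kj; rewrite /orient E1 E2 !mul0r subrr eqxx.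
move: pi1 pj1 x_disc o0 Ne; case: (p i) => a1 a2; case: (p j) => b1 b2; case: x => x1 x2.
rewrite /orient /= => pi1 pj1 x_disc o0 Ne.
have [s [t [s0 t0 st E1 E2]]] := chord_param pi1 pj1 x_disc o0 Ne.
by exists s, t; split=> //; rewrite E1 E2.
Qed.

End Circle.

(** * Connectedness and accordion diagonals *)

Section Segments.
Variable R : realType.
Implicit Types (x y : (R * R)%type) (t : R) (S : set (R * R)%type).

Definition seg x y t : (R * R)%type := (1 - t) *: x + t *: y.

Lemma seg0 x y : seg x y 0 = x.
Proof. by rewrite /seg subr0 scale1r scale0r addr0. Qed.

Lemma seg1 x y : seg x y 1 = y.
Proof. by rewrite /seg subrr scale1r scale0r add0r. Qed.

Lemma seg_continuous x y : continuous (seg x y).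
Proof.
move=> t.
have -> : seg x y = (fun t : R => ((1 - t) * x.1 + t * y.1, (1 - t) * x.2 + t * y.2)).
  by apply/funext.
have c k l : (1 - t0) * k + t0 * l @[t0 --> t] --> (1 - t) * k + t * l.
  apply: cvgD; apply: cvgMl; last exact: cvg_id.
  by apply: cvgB; [exact: cvg_cst|exact: cvg_id].
exact: cvg_pair (c _ _) (c _ _).
Qed.

Lemma orient_seg (a b x y : (R * R)%type) t :
  orient a b (seg x y t) = (1 - t) * orient a b x + t * orient a b y.
Proof. by rewrite orient_convex // subrK. Qed.

Lemma seg_connected x y : connected (seg x y @` `[0, 1]%classic).
Proof.
apply: connected_continuous_connected; first exact: segment_connected.
exact: continuous_subspaceT (@seg_continuous x y).
Qed.

Lemma seg_closed x y : closed (seg x y @` `[0, 1]%classic).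
Proof.
apply: compact_closed; first exact: norm_hausdorff.
apply: continuous_compact; last exact: segment_compact.
exact: continuous_subspaceT (@seg_continuous x y).
Qed.

Lemma convex_connected S :
  (forall x y t, S x -> S y -> 0 <= t <= 1 -> S (seg x y t)) -> connected S.
Proof.
move=> convS; have [[x Sx]|S0] := pselect (S !=set0); last first.
  by move/set0P/negP/negPn/eqP: S0 => ->; exact: connected0.
have -> : S = \bigcup_(y in S) (seg x y @` `[0, 1]%classic).
  apply/seteqP; split=> [y Sy|z [y Sy [t /= t01 <-]]]; last by apply: convS;
    rewrite ?in_itv in t01 *.
  by exists y => //; exists 1; rewrite ?seg1 //= in_itv /= ler01 lexx.
apply: bigcup_connected => [|y _]; last exact: seg_connected.
by exists x => y _; exists 0; rewrite ?seg0 //= in_itv /= ler01 lexx.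
Qed.

Lemma seg_closure S x y : (forall t, 0 < t <= 1 -> S (seg y x t)) -> closure S y.
Proof.
move=> Sxy B; rewrite -{1}(seg0 y x) => /(seg_continuous (x := y) (y := x) (x0 := 0)).
rewrite /= nbhs_filterE => /nbhs_ballP[e /= e0 eB].
exists (seg y x (Num.min (e / 2) 1)); split.
  by apply: Sxy; rewrite lt_min divr_gt0 //= ltr01 ge_min lexx orbT.
apply: eB; rewrite /ball /= sub0r normrN ger0_norm; last first.
  by rewrite le_min ler01 divr_ge0 // ltW.
by rewrite gt_min ltr_pdivrMr // ltr_pMr // ltr1n.
Qed.

End Segments.

(** * Connected unions of chords *)

Section Chords.
Variables (R : realType) (n : nat) (p : label n -> (R * R)%type).
Hypothesis n2 : (2 <= n)%N.
Hypothesis p_cw : clockwise_on_circle p.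
Implicit Types (a b c d i j h k u v : label n) (x y : (R * R)%type) (e f : diag n).

Lemma hull_pairE a b : a != b -> hull p [set a; b]%SET = seg (p a) (p b) @` `[0, 1]%classic.
Proof.
move=> ab; apply/seteqP; split=> [x /(hull_pairP _ _ ab)[s [t [s0 t0 st ->]]]|x [t /=
  t01 <-]].
  by exists t; rewrite /= ?in_itv /= ?t0 -?st ?lerDr // /seg -st addrK.
apply/hull_pairP => //; exists (1 - t), t; rewrite subrK subr_ge0.
by move: t01; rewrite in_itv /= => /andP[].
Qed.

Lemma hull_left a b : a != b -> hull p [set a; b]%SET (p a).
Proof.
move=> ab; rewrite hull_pairE //; exists 0; rewrite ?seg0 //= in_itv /=.
by rewrite ler01 lexx.
Qed.

Lemma hull_right a b : a != b -> hull p [set a; b]%SET (p b).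
Proof. by move=> ab; rewrite finset.setUC; apply: hull_left; rewrite eq_sym. Qed.

(** If no end is shared, [c] and [d] are strictly on the same side of the line [ab], and so is every
    point of the segment [cd]. *)
Lemma hull_disjoint a b c d x : a != b -> c != d -> ~~ xing a b c d ->
  hull p [set a; b]%SET x -> hull p [set c; d]%SET x ->
  exists h, (h == a) || (h == b) /\ (h == c) || (h == d).
Proof.
move=> ab cd nx /(hull_pairP _ _ ab)[s [t [s0 t0 st xE]]].
move=> /(hull_pairP _ _ cd)[s' [t' [s'0 t'0 st' xE']]].
have [cab|/norP[ca cb]] := boolP ((c == a) || (c == b)); first by exists c;
  rewrite cab eqxx.
have [dab|/norP[da db]] := boolP ((d == a) || (d == b)).
  by exists d; rewrite dab eqxx orbT.
have e0 : s' * orient (p a) (p b) (p c) + t' * orient (p a) (p b) (p d) = 0.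
  by rewrite -orient_convex // -xE' xE orient_convex // orientaa orientbb !mulr0 addr0.
have oo := orient_same_side p_cw ab ca cb da db nx.
have nc : orient (p a) (p b) (p c) != 0 by apply: contraTneq oo => ->; rewrite mul0r ltxx.
set C := orient _ _ (p c) in e0 oo nc *; set E := orient _ _ (p d) in e0 oo *.
have CC : 0 < C * C by rewrite -expr2 exprn_even_gt0.
have : s' * (C * C) + t' * (C * E) = 0.
  by transitivity (C * (s' * C + t' * E)); [ring|rewrite e0 mulr0].
suff : 0 < s' * (C * C) + t' * (C * E) by move=> /[swap] ->; rewrite ltxx.
move: s'0; rewrite le_eqVlt => /predU1P[s'E|s'_gt0].
  by rewrite -s'E mul0r add0r mulr_gt0 //; lra.
by apply: ltr_pwDl; [exact: mulr_gt0|apply: mulr_ge0 => //; exact: ltW].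
Qed.

Section Connected.
Variables (D : {set diag n}) (z1 z2 : label n).
Hypothesis D_noncrossing : forall a b c d, [set a; b]%SET \in overline true D ->
  [set c; d]%SET \in overline true D -> ~~ xing a b c d.
Hypothesis D_hollow : forall d : diag n, d \in overline true D -> diagonal true d.
Hypothesis z12 : z1 != z2.
Hypothesis odd1 : odd z1 = false.
Hypothesis odd2 : odd z2 = false.

Local Notation db := (fun h k : label n => [set h; k]%SET \in overline true D).

Lemma cross_solid h k : odd h -> odd k -> h != k ->
  cross p [set h; k]%SET [set z1; z2]%SET <-> sp z1 z2 h k.
Proof.
move=> oh ok hk.
have [h1 h2 k1 k2] : [/\ z1 != h :> nat, z2 != h :> nat, z1 != k :> nat & z2 != k :> nat].
  by split; exact: odd_neq.
have hn : [set h; k]%SET != [set z1; z2]%SET.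
  apply: contraNneq h1 => /finset.setP/(_ z1); rewrite !inE eqxx /= =>
    /orP[/eqP->//|/eqP E].
  by move: k1; rewrite E eqxx.
rewrite cross_xing // /xing /sp !(eq_sym (nat_of_ord h), eq_sym (nat_of_ord k)) h1 h2 k1
  k2 /=.
have lt (i j : nat) : i != j -> (i < j)%N = ~~ (j < i)%N by case: ltngtP.
rewrite (lt z1 h) // (lt z2 h) // (lt z1 k) // (lt z2 k) //.
split; do 4 case: (_ < _)%N => //.
Qed.

Lemma db_neq h k : db h k -> [/\ odd h, odd k & h != k].
Proof.
move=> dhk; have [a [b [ab oa ob E]]] := diagonalP _ _ (D_hollow dhk).
have hk : h != k.
  apply: contraNneq ab => hk; move: E; rewrite hk finset.setUid => E.
  have : a \in [set k]%SET by rewrite E !inE eqxx.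
  have : b \in [set k]%SET by rewrite E !inE eqxx orbT.
  by rewrite !inE => /eqP-> /eqP->.
have S (x : label n) : x \in [set h; k]%SET -> odd x by rewrite E !inE => /orP[]/eqP->.
by split=> //; apply: S; rewrite !inE eqxx ?orbT.
Qed.

Lemma cut_chordP (d : diag n) : d \in overline true D /\ cross p d [set z1; z2]%SET <->
  exists h k, d = [set h; k]%SET /\ cut_chord db z1 z2 h k.
Proof.
split=> [[dD dc]|[h [k [-> /andP[dD hk]]]]].
  have [h [k [hk oh ok E]]] := diagonalP _ _ (D_hollow dD).
  exists h, k; split=> //; rewrite /cut_chord -E dD /=; apply/cross_solid => //.
  by rewrite -E.
by have [oh ok nhk] := db_neq dD; split=> //; apply/cross_solid.
Qed.

Definition cut_union := \bigcup_(d in [set d : diag n | d \in overline true D /\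
  cross p d [set z1; z2]%SET]) hull p d.

(** Otherwise the cut chords that satisfy [P] and the others would cover the union by two nonempty
    closed sets, disjoint because noncrossing chords meet only at common ends. *)
Lemma connected_linked : connected cut_union -> linked db z1 z2.
Proof.
move=> conn P Psym [h1 [k1 [c1 P1]]] [h2 [k2 [c2 P2]]].
apply: contrapT => no.
have all_P h k k' : cut_chord db z1 z2 h k -> cut_chord db z1 z2 h k' -> P h k -> P h k'.
  by move=> ck ck' Phk; apply: contraT => nP; exfalso; apply: no; exists h, k, k'.
pose U (Q : rel (label n)) := \bigcup_(z in [set z : label n * label n |
  cut_chord db z1 z2 z.1 z.2 /\ Q z.1 z.2]) hull p [set z.1; z.2]%SET.
have clU Q : closed (U Q).
  apply: closed_bigcup; first exact: finite_finset.
  by move=> z [/andP[/db_neq[_ _ ne] _] _]; rewrite hull_pairE //; exact: seg_closed.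
pose nP h k := ~~ P h k.
have Usub Q : U Q `<=` cut_union.
  move=> x [z [cz _] xz]; exists [set z.1; z.2]%SET => //.
  by apply/cut_chordP; exists z.1, z.2.
have disj x : U P x -> U nP x -> False.
  move=> [[a b] [/= cab Pab] xab] [[c d] [/= ccd Pcd] xcd].
  have /andP[/[dup] dab /db_neq[_ _ ab] _] := cab.
  have /andP[/[dup] dcd /db_neq[_ _ cd] _] := ccd.
  have [h [/orP hab /orP hcd]] := hull_disjoint ab cd (D_noncrossing dab dcd) xab xcd.
  have cC i j : cut_chord db z1 z2 i j = cut_chord db z1 z2 j i.
    by rewrite /cut_chord finset.setUC cutC.
  have [b' [cb' Pb']] : exists b', cut_chord db z1 z2 h b' /\ P h b'.
    by case: hab => /eqP->; [exists b|exists a; rewrite cC Psym].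
  have [d' [cd' Pd']] : exists d', cut_chord db z1 z2 h d' /\ ~~ P h d'.
    by case: hcd => /eqP->; [exists d|exists c; rewrite cC Psym].
  by move: Pd'; rewrite (all_P _ _ _ cb' cd').
have UE : U P = cut_union.
  apply: conn.
  - have /andP[/db_neq[_ _ ne] _] := c1.
    by exists (p h1); exists (h1, k1) => //=; exact: hull_left.
  - exists (~` U nP); first by rewrite openC.
    apply/seteqP; split=> [x Ux|x [[d dD xd] nU]].
      by split; [exact: Usub Ux|move=> /(disj x Ux)].
    have [h [k [dE ck]]] := (cut_chordP d).1 dD; exists (h, k); rewrite /= -?dE //;
      split=> //.
    by apply: contraT => nPhk; exfalso; apply: nU; exists (h, k); rewrite /= -?dE.
  - exists (U P) => //; apply/seteqP; split=> [x Ux|x []//].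
    by split=> //; exact: Usub Ux.
have x2 : cut_union (p h2).
  have /andP[/db_neq[_ _ ne] _] := c2.
  exists [set h2; k2]%SET; last exact: hull_left.
  by apply/cut_chordP; exists h2, k2.
rewrite -UE in x2; apply: disj x2 _.
have /andP[/db_neq[_ _ ne] _] := c2.
by exists (h2, k2) => //=; exact: hull_left.
Qed.

(** A part [B] that is open and closed in the union contains every chord that it meets; [linked] is
    applied to the relation of being contained in [B]. *)
Lemma linked_connected : linked db z1 z2 -> connected cut_union.
Proof.
move=> L B B0 [C1 oC1 BE1] [C2 cC2 BE2].
have Bsub : B `<=` cut_union by rewrite BE1 => x [].
have seg_in h k : cut_chord db z1 z2 h k -> forall x, B x -> hull p [set h; k]%SET x ->
    hull p [set h; k]%SET `<=` B.
  move=> ck x Bx hx; have /andP[/db_neq[_ _ ne] _] := ck.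
  have hA : hull p [set h; k]%SET `<=` cut_union.
    by move=> y hy; exists [set h; k]%SET => //; apply/cut_chordP; exists h, k.
  have conn : connected (hull p [set h; k]%SET) by rewrite hull_pairE //;
    exact: seg_connected.
  suff -> : hull p [set h; k]%SET = hull p [set h; k]%SET `&` B by apply: subIsetr.
  apply/esym/conn; first by exists x.
    by exists C1 => //; rewrite BE1 setIA (setIidl hA).
  by exists C2 => //; rewrite BE2 setIA (setIidl hA).
pose P h k := `[< hull p [set h; k]%SET `<=` B >].
have Psym : symmetric P by move=> h k; rewrite /P finset.setUC.
apply/seteqP; split=> // x [d dD xd].
have [h [k [dE ck]]] := (cut_chordP d).1 dD; rewrite dE in xd.
suff /asboolP : P h k by apply.
apply: contraT => nP.
have [y By] := B0; have [d' d'D yd'] := Bsub _ By.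
have [h' [k' [d'E ck']]] := (cut_chordP d').1 d'D; rewrite d'E in yd'.
have Phk' : P h' k' by apply/asboolP; exact: seg_in ck' _ By yd'.
have [||a [b [b' [cab cab' Pab]]]] := L P Psym.
- by exists h', k'.
- by exists h, k.
move=> /asboolP; case; apply: (seg_in _ _ cab' (p a)).
  move/asboolP: Pab; apply; have /andP[/db_neq[_ _ ne] _] := cab; exact: hull_left.
by have /andP[/db_neq[_ _ ne] _] := cab'; exact: hull_left.
Qed.

End Connected.
End Chords.

(** * Hollow dissections and their cells *)

Section Dissection.
Variables (R : realType) (n : nat) (p : label n -> (R * R)%type).
Hypothesis n2 : (2 <= n)%N.
Hypothesis p_cw : clockwise_on_circle p.
Implicit Types (a b c d i j h k l r u v z : label n) (e f s : diag n).

Lemma diagonal_set2 col h k : diagonal col [set h; k]%SET =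
  [&& h != k, odd h == col & odd k == col].
Proof.
rewrite /diagonal cards2; case: (h != k) => //=.
apply/forall_inP/andP => [H|[Hh Hk] x]; first by split; apply: H; rewrite !inE eqxx ?orbT.
by rewrite !inE => /orP[]/eqP->.
Qed.

Lemma set2_eq a b c d : [set a; b]%SET = [set c; d]%SET -> a != b ->
  (a = c /\ b = d) \/ (a = d /\ b = c).
Proof.
move=> E ab; have : a \in [set c; d]%SET by rewrite -E !inE eqxx.
have : b \in [set c; d]%SET by rewrite -E !inE eqxx orbT.
rewrite !inE => /orP[]/eqP bE /orP[]/eqP aE; move: ab; rewrite aE bE ?eqxx //;
  by [left|right].
Qed.

Lemma xing_refl a b : ~~ xing a b a b.
Proof. by rewrite /xing eqxx. Qed.

Lemma boundaryP a b : boundary true [set a; b]%SET ->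
  (b = a + 2 :> nat \/ b + 2 * n = a + 2 \/ a = b + 2 :> nat \/ a + 2 * n = b + 2)%N.
Proof.
move=> /andP[]; rewrite diagonal_set2 => /and3P[ab _ _].
move=> /exists_inP[i iab /exists_inP[j jab ij]].
have N2 : (2 < 2 * n)%N by lia.
move: iab jab; rewrite !inE => /orP[]/eqP iE /orP[]/eqP jE;
  have := mod_step (ltn_ord i) (ltn_ord j) N2 ij; rewrite iE jE; move: N2; clear; lia.
Qed.

Lemma boundary_noncrossing a b h k : boundary true [set a; b]%SET -> odd h -> odd k ->
  ~~ xing a b h k.
Proof.
move=> bd oh ok; have := boundaryP bd.
move: bd => /andP[]; rewrite diagonal_set2 => /and3P[_ /eqP oa /eqP ob] _.
move: oh ok oa ob (ltn_ord a) (ltn_ord b) (ltn_ord h) (ltn_ord k).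
by rewrite /xing; move: (nat_of_ord a) (nat_of_ord b) (nat_of_ord h) (nat_of_ord k) =>
  {}a {}b {}h {}k; clear; lia.
Qed.

Lemma adjacent_boundary z l r : odd z = false -> adjacent z l r -> boundary true [set l;
  r]%SET.
Proof.
move=> oz [ol or rE lE]; have zn := ltn_ord z.
have lr : l != r.
  apply/eqP => lr; move: lE; rewrite lr rE; case: ifP => [/eqP->|_] E; move: E n2;
    clear; lia.
rewrite /boundary diagonal_set2 lr ol or /=.
apply/exists_inP; exists l; rewrite ?inE ?eqxx //.
apply/exists_inP; exists r; rewrite ?inE ?eqxx ?orbT //.
rewrite rE lE; case: ifP => [/eqP->|]; last by case: (nat_of_ord z) => //= k _;
  rewrite addn2.
rewrite (_ : (2 * n).-1 + 2 = 1 + 2 * n)%N ?modnDr //; move: n2; clear; lia.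
Qed.

Section Fixed.
Variable D : {set diag n}.
Hypothesis D_diss : dissection p true D.

Lemma overline_hollow s : s \in overline true D -> diagonal true s.
Proof.
rewrite !inE => /orP[/(D_diss.1)/andP[]//|/andP[]//].
Qed.

Lemma overline_noncrossing a b c d : [set a; b]%SET \in overline true D ->
  [set c; d]%SET \in overline true D -> ~~ xing a b c d.
Proof.
move=> sD tD; have := overline_hollow tD; have := overline_hollow sD.
rewrite !diagonal_set2 => /and3P[ab /eqP oa /eqP ob] /and3P[cd /eqP oc /eqP od].
move: sD tD; rewrite !inE => /orP[sD|sB]; last by move=> _; exact: boundary_noncrossing.
move=> /orP[tD|tB]; last by rewrite xing_sym; exact: boundary_noncrossing.
have [E|ne] := eqVneq [set a; b]%SET [set c; d]%SET.
  have [[-> ->]|[-> ->]] := set2_eq E ab; first exact: xing_refl.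
  by rewrite xingCr xing_refl.
by apply/negP => x; apply: (D_diss.2 _ _ sD tD ne); apply/cross_xing.
Qed.

Lemma maximal_ex : exists2 m : rel (label n), maximal_noncrossing m &
  forall h k, [set h; k]%SET \in overline true D -> m h k.
Proof.
pose P (M : {set diag n}) := [forall s in M, diagonal true s] &&
  [forall a, forall b, forall c, forall d,
    ([set a; b]%SET \in M) ==> ([set c; d]%SET \in M) ==> ~~ xing a b c d].
have PP (M : {set diag n}) : reflect ((forall s, s \in M -> diagonal true s) /\
    (forall a b c d, [set a; b]%SET \in M -> [set c; d]%SET \in M ->
      ~~ xing a b c d)) (P M).
  apply: (iffP andP) => -[h1 h2]; split.
  - by move=> s; exact/forall_inP.
  - move=> a b c d ab cd; move/forallP: h2 => /(_ a)/forallP/(_ b)/forallP/(_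
    c)/forallP/(_ d).
    by rewrite ab cd.
  - exact/forall_inP.
  - apply/forallP => a; apply/forallP => b; apply/forallP => c; apply/forallP => d.
    by apply/implyP => ab; apply/implyP => cd; exact: h2.
have PD : P (overline true D).
  by apply/PP; split; [exact: overline_hollow|exact: overline_noncrossing].
have [M /maxsetP[/PP[M1 M2] Mmax] DM] := maxset_exists PD.
exists (fun h k => [set h; k]%SET \in M); last by move=> h k; exact: (fintype.subsetP DM).
split.
- by move=> h k; rewrite finset.setUC.
- by move=> a b /M1; rewrite diagonal_set2 => /and3P[ab /eqP-> /eqP->].
- exact: M2.
move=> a b oa ob ab nx; rewrite -(Mmax ([set a; b]%SET |: M)%SET) ?setU11
  ?finset.subsetUr //.
apply/PP; split=> [s|a' b' c' d'].
  by rewrite !inE => /orP[/eqP->|/M1//]; rewrite diagonal_set2 ab oa ob.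
have sub (s : diag n) : s \in ([set a; b]%SET |: M)%SET -> s = [set a; b]%SET \/ s \in M.
  by rewrite !inE => /orP[/eqP|]; [left|right].
move=> sM tM; have ab' : a' != b'.
  case: (sub _ sM) => [E|/M1]; last by rewrite diagonal_set2 => /andP[].
  by have : #|[set a'; b']%SET| = 2%N; [rewrite E cards2 ab|rewrite cards2;
    case: (a' != b')].
have cd' : c' != d'.
  case: (sub _ tM) => [E|/M1]; last by rewrite diagonal_set2 => /andP[].
  by have : #|[set c'; d']%SET| = 2%N; [rewrite E cards2 ab|rewrite cards2;
    case: (c' != d')].
have nx' x y c d : [set x; y]%SET = [set a; b]%SET -> x != y -> [set c; d]%SET \in M ->
  ~~ xing x y c d.
  by move=> E xy cM; have [[-> ->]|[-> ->]] := set2_eq E xy; [|rewrite xingC]; exact: nx.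
case: (sub _ sM) => [sE|sM']; case: (sub _ tM) => [tE|tM'].
- have [[-> ->]|[-> ->]] := set2_eq sE ab'; have [[-> ->]|[-> ->]] := set2_eq tE cd';
    rewrite ?[xing b a _ _]xingC ?[xing a b b a]xingCr; exact: xing_refl.
- exact: nx'.
- by rewrite xing_sym; exact: nx'.
- exact: M2.
Qed.

End Fixed.
End Dissection.

(** * Cells as systems of signs *)

Section Cells.
Variables (R : realType) (n : nat) (p : label n -> (R * R)%type).
Hypothesis n2 : (2 <= n)%N.
Hypothesis p_cw : clockwise_on_circle p.
Implicit Types (a b c d i j h k l r u v z : label n) (e f s : diag n) (x y : (R * R)%type).
Variable D : {set diag n}.
Hypothesis D_diss : dissection p true D.

Local Notation o i j := (orient (p i) (p j)).
Local Notation cut := (cut_polygon p true D).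

Lemma D_hollow i j : [set i; j]%SET \in D -> [/\ i != j, odd i & odd j].
Proof.
move=> dD; have := overline_hollow D_diss (s := [set i; j]%SET).
rewrite !inE dD => /(_ isT); rewrite diagonal_set2.
by move=> /and3P[ij /eqP-> /eqP->].
Qed.

Lemma D_pair s : s \in D -> exists i j, s = [set i; j]%SET /\ i != j.
Proof.
move=> sD; have /andP[/diagonalP[i [j [ij _ _ E]]] _] := D_diss.1 _ sD.
by exists i, j.
Qed.

Lemma polygon_vertex h : odd h -> polygon p true (p h).
Proof.
move=> oh; exists (fun i => (i == h)%:R).
split=> [i||]; first exact: ler0n.
  rewrite (bigD1 h) ?inE ?oh //= eqxx big1 ?addr0 // => i /andP[_ /negbTE->] //.
rewrite (bigD1 h) ?inE ?oh //= eqxx scale1r big1 ?addr0 // => i /andP[_ /negbTE->].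
by rewrite scale0r.
Qed.

Lemma polygon_convex col x y t : polygon p col x -> polygon p col y -> 0 <= t <= 1 ->
  polygon p col (seg x y t).
Proof.
move=> [w [w0 w1 ->]] [w' [w'0 w'1 ->]] /andP[t0 t1].
exists (fun i => (1 - t) * w i + t * w' i); split=> [i||].
- by rewrite addr_ge0 // mulr_ge0 ?subr_ge0.
- by rewrite big_split /= -!mulr_sumr w1 w'1 !mulr1 subrK.
rewrite /seg !scaler_sumr -big_split /=; apply: eq_bigr => i _.
by rewrite !scalerA -scalerDl.
Qed.

Lemma cut_orient_neq0 i j x : [set i; j]%SET \in D -> cut x -> o i j x != 0.
Proof.
move=> ijD [xP xD]; have [ij _ _] := D_hollow ijD.
apply/eqP => o0; apply: xD; exists [set i; j]%SET => //.
exact: polygon_line n2 p_cw _ _ _ _ ij xP o0.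
Qed.

(** In the cut polygon the classes of this relation are the components: a class is convex, hence
    connected, and on a component [orient] does not vanish, hence keeps its sign. *)
Definition same_side x y := forall i j, [set i; j]%SET \in D -> 0 < o i j x * o i j y.

Lemma same_side_component x y : cut x -> polygon p true y -> same_side x y ->
  connected_component cut x y.
Proof.
move=> xcut yP xy.
pose S := [set y | polygon p true y /\ same_side x y].
have Scut : S `<=` cut.
  move=> z [zP xz]; split=> // -[s /= sD zs].
  have [i [j [sE ij]]] := D_pair sD; rewrite sE in sD zs.
  have /(hull_pairP _ _ ij)[l [r [_ _ lr zE]]] := zs.
  have := xz _ _ sD; rewrite zE orient_convex // orientaa orientbb !mulr0 addr0.
  by rewrite mulr0 ltxx.
have Sx : S x.
  split; first by case: xcut.
  by move=> i j ijD; rewrite -expr2 exprn_even_gt0 //= cut_orient_neq0.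
apply: (connected_component_max Sx Scut) => //.
apply: convex_connected => u v t [uP xu] [vP xv] t01.
split; first exact: polygon_convex.
move=> i j ijD; rewrite orient_seg mulrDr mulrCA [X in _ + X]mulrCA.
have := xu _ _ ijD; have := xv _ _ ijD; case/andP: t01.
set A := _ * _; set B := _ * _; rewrite le_eqVlt => /predU1P[<-|t0] t1 B0 A0.
  by rewrite subr0 mul1r mul0r addr0.
apply: ltr_wpDl; last exact: mulr_gt0.
by rewrite mulr_ge0 ?subr_ge0 // ltW.
Qed.

Lemma component_same_side x y : cut x -> connected_component cut x y -> same_side x y.
Proof.
move=> xcut xy i j ijD.
have cI : is_interval (o i j @` connected_component cut x).
  apply/connected_intervalP; apply: connected_continuous_connected.
    exact: component_connected.
  exact: continuous_subspaceT (@orient_continuous _ (p i) (p j)).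
have nz (z : (R * R)%type) : connected_component cut x z -> o i j z != 0.
  by move=> /connected_component_sub; exact: cut_orient_neq0.
have xx : connected_component cut x x by exact: connected_component_refl.
have no0 : ~ (o i j @` connected_component cut x) 0.
  by move=> [z /nz/eqP].
have [xI yI] : (o i j @` connected_component cut x) (o i j x) /\
    (o i j @` connected_component cut x) (o i j y) by split; [exists x|exists y].
have := nz _ xx; have := nz _ xy; rewrite !neq_lt => /orP[y0|y0] /orP[x0|x0].
- by rewrite nmulr_rgt0.
- by exfalso; apply: no0; apply: (cI _ _ yI xI); rewrite !ltW.
- by exfalso; apply: no0; apply: (cI _ _ xI yI); rewrite !ltW.
- by rewrite mulr_gt0.
Qed.

Lemma closure_weak_side x y i j : cut x -> closure (connected_component cut x) y ->
  [set i; j]%SET \in D -> 0 <= o i j x * o i j y.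
Proof.
move=> xcut yC ijD; have c0 : closed [set y | 0 <= o i j x * o i j y].
  apply: (@preimage_closed _ _ (fun y => o i j x * o i j y) [set t | 0 <= t]);
    last exact: closed_ge.
  move=> z _; apply: (@continuous_comp _ _ _ (o i j) (fun t : R => o i j x * t)).
    exact: orient_continuous.
  exact: mulrl_continuous.
apply: c0; apply: closureS yC => z zC.
exact: ltW (component_same_side xcut zC ijD).
Qed.

Lemma weak_side_closure x y : cut x -> polygon p true y ->
  (forall i j, [set i; j]%SET \in D -> 0 <= o i j x * o i j y) ->
  closure (connected_component cut x) y.
Proof.
move=> xcut yP xy; apply: (@seg_closure _ _ x) => t /andP[t0 t1].
have xP : polygon p true x by case: xcut.
apply: same_side_component => //; first by apply: polygon_convex => //; rewrite (ltW t0).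
move=> i j ijD; rewrite orient_seg mulrDr mulrCA [X in _ + X]mulrCA.
apply: ltr_wpDl; first by rewrite mulr_ge0 ?subr_ge0 ?xy.
by rewrite mulr_gt0 // -expr2 exprn_even_gt0 //= cut_orient_neq0.
Qed.

Lemma noncrossing_weak i j h k : i != j -> ~~ xing i j h k ->
  0 <= o i j (p h) * o i j (p k).
Proof.
move=> ij nx; have on0 w : (w == i) || (w == j) -> o i j (p w) = 0.
  by case/orP => /eqP->; rewrite ?orientaa ?orientbb.
have [hE|/norP[hi hj]] := boolP ((h == i) || (h == j)); first by rewrite on0 // mul0r.
have [kE|/norP[ki kj]] := boolP ((k == i) || (k == j)); first by rewrite (on0 k) // mulr0.
exact: ltW (orient_same_side p_cw ij hi hj ki kj nx).
Qed.

(* [C] is the cell of the barycentre of the triangle. *)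
Lemma triangle_cell u v a : u != v -> v != a -> a != u -> odd u -> odd v -> odd a ->
  (forall i j, [set i; j]%SET \in D ->
     [/\ ~~ xing i j u v, ~~ xing i j v a & ~~ xing i j a u]) ->
  exists C, [/\ cell p true D C, hull p [set u; v]%SET `<=` C, hull p [set a;
    u]%SET `<=` C &
    [set u; v]%SET \in D -> forall y, C y -> 0 <= o u v (p a) * o u v y].
Proof.
move=> uv va au ou ov oa nx.
pose x := seg (seg (p u) (p v) (1 / 2)) (p a) (1 / 3).
have oE i j : o i j x = (o i j (p u) + o i j (p v) + o i j (p a)) / 3.
  by rewrite !orient_seg; field.
have xP : polygon p true x.
  apply: polygon_convex; [apply: polygon_convex| |]; try exact: polygon_vertex.
    by apply/andP; split; lra.
  by apply/andP; split; lra.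
have weak i j w : [set i; j]%SET \in D -> (w == u) || (w == v) || (w == a) ->
    0 <= o i j x * o i j (p w).
  move=> ijD hw; have [ij _ _] := D_hollow ijD; have [n1 n3 n4] := nx _ _ ijD.
  have n1' := noncrossing_weak ij n1; have n3' := noncrossing_weak ij n3.
  have n4' := noncrossing_weak ij n4.
  have sq w' : 0 <= o i j (p w') * o i j (p w') by rewrite -expr2 sqr_ge0.
  have := sq u; have := sq v; have := sq a; rewrite oE.
  by case/orP: hw => [/orP[]|] /eqP->; move: n1' n3' n4';
    move: (o i j (p u)) (o i j (p v)) (o i j (p a)) => A B E; nra.
have xcut : cut x.
  split=> // -[s /= sD xs]; have [i [j [sE ij]]] := D_pair sD; rewrite sE in sD xs.
  have /(hull_pairP _ _ ij)[l [r [_ _ lr xE]]] := xs.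
  have o0 : o i j x = 0 by rewrite xE orient_convex // orientaa orientbb !mulr0 addr0.
  (* Some vertex [w] is not an end of [ij], so its orientation is not 0. No two vertices have
     opposite signs, so the three orientations cannot add up to 0. *)
  have [w [hw wi wj]] : exists w, [/\ (w == u) || (w == v) || (w == a), w != i & w != j].
    have [ui|ui] := eqVneq u i; have [vj|vj] := eqVneq v j; subst.
    - by exists a; rewrite eqxx !orbT; split=> //; rewrite eq_sym.
    - have [vi|vi] := eqVneq v i; first by move: uv; rewrite vi eqxx.
      by exists v; rewrite eqxx orbT.
    - have [uj|uj] := eqVneq u j; first by move: uv; rewrite uj eqxx.
      by exists u; rewrite eqxx.
    - have [uj|uj] := eqVneq u j; last by exists u; rewrite eqxx.
      have [vi|vi] := eqVneq v i; last by exists v; rewrite eqxx orbT.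
      by subst; exists a; rewrite eqxx !orbT; split=> //; rewrite eq_sym.
  have ow : o i j (p w) != 0 by apply: orient_neq0 => //; rewrite eq_sym.
  have [n1 n3 n4] := nx _ _ sD.
  have n1' := noncrossing_weak ij n1; have n3' := noncrossing_weak ij n3.
  have n4' := noncrossing_weak ij n4.
  have sq w' : 0 <= o i j (p w') * o i j (p w') by rewrite -expr2 sqr_ge0.
  have ww : 0 < o i j (p w) * o i j (p w) by rewrite -expr2 exprn_even_gt0.
  move: o0; rewrite oE => o0.
  have : (o i j (p u) + o i j (p v) + o i j (p a)) * o i j (p w) = 0.
    by apply/eqP; rewrite mulf_eq0 (negbTE ow) orbF; apply/eqP; lra.
  by move: ww; case/orP: hw => [/orP[]|] /eqP->; move: n1' n3' n4';
    move: (o i j (p u)) (o i j (p v)) (o i j (p a)) => A B E; nra.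
have inC w w' : (w == u) || (w == v) || (w == a) -> (w' == u) || (w' == v) || (w' == a) ->
    w != w' -> hull p [set w; w']%SET `<=` closure (connected_component cut x).
  move=> hw hw' ww' y; rewrite hull_pairE // => -[t /= t01 <-].
  rewrite in_itv /= in t01; have [t0 t1] := andP t01.
  have od z : (z == u) || (z == v) || (z == a) -> odd z by case/orP => [/orP[]|] /eqP->.
  apply: weak_side_closure => //.
    by apply: polygon_convex => //; apply: polygon_vertex; exact: od.
  move=> i j ijD; rewrite orient_seg mulrDr mulrCA [X in _ + X]mulrCA.
  by rewrite addr_ge0 // mulr_ge0 ?subr_ge0 // weak.
exists (closure (connected_component cut x)); split.
- by exists x.
- by apply: inC; rewrite ?eqxx ?orbT.
- by apply: inC; rewrite ?eqxx ?orbT.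
move=> uvD y yC; have := closure_weak_side xcut yC uvD.
rewrite oE orientaa orientbb !add0r => h.
by move: h; rewrite -mulrA mulrCA mulrC pmulr_lge0 ?invr_gt0 ?ltr0n // mulrC.
Qed.

(** A diagonal other than [uv] misses an end of [uv], which lies in both cells and strictly on one
    side of the diagonal; for [uv] itself, [a] and [c] decide. So the two cells have the same
    signs. *)
Lemma cell_unique u v a c C C' : [set u; v]%SET \in D ->
  cell p true D C -> cell p true D C' ->
  hull p [set u; v]%SET `<=` C -> hull p [set u; v]%SET `<=` C' ->
  C (p a) -> C' (p c) -> 0 < o u v (p a) * o u v (p c) -> C = C'.
Proof.
move=> uvD [x xcut ->] [x' x'cut ->] uvC uvC' aC cC' ac.
have [uv ou ov] := D_hollow uvD.
suff xx' : connected_component cut x x' by rewrite (same_connected_component xx').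
apply: same_side_component => //; first by case: x'cut.
move=> i j ijD; have [ij oi oj] := D_hollow ijD.
have pos (A B W W' : R) : A != 0 -> B != 0 -> 0 <= A * W -> 0 <= B * W' -> 0 < W * W' ->
  0 < A * B.
  move=> A0 B0 AW BW WW.
  have /andP[W0 W'0] : (W != 0) && (W' != 0) by rewrite -negb_or -mulf_eq0 gt_eqF.
  have AW' : 0 < A * W by rewrite lt_def mulf_neq0.
  have BW' : 0 < B * W' by rewrite lt_def mulf_neq0.
  have : 0 < (A * B) * (W * W') by rewrite mulrACA mulr_gt0.
  by rewrite pmulr_lgt0.
have nx := cut_orient_neq0 ijD xcut; have nx' := cut_orient_neq0 ijD x'cut.
have [E|ne] := eqVneq [set i; j]%SET [set u; v]%SET.
  apply: (pos _ _ _ _ nx nx' (closure_weak_side xcut aC ijD) (closure_weak_side x'cut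
    cC' ijD)).
  have [[-> ->]//|[-> ->]] := set2_eq E ij.
  by rewrite !(orient_swap (p v)) mulrNN.
have [w [wC wC' wi wj]] : exists w, [/\ closure (connected_component cut x) (p w),
    closure (connected_component cut x') (p w), w != i & w != j].
  have [uij|/norP[ui uj]] := boolP ((u == i) || (u == j)); last first.
    by exists u; split=> //; [apply: uvC|apply: uvC']; exact: hull_left.
  exists v; split; [by apply: uvC; exact: hull_right|by apply: uvC'; exact: hull_right| |].
    apply: contraNneq ne => vi; case/orP: uij => /eqP uE; first by move: uv;
      rewrite uE vi eqxx.
    by rewrite uE vi finset.setUC.
  apply: contraNneq ne => vj; case/orP: uij => /eqP uE; last by move: uv;
    rewrite uE vj eqxx.
  by rewrite uE vj.
apply: (pos _ _ _ _ nx nx' (closure_weak_side xcut wC ijD) (closure_weak_side x'cut wC'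
  ijD)).
rewrite -expr2 exprn_even_gt0 //=.
by apply: orient_neq0 => //; rewrite eq_sym.
Qed.

End Cells.

(** * The sign function and shear coordinates *)

Definition overline_rel n (D : {set diag n}) : rel (label n) :=
  fun h k => [set h; k]%SET \in overline true D.

Section Zeta.
Variables (R : realType) (n : nat) (p : label n -> (R * R)%type).
Hypothesis n2 : (2 <= n)%N.
Hypothesis p_cw : clockwise_on_circle p.
Implicit Types (a b c d i j h k l r u v z : label n) (f : diag n) (x y : (R * R)%type).
Variable D : {set diag n}.
Hypothesis D_diss : dissection p true D.
Variable m : rel (label n).
Hypothesis mM : maximal_noncrossing m.
Local Notation db := (overline_rel D).
Hypothesis db_m : forall h k, db h k -> m h k.
Variables z1 z2 : label n.
Hypothesis z12 : z1 != z2.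
Hypothesis odd1 : odd z1 = false.
Hypothesis odd2 : odd z2 = false.
Local Notation e := [set z1; z2]%SET.
Local Notation cut h k := (sp z1 z2 h k).

(** Treats both shapes at once: by conversion, [turn true] and [turn false] are the predicates of
    the Z and of the S in [zeta]. *)
Definition turn (s : bool) : pred R := fun t => if s then t < 0 else 0 < t.

Lemma turn_orient s u v a : u != v -> v != a -> u != a ->
  turn s (orient (p u) (p v) (p a)) = (cw u v a == s).
Proof.
move=> uv va ua; rewrite /turn; case: (boolP (cw u v a)) => h; case: s => //=.
- by rewrite (orient_lt0 p_cw).
- by rewrite ltNge ltW // (orient_lt0 p_cw).
- by rewrite ltNge ltW // (orient_gt0 p_cw).
- by rewrite (orient_gt0 p_cw).
Qed.

Lemma overlineC h k : db h k = db k h.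
Proof. by rewrite /overline_rel finset.setUC. Qed.

Lemma D_overline h k : [set h; k]%SET \in D -> db h k.
Proof. by move=> hk; rewrite /overline_rel !inE hk. Qed.

Lemma cross_cut h k : db h k -> cross p e [set h; k]%SET <-> cut h k.
Proof.
move=> /(overline_hollow D_diss); rewrite diagonal_set2 => /and3P[hk /eqP oh /eqP ok].
rewrite -(cross_solid p_cw (z1 := z1) (z2 := z2)) // /cross.
by rewrite setIC.
Qed.

(** The outer sides [ua] and [vc] of the path come from [linked_side], used on each side of [uv].
    The cells are those of the triangles [uva] and [vuc], distinct because these lie on opposite
    sides of [uv]. *)
Lemma linked_bent s u v b d : [set u; v]%SET \in D -> linked db z1 z2 ->
  m u b -> m b v -> m v d -> m d u -> cw u v b == s -> cw u v d != s ->
  cut u v -> cut u b -> cut v d -> bent_path p (turn s) true D [set u; v]%SET e.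
Proof.
move=> uvD L mub mbv mvd mdu bs ds cuv cub cvd.
have duv := D_overline uvD; have muv := db_m duv.
have [ou ov uv] := mn_hollow mM muv.
have vu : v != u by rewrite eq_sym.
have mvu : m v u by rewrite (mn_sym mM).
have dvu : db v u by rewrite overlineC.
have cvu : cut v u by rewrite cutC.
have ds' : cw v u d == s by move: ds; rewrite (cwC d uv); case: (cw v u d); case: (s).
have adj z l r : odd z = false -> adjacent z l r -> db l r.
  by move=> oz /(adjacent_boundary n2 oz) bd; rewrite /overline_rel !inE bd orbT.
have dsym : symmetric db by exact: overlineC.
have [a [/andP[dua cua] /and3P[au av as_] nxa]] :=
  linked_side mM dsym db_m adj z12 odd1 odd2 muv mub mbv cuv bs cub L duv.
have [c [/andP[dvc cvc] /and3P[cv cu cs] nxc]] :=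
  linked_side mM dsym db_m adj z12 odd1 odd2 mvu mvd mdu cvu ds' cvd L dvu.
have [_ oa _] := mn_hollow mM (db_m dua); have [_ oc _] := mn_hollow mM (db_m dvc).
have va : v != a by rewrite eq_sym. have uc : u != c by rewrite eq_sym.
have nx i j h k : [set i; j]%SET \in D -> db h k -> ~~ xing i j h k.
  by move=> /D_overline/db_m mij /db_m mhk; exact: (mn_noncrossing mM mij mhk).
have [C [cC uvC auC Cside]] : exists C, [/\ cell p true D C, hull p [set u; v]%SET `<=` C,
    hull p [set a; u]%SET `<=` C &
    [set u; v]%SET \in D -> forall y, C y -> 0 <= orient (p u) (p v) (p a) * orient (p
      u) (p v) y].
  apply: triangle_cell => // i j ijD; split; first exact: nx.
    exact: nxa (D_overline ijD).
  by rewrite xingCr; exact: nx.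
have [C' [cC' vuC' cvC' _]] : exists C, [/\ cell p true D C, hull p [set v; u]%SET `<=` C,
    hull p [set c; v]%SET `<=` C &
    [set v; u]%SET \in D -> forall y, C y -> 0 <= orient (p v) (p u) (p c) * orient (p
      v) (p u) y].
  apply: triangle_cell => // i j ijD; split; first exact: nx.
    exact: nxc (D_overline ijD).
  by rewrite xingCr; exact: nx.
split; first exact/(cross_cut duv).
exists C, C', u, v, a, c; split=> //.
- move=> CC'; have /(Cside uvD) : C (p c) by rewrite CC'; apply: cvC'; exact: hull_left.
  rewrite leNgt (orient_opposite p_cw uv) //.
  have : cw u v a != cw u v c.
    by rewrite (eqP as_) (cwC c uv) (eqP cs); case: (s).
  by rewrite cw_side ?negbK.
- have dau : db a u by rewrite overlineC.
  split=> //.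
    by apply/eqP => /set2_eq/(_ au)[[E _]|[E _]]; [move: au|move: av]; rewrite E eqxx.
  by apply/(cross_cut dau); rewrite cutC.
- have vc : v != c by rewrite eq_sym.
  rewrite (finset.setUC [set v]%SET) in vuC'; rewrite (finset.setUC [set c]%SET) in cvC'.
  split=> //.
    by apply/eqP => /set2_eq/(_ vc)[[E _]|[_ E]]; [move: vu|move: cu]; rewrite E eqxx.
  by apply/(cross_cut dvc).
by rewrite turn_orient // eq_sym.
Qed.

Lemma turn_cut s u v b d a c : m u v -> m u b -> m b v -> m v d -> m d u ->
  cw u v b == s -> cw u v d != s -> cut u v ->
  m u a -> a != v -> cw u v a == s -> cut u a ->
  m v c -> c != u -> cw u v c != s -> cut v c -> cut u b /\ cut v d.
Proof.
move=> muv mub mbv mvd mdu bs ds cuv mua av as_ cua mvc cu cs cvc.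
have uv := mn_neq mM muv; have vu : v != u by rewrite eq_sym.
have mvu : m v u by rewrite (mn_sym mM).
have cvu : cut v u by rewrite cutC.
have flip w : cw u v w != s -> cw v u w == s.
  by rewrite (cwC w uv); case: (cw v u w); case: (s).
split.
  apply: (right_end mM odd1 odd2 muv mub mbv cuv bs mua _ cua).
  by rewrite /strictly_on av as_ eq_sym (mn_neq mM mua).
apply: (right_end mM odd1 odd2 mvu mvd mdu cvu (flip _ ds) mvc _ cvc).
by rewrite /strictly_on cu flip // eq_sym (mn_neq mM mvc).
Qed.

(** The two cells of the path differ, so by [cell_unique] the outer ends [a] and [c] are on opposite
    sides of [uv], and [turn_cut] passes from the sides of the cells to those of the triangles. The
    path may name the ends of [uv] in either order, whence two cases. *)
Lemma bent_cut s u v b d : [set u; v]%SET \in D ->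
  m u b -> m b v -> m v d -> m d u -> cw u v b == s -> cw u v d != s ->
  bent_path p (turn s) true D [set u; v]%SET e ->
  [/\ cut u v, cut u b & cut v d].
Proof.
move=> uvD mub mbv mvd mdu bs ds [/(cross_cut (D_overline uvD)) cuv].
have duv := D_overline uvD; have muv := db_m duv.
move=> [C [C' [u' [v' [a [c [CC' [uv' E] [[cC uvC] dau au_uv cr_au auC] [[cC' uvC'] dvc
  vc_uv cr_vc vcC'] sa]]]]]]].
have uv : u != v := mn_neq mM muv.
have uvD' : [set u'; v']%SET \in D by rewrite -E.
have dua : db u' a by rewrite overlineC.
have mua := db_m dua; have mvc := db_m dvc.
have ua := mn_neq mM mua; have vc := mn_neq mM mvc.
have av : a != v'.
  by apply: contraNneq au_uv => ->; rewrite E finset.setUC.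
have cu : c != u'.
  by apply: contraNneq vc_uv => ->; rewrite E finset.setUC.
have va : v' != a by rewrite eq_sym.
have au : a != u' by rewrite eq_sym.
have cv : c != v' by rewrite eq_sym.
have as_ : cw u' v' a == s by rewrite -turn_orient.
have cs : cw u' v' c != s.
  apply: contra_notN CC' => cs; rewrite E in uvC uvC'.
  apply: (cell_unique n2 p_cw D_diss uvD' cC cC' uvC uvC' (a := a) (c := c)).
  - by apply: auC; exact: hull_left.
  - by apply: vcC'; exact: hull_right.
  by apply: (orient_same_side p_cw) => //; rewrite -cw_side // (eqP as_) eq_sym.
have cua : cut u' a by apply/(cross_cut dua); rewrite (finset.setUC [set u']%SET).
have cvc : cut v' c by apply/(cross_cut dvc).
have [[uE vE]|[uE vE]] := set2_eq E uv; subst u' v'.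
  have [cub cvd] := turn_cut muv mub mbv mvd mdu bs ds cuv mua av as_ cua mvc cu cs cvc.
  by split.
have sw (x y : label n) : m x y -> m y x by rewrite (mn_sym mM).
have flip w : (cw v u w == s) = (cw u v w != s).
  by rewrite (cwC w uv); case: (cw v u w); case: (s).
have ds' : cw v u d == s by rewrite flip.
have bs' : cw v u b != s by rewrite flip negbK.
have cvu : cut v u by rewrite cutC.
have [cvd cub] := turn_cut (sw _ _ muv) mvd mdu mub mbv ds' bs' cvu mua av as_ cua mvc
  cu cs cvc.
by split.
Qed.

(** A Z amounts to leaving the two triangles through [ub] and [vd], an S through [ud] and [vb];
    these are the two ways of splitting the quadrilateral. *)
Theorem zeta_shear u v b d : [set u; v]%SET \in D -> linked db z1 z2 -> quad m u b v d ->
  zeta p true D [set u; v]%SET e = shear R e u b v d.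
Proof.
move=> uvD L /and5P[muv mub mbv mvd /and3P[mdu cwb cwd]].
have b1 : cw u v b == true by apply/eqP.
have d1 : cw u v d != true by move: cwd; case: (cw u v d).
have b0 : cw u v b != false by rewrite (eqP b1).
have d0 : cw u v d == false by move: cwd; case: (cw u v d).
have mud : m u d by rewrite (mn_sym mM).
have mdv : m d v by rewrite (mn_sym mM).
have mvb : m v b by rewrite (mn_sym mM).
have mbu : m b u by rewrite (mn_sym mM).
have A1 := linked_bent uvD L mub mbv mvd mdu b1 d1.
have A2 := bent_cut uvD mub mbv mvd mdu b1 d1.
have B1 := linked_bent uvD L mud mdv mvb mbu d0 b0.
have B2 := bent_cut uvD mud mdv mvb mbu d0 b0.
rewrite /zeta /shear /split !sepE //.
case: asboolP => [/A2[cuv cub cvd]|nA].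
  have -> : cut b v = false by move: cuv; rewrite (sp_add z1 z2 u b v) cub; case: (cut b v).
  by rewrite cub cvd subr0.
case: asboolP => [/B2[cuv cud cvb]|nB].
  have -> : cut b v by rewrite cutC.
  have -> : cut v d = false by move: cuv; rewrite (sp_add z1 z2 u d v) cud cutC;
    case: (cut v d).
  by rewrite [cut d u]cutC cud !andbF sub0r.
have -> : [&& cut u b, ~~ cut b v & cut v d] = false.
  apply/negP => /and3P[cub cbv cvd]; apply: nA; apply: A1 => //.
  by rewrite (sp_add z1 z2 u b v) cub (negbTE cbv).
have -> : [&& cut b v, ~~ cut v d & cut d u] = false.
  apply/negP => /and3P[cbv cvd cdu]; apply: nB; apply: B1 => //; last by rewrite cutC.
    by rewrite (sp_add z1 z2 u d v) [cut u d]cutC cdu [cut d v]cutC (negbTE cvd).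
  by rewrite cutC.
by rewrite subrr.
Qed.

Lemma linked_shear0 u v b d : ~~ db u v -> linked db z1 z2 -> quad m u b v d ->
  shear R e u b v d = 0.
Proof.
move=> nuv L /and5P[muv mub mbv mvd /and3P[mdu cwb cwd]].
have b1 : cw u v b == true by apply/eqP.
have d1 : cw u v d != true by move: cwd; case: (cw u v d).
have b0 : cw u v b != false by rewrite (eqP b1).
have d0 : cw u v d == false by move: cwd; case: (cw u v d).
have mud : m u d by rewrite (mn_sym mM).
have mdv : m d v by rewrite (mn_sym mM).
have mvb : m v b by rewrite (mn_sym mM).
have mbu : m b u by rewrite (mn_sym mM).
have adj z l r : odd z = false -> adjacent z l r -> db l r.
  by move=> oz /(adjacent_boundary n2 oz) bd; rewrite /overline_rel !inE bd orbT.
have dsym : symmetric db by exact: overlineC.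
have nt := linked_no_turn mM dsym db_m adj z12 odd1 odd2 L muv nuv.
rewrite /shear /split !sepE //.
have -> : [&& cut u b, ~~ cut b v & cut v d] = false.
  apply/negP => /and3P[cub cbv cvd]; apply: (nt b d true) => //.
  by rewrite (sp_add z1 z2 u b v) cub (negbTE cbv).
have -> : [&& cut b v, ~~ cut v d & cut d u] = false.
  apply/negP => /and3P[cbv cvd cdu]; apply: (nt d b false) => //; last by rewrite cutC.
    by rewrite (sp_add z1 z2 u d v) [cut u d]cutC cdu [cut d v]cutC (negbTE cvd).
  by rewrite cutC.
by rewrite subrr.
Qed.

End Zeta.

(** * A criterion for complete simplicial fans *)

Section CoordForm.
Variables (R : fieldType) (V : vectType R) (n : nat) (X : n.-tuple V) (k : 'I_n -> R).

Definition coord_form (x : V) : R := \sum_i k i * coord X i x.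

Fact coord_form_is_scalar : scalar coord_form.
Proof.
move=> a u v; rewrite /coord_form mulr_sumr -big_split; apply: eq_bigr => i _ /=.
by rewrite linearP /= mulrDr mulrCA.
Qed.

HB.instance Definition _ := GRing.isSemilinear.Build R V R _ coord_form
  (GRing.semilinear_linear coord_form_is_scalar).

End CoordForm.

Section FanCriterion.
Variables (R : realType) (V : vectType R) (E : finType) (g : E -> V).
Implicit Types (A B : {set E}) (w : E -> R) (x : V).

Definition weigh w := \sum_e w e *: g e.

(** The coefficients of [cone] are indexed by positions in a list; this transports them to [E], with
    value 0 off [A]. *)
Definition index_weight A (c : 'I_(size [seq g e | e <- enum A]) -> R) (e : E) : R :=
  if e \in A then oapp c 0 (insub (index e (enum A))) else 0.

Lemma index_weightE A (c : 'I_(size [seq g e | e <- enum A]) -> R) :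
  \sum_i c i *: [seq g e | e <- enum A]`_i = weigh (index_weight c).
Proof.
rewrite /weigh (bigID (mem A)) /= [X in _ = _ + X]big1 ?addr0; last first.
  by move=> e /negbTE eA; rewrite /index_weight eA scale0r.
have -> : \sum_(e in A) index_weight c e *: g e =
    \sum_(e <- enum A) oapp c 0 (insub (index e (enum A))) *: g e.
  by rewrite big_enum; apply: eq_bigr => e eA; rewrite /index_weight eA.
rewrite {}/index_weight; move: c (enum_uniq (mem A)); case: (enum A) => [|e0 s] c us.
  by rewrite big_ord0 big_nil.
rewrite [RHS](big_nth e0).
have sz : size [seq g e | e <- e0 :: s] = size (e0 :: s) by rewrite size_map.
rewrite -sz big_mkord; apply: eq_bigr => i _.
have i_s : (i < size (e0 :: s))%N by rewrite -sz.
by rewrite (nth_map e0) // index_uniq // valK.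
Qed.

Lemma coneE A x : cone [seq g e | e <- enum A] x <->
  exists w, [/\ forall e, 0 <= w e, forall e, e \notin A -> w e = 0 & x = weigh w].
Proof.
split=> [[c c0 ->]|[w [w0 wA ->]]].
  exists (index_weight c); split=> [e|e /negbTE eA|]; last exact: index_weightE.
    by rewrite /index_weight; case: ifP => // _; case: insub => /=.
  by rewrite /index_weight eA.
have lt (i : 'I_(size [seq g e | e <- enum A])) : (i < #|A|)%N.
  by apply: leq_trans (ltn_ord i) _; rewrite size_map -cardE.
pose c (i : 'I_(size [seq g e | e <- enum A])) := w (enum_val (Ordinal (lt i))).
exists c => [i|]; first exact: w0.
rewrite index_weightE; apply: eq_bigr => e _; congr (_ *: _).
rewrite /index_weight; case: ifPn => eA; last exact: wA.
have ilt : (index e (enum A) < size [seq g e | e <- enum A])%N.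
  by rewrite size_map index_mem mem_enum.
rewrite insubT /= /c; congr w; rewrite /enum_val /=.
have iA : (index e (enum A) < size (enum A))%N by rewrite index_mem mem_enum.
by rewrite (set_nth_default e) // nth_index // mem_enum.
Qed.

Variable ok : {set E} -> Prop.
Hypothesis ok_sub : forall A B, B \subset A -> ok A -> ok B.

Definition admissible w := (forall e, 0 <= w e) /\ ok [set e | w e != 0]%SET.

Hypothesis weigh_surj : forall x, exists2 w, admissible w & x = weigh w.
Hypothesis weigh_inj : forall w w', admissible w -> admissible w' ->
  weigh w = weigh w' -> w = w'.

Lemma admissible_sub A w : ok A -> (forall e, 0 <= w e) -> (forall e, e \notin A ->
  w e = 0) ->
  admissible w.
Proof.
move=> okA w0 wA; split=> //; apply: ok_sub okA.
by apply/fintype.subsetP => e; rewrite !inE; apply: contraNT => /wA->.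
Qed.

Lemma cone_setI A B : ok A -> ok B ->
  cone [seq g e | e <- enum A] `&` cone [seq g e | e <- enum B] =
  cone [seq g e | e <- enum (A :&: B)%SET].
Proof.
move=> okA okB; apply/seteqP; split=> x.
  move=> [/coneE[w [w0 wA ->]] /coneE[w' [w'0 w'B E']]].
  have ww' : w = w' by apply: weigh_inj => //; exact: admissible_sub w0 wA || exact:
    admissible_sub w'0 w'B.
  apply/coneE; exists w; split=> // e; rewrite inE negb_and => /orP[/wA//|].
  by rewrite ww' => /w'B.
move=> /coneE[w [w0 wAB ->]]; split; apply/coneE; exists w; split=> // e eA; apply: wAB;
  by rewrite inE (negbTE eA) ?andbF.
Qed.

(** The positive and the negative parts of a linear relation are two admissible weights with the
    same image, hence they are equal. *)
Lemma admissible_free A : ok A -> free [seq g e | e <- enum A].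
Proof.
move=> okA; pose s := [seq g e | e <- enum A].
suff : free (in_tuple s) by [].
apply/freeP => k /= k0 i.
pose kp i := Num.max (k i) 0; pose kn i := Num.max (- k i) 0.
have kE j : k j = kp j - kn j.
  rewrite /kp /kn; have [kj|kj] := lerP 0 (k j).
    by rewrite max_r ?oppr_le0 // subr0.
  by rewrite max_l ?oppr_ge0 ?ltW // sub0r opprK.
have ge0 (c : 'I_(size s) -> R) : (forall i, 0 <= c i) -> admissible (index_weight c).
  move=> c0; apply: admissible_sub okA _ _ => e; rewrite /index_weight;
    last by move/negbTE->.
  by case: ifP => // _; case: insub => /=.
have E1 : weigh (index_weight kp) = weigh (index_weight kn).
  rewrite -!index_weightE; apply/eqP; rewrite -subr_eq0 -sumrB; apply/eqP.
  by rewrite -[RHS]k0; apply: eq_bigr => j _; rewrite -scalerBl -kE.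
have := weigh_inj (ge0 kp _) (ge0 kn _) E1.
have kp0 j : 0 <= kp j by rewrite le_max lexx orbT.
have kn0 j : 0 <= kn j by rewrite le_max lexx orbT.
move=> /(_ kp0 kn0) EW.
have lt : (i < #|A|)%N.
  by apply: leq_trans (ltn_ord i) _; rewrite size_map -cardE.
pose e := enum_val (Ordinal lt).
have eA : e \in A by exact: enum_valP.
have ie : index e (enum A) = i.
  by rewrite /e /enum_val index_uniq ?enum_uniq // -cardE.
have := congr1 (fun w => w e) EW; rewrite /index_weight eA ie valK /= => kpn.
by rewrite kE kpn subrr.
Qed.

Lemma free_form A (k : E -> R) : free [seq g e | e <- enum A] ->
  exists f : {scalar V}, forall e, e \in A -> f (g e) = k e.
Proof.
move=> fr; pose s := [seq g e | e <- enum A].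
have sA : size s = #|A| by rewrite size_map -cardE.
have lt (i : 'I_(size s)) : (i < #|A|)%N by apply: leq_trans (ltn_ord i) _; rewrite sA.
exists (coord_form (in_tuple s) (fun i => k (enum_val (Ordinal (lt i))))) => e eA.
have iA : (index e (enum A) < size (enum A))%N by rewrite index_mem mem_enum.
have ilt : (index e (enum A) < size s)%N by rewrite size_map.
have gE : g e = (in_tuple s)`_(Ordinal ilt).
  by rewrite /= (nth_map e) // nth_index // mem_enum.
have coordE j : coord (in_tuple s) j (g e) = (Ordinal ilt == j)%:R.
  by rewrite gE coord_free.
rewrite /= /coord_form (bigD1 (Ordinal ilt)) //= coordE eqxx mulr1.
rewrite big1 ?addr0 => [|j /negbTE ne]; last by rewrite coordE eq_sym ne mulr0.
congr k; rewrite /enum_val /=.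
by rewrite (set_nth_default e) // nth_index // mem_enum.
Qed.

Lemma face_cone A B : ok A -> B \subset A ->
  face (cone [seq g e | e <- enum B]) (cone [seq g e | e <- enum A]).
Proof.
move=> okA BA.
(* This form is 0 on the generators in [B] and 1 on the others. *)
have [f fE] := free_form (fun e => (e \notin B)%:R) (admissible_free okA).
have fw w : (forall e, e \notin A -> w e = 0) -> f (weigh w) = \sum_e w e * (e \notin B)%:R.
  move=> wA; rewrite /weigh linear_sum; apply: eq_bigr => e _; rewrite linearZ /=.
  by have [eA|/wA->] := boolP (e \in A); [rewrite fE|rewrite !mul0r].
exists f; split=> [x /coneE[w [w0 wA ->]]|].
  by rewrite fw //; apply: sumr_ge0 => e _; rewrite mulr_ge0.
apply/seteqP; split=> x.
  move=> /coneE[w [w0 wB ->]].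
  have wA e : e \notin A -> w e = 0 by move=> eA; apply: wB; apply: contra eA;
    exact: (fintype.subsetP BA).
  split; first by apply/coneE; exists w.
  by rewrite /= fw // big1 // => e _; have [eB|/wB->] := boolP (e \in B);
    rewrite ?mulr0 ?mul0r.
move=> [/coneE[w [w0 wA ->]]]; rewrite /= fw // => /eqP.
rewrite psumr_eq0 => [|e _]; last by rewrite mulr_ge0.
move=> /allP h; apply/coneE; exists w; split=> // e eB.
by have := h e (mem_index_enum e); rewrite eB mulr1 => /eqP.
Qed.

Lemma cone_face A F : face F (cone [seq g e | e <- enum A]) ->
  exists2 B : {set E}, B \subset A & F = cone [seq g e | e <- enum B].
Proof.
move=> [f [f_ge0 ->]]; exists [set e in A | f (g e) == 0]%SET.
  by apply/fintype.subsetP => e; rewrite !inE => /andP[].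
have fg e : e \in A -> 0 <= f (g e).
  move=> eA; apply: f_ge0; apply/coneE; exists (fun e' => (e' == e)%:R).
  split=> [e'|e' e'A|]; first exact: ler0n.
    by have [e'e|//] := eqVneq e' e; move: e'A; rewrite e'e eA.
  rewrite /weigh (bigD1 e) //= eqxx scale1r big1 ?addr0 // => e' /negbTE->.
  by rewrite scale0r.
have fw w : f (weigh w) = \sum_e w e * f (g e).
  by rewrite /weigh linear_sum; apply: eq_bigr => e _; rewrite linearZ.
apply/seteqP; split=> x.
  move=> [/coneE[w [w0 wA ->]]]; rewrite /= fw => /eqP.
  rewrite psumr_eq0 => [|e _]; last first.
    by have [/fg fe|/wA->] := boolP (e \in A); [rewrite mulr_ge0|rewrite mul0r].
  move=> /allP h; apply/coneE; exists w; split=> // e.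
  rewrite inE negb_and => /orP[/wA//|nz]; apply/eqP.
  by have := h e (mem_index_enum e); rewrite mulf_eq0 (negbTE nz) orbF.
move=> /coneE[w [w0 wB ->]].
have wA e : e \notin A -> w e = 0 by move=> eA; apply: wB; rewrite inE (negbTE eA).
split; first by apply/coneE; exists w.
rewrite /= fw big1 // => e _.
have [|/wB->] := boolP (e \in [set e in A | f (g e) == 0]%SET); last by rewrite mul0r.
by rewrite inE => /andP[_ /eqP->]; rewrite mulr0.
Qed.

Theorem complete_simplicial_fan_criterion : complete_simplicial_fan
  [set C | exists2 A, ok A & C = cone [seq g e | e <- enum A]].
Proof.
split.
- split.
  + apply: (@sub_finite_set _ _ ((fun A => cone [seq g e | e <- enum A]) @` [set: {set
    E}])).
      by move=> C [A _ ->]; exists A.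
    by apply: finite_image; exact: finite_finset.
  + by move=> C [A _ ->]; exists [seq g e | e <- enum A].
  + move=> C F [A okA ->] /cone_face[B BA ->]; exists B => //; exact: ok_sub okA.
  + move=> C C' [A okA ->] [B okB ->]; rewrite cone_setI //.
    by split; apply: face_cone => //; [exact: finset.subsetIl|exact: finset.subsetIr].
- move=> C [A okA ->]; exists [seq g e | e <- enum A] => //.
  exact: admissible_free.
apply/seteqP; split=> // x _; have [w [w0 okw] ->] := weigh_surj x.
exists (cone [seq g e | e <- enum [set e | w e != 0]%SET]);
  first by exists [set e | w e != 0]%SET.
by apply/coneE; exists w; split=> // e; rewrite inE negbK => /eqP.
Qed.

End FanCriterion.

(** * The g-vector fan *)

Section GFan.
Variables (R : realType) (n : nat) (p : label n -> (R * R)%type).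
Hypothesis n2 : (2 <= n)%N.
Hypothesis p_cw : clockwise_on_circle p.
Implicit Types (a b c d h k u v x y z : label n) (e f : diag n) (w : diag n -> R).
Variable D : {set diag n}.
Hypothesis D_diss : dissection p true D.
Variable m : rel (label n).
Hypothesis mM : maximal_noncrossing m.
Hypothesis db_m : forall h k, overline_rel D h k -> m h k.

Lemma overline_rel_adjacent z l r : odd z = false -> adjacent z l r -> overline_rel D l r.
Proof. by move=> oz /(adjacent_boundary n2 oz) bd; rewrite /overline_rel !inE bd orbT. Qed.

Lemma accordion_linked z1 z2 : z1 != z2 -> odd z1 = false -> odd z2 = false ->
  accordion_diagonal p D [set z1; z2]%SET <-> linked (overline_rel D) z1 z2.
Proof.
move=> z12 o1 o2.
have nx := overline_noncrossing n2 p_cw D_diss; have hol := overline_hollow D_diss.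
split=> [[_]|L].
  exact: (connected_linked p_cw nx hol z12 o1 o2).
split; first by rewrite diagonal_set2 z12 o1 o2.
exact: (linked_connected p_cw hol z12 o1 o2 L).
Qed.

Lemma shear_accordion e a b c d : diagonal false e -> accordion_diagonal p D e ->
  quad m a b c d ->
  shear R e a b c d = if [set a; c]%SET \in D then zeta p true D [set a; c]%SET e else 0.
Proof.
move=> /diagonalP[z1 [z2 [z12 o1 o2 ->]]] /(accordion_linked z12 o1 o2) L q.
case: ifP => [acD|/negbT acD].
  by rewrite (zeta_shear n2 p_cw D_diss mM db_m z12 o1 o2 acD L q).
apply: (linked_shear0 R n2 mM db_m z12 o1 o2 _ L q).
rewrite /overline_rel !inE (negbTE acD) /=; apply/negP => bd.
have [oa ob oc od] := quad_odd mM q.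
by have /negP := boundary_noncrossing n2 bd ob od; apply; exact: quad_xing q.
Qed.

(* A boundary edge of the solid polygon isolates one hollow vertex. *)
Lemma boundary_shear e a b c d : boundary false e -> quad m a b c d ->
  shear R e a b c d = 0.
Proof.
move=> /andP[/diagonalP[z1 [z2 [z12 o1 o2 ->]]]].
move=> /exists_inP[i iz /exists_inP[j jz ij]] q.
have [oa ob oc od] := quad_odd mM q; have [ac ab bc cd da] := quad_neq mM q.
have N2 : (2 < 2 * n)%N by lia.
have oi : odd i = false by move: iz; rewrite !inE => /orP[]/eqP->.
have oj : odd j = false by move: jz; rewrite !inE => /orP[]/eqP->.
have st := mod_step (ltn_ord i) (ltn_ord j) N2 ij.
have ne : i != j.
  by apply/eqP => E; move: st; rewrite E; move: N2; clear; lia.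
have sE h k : odd h -> odd k ->
    sp z1 z2 h k = (h == i.+1 :> nat) (+) (k == i.+1 :> nat).
  move=> oh ok; have [[-> ->]|[-> ->]] : (z1 = i /\ z2 = j) \/ (z1 = j /\ z2 = i).
    by move: iz jz ne; rewrite !inE => /orP[]/eqP-> /orP[]/eqP->; rewrite ?eqxx //;
      by [left|right].
  - exact: sp_step (ltn_ord i) (ltn_ord h) (ltn_ord k) oh ok oi oj st.
  - by rewrite sp_swap; exact: sp_step (ltn_ord i) (ltn_ord h) (ltn_ord k) oh ok oi oj st.
rewrite /shear /split !sepE // !sE //.
have inj x y : x != y -> (x == i.+1 :> nat) && (y == i.+1 :> nat) = false.
  by move=> xy; apply: contraNF xy => /andP[/eqP xE /eqP yE]; apply/eqP/val_inj;
    rewrite /= xE yE.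
move: (inj _ _ ab) (inj _ _ bc) (inj _ _ cd) (inj _ _ da).
by do 4 case: (_ == _ :> nat) => //=; rewrite subrr.
Qed.

Lemma internal_xing u v : u != v -> odd u -> odd v -> ~~ boundary true [set u; v]%SET ->
  exists h k, [/\ odd h, odd k & xing u v h k].
Proof.
move=> uv ou ov; wlog lt : u v uv ou ov / (u < v)%N.
  move=> H nb; have [lt|gt|/val_inj E] := ltngtP u v; first exact: H.
    have [||h [k [oh ok x]]] := H v u _ ov ou gt; rewrite 1?eq_sym // 1?finset.setUC //.
    by exists h, k; rewrite xingC.
  by rewrite E eqxx in uv.
rewrite /boundary diagonal_set2 uv ou ov /= => nb.
have step i j : (i == u) || (i == v) -> (j == u) || (j == v) ->
  (j == i + 2 %[mod 2 * n])%N = false.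
  move=> iu ju; apply: contraNF nb => ij.
  by apply/exists_inP; exists i; rewrite ?inE //; apply/exists_inP; exists j; rewrite ?inE.
have vn := ltn_ord v; have un := ltn_ord u.
have [|||h [k [hN kN oh ok x]]] := @xing_ex (2 * n) u v _ lt vn ou ov.
- by rewrite oddM.
- by apply: contraFF (step u v _ _) => [/eqP->||]; rewrite ?eqxx ?orbT.
- by apply: contraFF (step v u _ _) => [/eqP<-||]; rewrite ?eqxx ?orbT // modnDr.
by exists (Ordinal hN), (Ordinal kN).
Qed.

Lemma quad_ex u v : [set u; v]%SET \in D -> exists b d, quad m u b v d.
Proof.
move=> uvD; have [uv ou ov] := D_hollow D_diss uvD.
have muv : m u v by apply: db_m; rewrite /overline_rel !inE uvD.
have /andP[_ nb] := D_diss.1 _ uvD.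
have [h [k [oh ok x]]] := internal_xing uv ou ov nb.
have [hu hv ku kv] : [/\ h != u, h != v, k != u & k != v].
  by case/and5P: x => uh uk vh vk _; split; rewrite eq_sym.
have S s : exists h, h \in on_side u v s.
  have ne : cw u v h != cw u v k by rewrite cw_side // negbK.
  case hs : (cw u v h == s); first by exists h; rewrite finset.in_set oh hu hv hs.
  exists k; rewrite finset.in_set ok ku kv /=.
  by move: hs ne; case: (cw u v h); case: (cw u v k); case: (s).
have [h1 /(triangle_ex mM muv)[b [mub mbv]]] := S true.
have [h2 /(triangle_ex mM muv)[d [mud mdv]]] := S false.
rewrite !finset.in_set => /and4P[_ _ _ ds] /and4P[_ _ _ bs].
exists b, d; rewrite /quad muv mub mbv (mn_sym mM v d) mdv (mn_sym mM d u) mud /=.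
by rewrite (eqP bs) (eqP ds).
Qed.

Lemma gvectorE (w : diag n -> R) (dl : {d : diag n | d \in D}) :
  weigh (gvector p D) w dl = \sum_e w e * zeta p true D (val dl) e.
Proof.
rewrite /weigh; elim/big_ind2 : _ => [|x1 x2 y1 y2 <- <-|e _]; rewrite !ffunE //.
Qed.

Lemma supported_lamination A w : accordion_dissection p D A -> (forall e, 0 <= w e) ->
  (forall e, w e != 0 -> e \in A) -> lamination w.
Proof.
move=> [[Aint Anx] _] w0 wA; split=> // [e /wA/Aint/andP[]//|v v' y y' /wA vA /wA yA].
have := Aint _ vA; have := Aint _ yA => /andP[+ _] /andP[+ _].
rewrite !diagonal_set2 => /andP[yy' _] /andP[vv' _].
apply/negP => x; have [E|ne] := eqVneq [set v; v']%SET [set y; y']%SET.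
  have [[v1 v2]|[v1 v2]] := set2_eq E vv'; move: x; rewrite v1 v2.
    exact/negP/xing_refl.
  by rewrite xingC; exact/negP/xing_refl.
by apply: (Anx _ _ vA yA ne); apply/(cross_xing p_cw vv' yy' ne).
Qed.

Lemma weigh_inj_gvector w w' A A' :
  accordion_dissection p D A -> accordion_dissection p D A' ->
  (forall e, 0 <= w e) -> (forall e, 0 <= w' e) ->
  (forall e, w e != 0 -> e \in A) -> (forall e, w' e != 0 -> e \in A') ->
  weigh (gvector p D) w = weigh (gvector p D) w' -> w = w'.
Proof.
move=> okA okA' w0 w'0 wA w'A' ww'.
have lw := supported_lamination okA w0 wA; have lw' := supported_lamination okA' w'0 w'A'.
have S w1 A1 a b c d : accordion_dissection p D A1 -> (forall e, w1 e != 0 -> e \in A1) ->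
    quad m a b c d -> \sum_e w1 e * shear R e a b c d =
    if [set a; c]%SET \in D then \sum_e w1 e * zeta p true D [set a; c]%SET e else 0.
  move=> [[Aint _] Aacc] w1A q.
  have E e : w1 e * shear R e a b c d =
      w1 e * (if [set a; c]%SET \in D then zeta p true D [set a; c]%SET e else 0).
    have [->|we] := eqVneq (w1 e) 0; first by rewrite !mul0r.
    have eA := w1A _ we; have /andP[de _] := Aint _ eA.
    by rewrite (shear_accordion de (Aacc _ eA) q).
  under eq_bigr do rewrite E.
  by case: ifP => // _; rewrite big1 // => e _; rewrite mulr0.
have U := lamination_unique n2 mM lw lw' _.
apply/funext => e; have [ie|nie] := boolP (internal false e).
  apply: U ie => a b c d q.
  have := S w A a b c d okA wA q; have := S w' A' a b c d okA' w'A' q.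
  rewrite /shear => -> ->; case: ifP => // acD.
  have := congr1 (fun x : {ffun {d : diag n | d \in D} -> R^o} =>
    x (exist (fun s : diag n => s \in D) _ acD)) ww'.
  by rewrite !gvectorE.
have z w1 A1 : accordion_dissection p D A1 -> (forall e, w1 e != 0 -> e \in A1) -> w1 e = 0.
  by move=> [[Aint _] _] w1A; apply/eqP; apply: contraNT nie => /w1A/Aint.
by rewrite (z w A) // (z w' A').
Qed.

Lemma weigh_surj_gvector (x : {ffun {d : diag n | d \in D} -> R^o}) :
  exists w, [/\ forall e, 0 <= w e, accordion_dissection p D [set e | w e != 0]%SET &
    x = weigh (gvector p D) w].
Proof.
pose X (s : diag n) : R := oapp (fun dl => x dl) 0 (insub s).
have [w lw wE] := lamination_exists mM X.
have noturn z1 z2 : z1 != z2 -> w [set z1; z2]%SET != 0 ->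
    forall a b c d, quad m a b c d -> ~~ overline_rel D a c ->
    ~~ [&& sp z1 z2 a b, ~~ sp z1 z2 b c & sp z1 z2 c d] &&
    ~~ [&& sp z1 z2 b c, ~~ sp z1 z2 c d & sp z1 z2 d a].
  move=> z12 we a b c d q nac; have [oa ob oc od] := quad_odd mM q.
  have acD : [set a; c]%SET \notin D by apply: contra nac; rewrite /overline_rel !inE => ->.
  have X0 : X [set a; c]%SET = 0 by rewrite /X insubN.
  have := wE _ _ _ _ q; rewrite X0 /shear.
  under eq_bigr do rewrite mulrBr.
  have w0 := lam_ge0 lw.
  have fin (P : diag n -> bool) : \sum_e w e * (P e)%:R = 0 -> P [set z1; z2]%SET = false.
    move/eqP; rewrite psumr_eq0 => [|e _]; last by rewrite mulr_ge0.
    move=> /allP/(_ _ (mem_index_enum [set z1; z2]%SET)).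
    by rewrite mulf_eq0 (negbTE we) /= pnatr_eq0 eqb0 => /negbTE.
  rewrite -!sepE // sumrB -!negb_or.
  (* One of the two sums vanishes term by term. Their difference being 0, so does the other, whose
     terms are nonnegative. *)
  have [z|z] := lam_split lw (quad_xing mM q) oa ob oc od.
    rewrite [X in X - _]big1 // sub0r => /eqP; rewrite oppr_eq0 => /eqP/fin.
    have : \sum_e w e * (split e a b c d)%:R = 0 by rewrite big1.
    by move=> /fin; rewrite /split => -> ->.
  rewrite [X in _ - X]big1 // subr0 => /fin.
  have : \sum_e w e * (split e b c d a)%:R = 0 by rewrite big1.
  by move=> /fin; rewrite /split => -> ->.
(* A dissection contains no boundary edges; by [boundary_shear], dropping their weight does not
   change the coordinates. *)
pose w' e := if internal false e then w e else 0.
have w'0 e : 0 <= w' e by rewrite /w'; case: ifP => // _; exact: lam_ge0.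
have w'P e : w' e != 0 -> internal false e /\ w e != 0.
  by rewrite /w'; case: ifP; rewrite ?eqxx.
have acc e : w' e != 0 -> accordion_diagonal p D e.
  move=> /w'P[/andP[/diagonalP[z1 [z2 [z12 o1 o2 ->]]] _] we].
  apply/accordion_linked => //.
  have dsym : symmetric (overline_rel D) by exact: overlineC.
  exact: (linked_of_no_turn mM dsym db_m overline_rel_adjacent z12 o1 o2 (noturn _ _ z12
    we)).
exists w'; split=> //.
  split; last by move=> e; rewrite inE => /acc.
  split=> [e|e f]; first by rewrite inE => /w'P[].
  rewrite !inE => /w'P[/andP[/diagonalP[z1 [z2 [z12 o1 o2 ->]]] _] we].
  move=> /w'P[/andP[/diagonalP[z3 [z4 [z34 o3 o4 ->]]] _] wf] ne.
  by move=> /(cross_xing p_cw z12 z34 ne); exact/negP/(lam_noncrossing lw we wf).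
apply/ffunP => dl; rewrite gvectorE.
have [u [v [dE uv]]] := D_pair D_diss (valP dl).
have uvD : [set u; v]%SET \in D by rewrite -dE (valP dl).
have [b [d q]] := quad_ex uvD.
have -> : x dl = X [set u; v]%SET by rewrite /X -dE valK.
rewrite -(wE _ _ _ _ q) dE; apply: eq_bigr => e _.
rewrite /w'; case: ifPn => [ie|nie].
  have [->|we] := eqVneq (w e) 0; first by rewrite !mul0r.
  have /andP[de _] := ie.
  by rewrite (shear_accordion de _ q) ?uvD //; apply: acc; rewrite /w' ie.
have [->|we] := eqVneq (w e) 0; first by rewrite !mul0r.
have de := lam_solid lw we.
rewrite mul0r boundary_shear ?mulr0 //.
by move: nie; rewrite /internal de /= negbK.
Qed.

End GFan.

Theorem theorem2p12 (R : realType) (n : nat) (p : label n -> (R * R)%type)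
    (D : {set diag n}) :
  (2 <= n)%N -> clockwise_on_circle p -> dissection p true D ->
  complete_simplicial_fan (gfan p D).
Proof.
move=> n2 p_cw D_diss.
have [m mM db_m] := maximal_ex n2 p_cw D_diss.
apply: (@complete_simplicial_fan_criterion _ _ _ (gvector p D) (accordion_dissection p D)).
- move=> A B /fintype.subsetP BA [[Aint Anx] Aacc]; split=> [|e /BA/Aacc//].
  by split=> [e /BA/Aint//|e f /BA eA /BA fA]; exact: Anx.
- move=> x; have [w [w0 okw ->]] := weigh_surj_gvector n2 p_cw D_diss mM db_m x.
  by exists w.
- move=> w w' [w0 okw] [w'0 okw'].
  by apply: (weigh_inj_gvector n2 p_cw D_diss mM db_m okw okw') => // e; rewrite inE.
Qed.
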